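(* Let $\{(X(t),Y(t))\}_{t\ge0}$ be a reflecting orthogonal planar random motion with speed $c>0$ and changes of direction paced by a Poisson process with rate $\lambda(t)\in C^1\bigl((0,\infty),[0,\infty)\bigr)$ such that $\Lambda(t)=\int_0^t\lambda(s)\,ds<\infty$ for all $t>0$. Then, for $|x|<ct$, the function $f$ defined by $f(x,t)\,dx=P\{X(t)\in dx,\ Y(t)=0\}$ satisfies the differential problem $$\begin{cases}\dfrac{\partial^2f}{\partial t^2}+2\lambda(t)\dfrac{\partial f}{\partial t}+\dfrac23\Bigl(\dfrac43\lambda(t)^2+\lambda'(t)\Bigr)f=c^2\dfrac{\partial^2f}{\partial x^2},\\[6pt] f(x,t)\ge0,\\[4pt] \displaystyle\int_{-ct}^{ct}f(x,t)\,dx=\frac12\bigl(e^{-2\Lambda(t)/3}-e^{-\Lambda(t)}\bigr),\end{cases}$$ and it is given by $$f(x,t)=\frac{e^{-2\Lambda(t)/3}}{4}\,\bar p\Bigl(\frac x2,t\Bigr),$$ where $\bar p(x,t)$ is the absolutely continuous component of the distribution of a one-dimensional telegraph process with rate function $\lambda(t)/3$ and velocity $c/2$.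
   Context: Directions: $d_k=(\cos(k\pi/2),\sin(k\pi/2))$, $k=0,1,2,3$, with indices taken modulo 4. The reflecting orthogonal planar random motion with speed $c$ and rate function $\lambda$ is the position $(X(t),Y(t))$ of a particle that starts at the origin at time $0$ with initial direction uniformly distributed on $\{d_0,d_1,d_2,d_3\}$, moves with velocity $c\,d_k$ as long as its current direction is $d_k$, and at each event of a non-homogeneous Poisson process with rate function $\lambda(t)$ switches from its current direction $d_k$ to one of the other three directions, each with probability $1/3$ (independently of everything else). The function $f(\cdot,t)$ is the density of the law of the motion on the open horizontal diagonal (vertices excluded) of the square $S_{ct}=\{(x,y)\in\mathbb{R}^2:|x|+|y|\le ct\}$. A one-dimensional (symmetric) telegraph process with velocity $v>0$ and rate function $\mu(t)$ is the position of a particle on $\mathbb{R}$ starting at $0$ with initial velocity $+v$ or $-v$, each with probability $1/2$, and reversing its velocity at each event of an independent non-homogeneous Poisson process with rate function $\mu(t)$.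
   Formalization: For λ only C¹, f need not have second partial derivatives, so the differential equation is proved in the sense of distributions on {t>0, |x|<ct} for every C¹ rate λ, and pointwise when λ is C² on (0,∞); f and p̄ are the continuous versions of the densities. *)

(* Defs.v *)
From HB Require Import structures.
From mathcomp Require Import all_boot all_order all_algebra.
From mathcomp Require Import all_classical all_reals all_analysis.

Set Implicit Arguments.
Unset Strict Implicit.
Unset Printing Implicit Defensive.

Import Order.TTheory GRing.Theory Num.Theory.
Import numFieldNormedType.Exports.

Local Open Scope classical_set_scope.
Local Open Scope ring_scope.

(* Only the values on (0, +oo) matter; rate may blow up at 0 as long as it stays
   integrable there. *)
Definition C1_rate (R : realType) (rate : R -> R) : Prop :=
  [/\ forall t : R, 0 < t -> 0 <= rate t,
      forall t : R, 0 < t -> derivable rate t 1,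
      forall t : R, 0 < t -> {for t, continuous (derive1 rate)} &
      forall t : R, 0 < t ->
        (@lebesgue_measure R).-integrable `]0, t] (EFin \o rate)].

Definition C2_rate (R : realType) (rate : R -> R) : Prop :=
  [/\ C1_rate rate,
      forall t : R, 0 < t -> derivable (derive1 rate) t 1 &
      forall t : R, 0 < t -> {for t, continuous (derive1 (derive1 rate))}].

Definition cumulative_rate (R : realType) (rate : R -> R) (t : R) : R :=
  \int[@lebesgue_measure R]_(s in `]0, t]) rate s.

Definition process_sigma (I Om S : Type) (J : set I) (Z : I -> Om -> S) :
    set (set Om) :=
  <<s [set A | exists i s, J i /\ A = Z i @^-1` [set s]] >>.

Definition independent_sigma (R : realType) (d : measure_display)
    (Om : measurableType d) (P : probability Om R) (F G : set (set Om)) : Prop :=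
  forall A B, F A -> G B -> P (A `&` B) = (P A * P B)%E.

(* poisson_pmf from the library is 1 for every k when its parameter is 0, hence
   the explicit weights; here m = 0 gives the Dirac mass at 0. *)
Definition poisson_weight (R : realType) (m : R) (k : nat) : R :=
  expR (- m) * m ^+ k / k`!%:R.

Record poisson_process (R : realType) (d : measure_display)
    (Om : measurableType d) (P : probability Om R) (rate : R -> R)
    (N : R -> Om -> nat) : Prop := {
  pp_measurable : forall (t : R) (k : nat), 0 <= t -> measurable (N t @^-1` [set k]);
  pp_start : forall w, N 0 w = 0%N;
  pp_nondecreasing : forall (w : Om) (s t : R), 0 <= s -> s <= t -> (N s w <= N t w)%N;
  pp_right_continuous : forall (w : Om) (t : R), 0 <= t ->
    \forall s \near t^'+, N s w = N t w;
  pp_increments : forall (n : nat) (t : nat -> R) (k : nat -> nat),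
    0 <= t 0%N -> (forall i, t i <= t i.+1) ->
    P (\bigcap_(i in `I_n) [set w | (N (t i.+1) w - N (t i) w)%N = k i]) =
    (\prod_(i < n) poisson_weight
       (cumulative_rate rate (t i.+1) - cumulative_rate rate (t i)) (k i))%:E
}.

(* D n is the index of the direction held between the n-th event and the
   following one. *)
Record reflecting_directions (R : realType) (d : measure_display)
    (Om : measurableType d) (P : probability Om R) (D : nat -> Om -> 'I_4) :
    Prop := {
  rd_measurable : forall n i, measurable (D n @^-1` [set i]);
  rd_law : forall (n : nat) (e : nat -> 'I_4),
    P (\bigcap_(j in `I_n.+1) (D j @^-1` [set e j])) =
    (4%:R^-1 * \prod_(j < n) (if e j.+1 != e j then 3%:R^-1 else 0))%:E
}.

Definition direction_angle (R : realType) (k : 'I_4) : R := k%:R * pi / 2%:R.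

Definition reflecting_orthogonal_motion (R : realType) (d : measure_display)
    (Om : measurableType d) (P : probability Om R) (c : R) (rate : R -> R)
    (X Y : R -> Om -> R) : Prop :=
  exists (N : R -> Om -> nat) (D : nat -> Om -> 'I_4),
    [/\ poisson_process P rate N,
        reflecting_directions P D,
        independent_sigma P (process_sigma [set t | 0 <= t] N)
                            (process_sigma setT D) &
        forall (t : R) (w : Om), 0 <= t ->
          X t w = \int[@lebesgue_measure R]_(s in `[0, t])
                    (c * cos (direction_angle R (D (N s w) w))) /\
          Y t w = \int[@lebesgue_measure R]_(s in `[0, t])
                    (c * sin (direction_angle R (D (N s w) w)))].

(* B w = true encodes a negative initial velocity; each event flips the sign. *)
Definition telegraph_process (R : realType) (d : measure_display)
    (Om : measurableType d) (P : probability Om R) (v : R) (rate : R -> R)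
    (W : R -> Om -> R) : Prop :=
  exists (N : R -> Om -> nat) (B : Om -> bool),
    [/\ poisson_process P rate N,
        forall b, measurable (B @^-1` [set b]) /\
                  P (B @^-1` [set b]) = (2%:R^-1)%:E,
        independent_sigma P (process_sigma [set t | 0 <= t] N)
                            (process_sigma setT (fun _ : unit => B)) &
        forall (t : R) (w : Om), 0 <= t ->
          W t w = \int[@lebesgue_measure R]_(s in `[0, t])
                    (v * (-1) ^+ (B w + N s w)%N)].

Definition cone (R : realType) (v : R) : set (R * R) :=
  [set z | 0 < z.2 /\ `|z.1| < v * z.2].

(* g x t is a density in x for each t.  Densities are only determined almost
   everywhere; the continuous version on the open cone is unique there. *)
Definition continuous_on_cone (R : realType) (v : R) (g : R -> R -> R) : Prop :=
  forall z, cone v z -> {for z, continuous (fun z : R * R => g z.1 z.2)}.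

Definition diagonal_density (R : realType) (d : measure_display)
    (Om : measurableType d) (P : probability Om R) (c : R)
    (X Y : R -> Om -> R) (f : R -> R -> R) : Prop :=
  continuous_on_cone c f /\
  forall (t : R) (A : set R), 0 < t -> measurable A ->
    A `<=` `](- (c * t)), (c * t)[ ->
    P [set w | A (X t w) /\ Y t w = 0] =
    (\int[@lebesgue_measure R]_(x in A) (f x t)%:E)%E.

(* Density of the absolutely continuous component in the Lebesgue decomposition
   of the law of W t, whose singular component is carried by the null set S. *)
Definition ac_component_density (R : realType) (d : measure_display)
    (Om : measurableType d) (P : probability Om R) (v : R)
    (W : R -> Om -> R) (p : R -> R -> R) : Prop :=
  continuous_on_cone v p /\
  forall t : R, 0 < t ->
    measurable_fun [set: R] (p^~ t) /\
    exists S : set R,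
      [/\ measurable S, @lebesgue_measure R S = 0%E &
          forall A : set R, measurable A ->
            P [set w | (A `\` S) (W t w)] =
            (\int[@lebesgue_measure R]_(x in A) (p x t)%:E)%E].

Definition dx (R : realType) (g : R -> R -> R) : R -> R -> R :=
  fun x t => derive1 (g^~ t) x.

Definition dt (R : realType) (g : R -> R -> R) : R -> R -> R :=
  fun x t => derive1 (g x) t.

Definition zero_order_coef (R : realType) (rate : R -> R) (t : R) : R :=
  2%:R / 3%:R * (4%:R / 3%:R * rate t ^+ 2 + derive1 rate t).

Definition classical_solution (R : realType) (c : R) (rate : R -> R)
    (f : R -> R -> R) : Prop :=
  forall x t, cone c (x, t) ->
    [/\ derivable (f x) t 1, derivable (dt f x) t 1,
        derivable (f^~ t) x 1, derivable ((dx f)^~ t) x 1 &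
        dt (dt f) x t + 2%:R * rate t * dt f x t
          + zero_order_coef rate t * f x t
        = c ^+ 2 * dx (dx f) x t].

Fixpoint differentiable_upto (R : realType) (k : nat) (g : R -> R -> R) : Prop :=
  continuous (fun z : R * R => g z.1 z.2) /\
  if k is k'.+1 then
    [/\ forall x t : R, derivable (g^~ t) x 1 /\ derivable (g x) t 1,
        differentiable_upto k' (dx g) & differentiable_upto k' (dt g)]
  else True.

Definition test_function (R : realType) (U : set (R * R)) (phi : R -> R -> R) :
    Prop :=
  (forall k, differentiable_upto k phi) /\
  exists K : set (R * R),
    [/\ compact K, K `<=` U & forall x t, ~ K (x, t) -> phi x t = 0].

(* f_tt + 2 rate f_t + (2/3) ((4/3) rate^2 + rate') f = c^2 f_xx in the sense of
   distributions on the open cone, so that all derivatives of f are moved to the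
   test function.  With rate only C^1, f is C^1 but need
   not have second partial derivatives, because the contribution of the paths
   with exactly one change of direction is
   exp(-Lambda(t)) (rate((t - x/c)/2) + rate((t + x/c)/2)) / (24 c). *)
Definition distributional_solution (R : realType) (c : R) (rate : R -> R)
    (f : R -> R -> R) : Prop :=
  forall phi, test_function (cone c) phi ->
    (\int[(@lebesgue_measure R \x @lebesgue_measure R)%E]_(z in cone c)
       (f z.1 z.2 *
         (dt (dt phi) z.1 z.2
          - 2%:R * dt (fun x t => rate t * phi x t) z.1 z.2
          + zero_order_coef rate z.2 * phi z.1 z.2
          - c ^+ 2 * dx (dx phi) z.1 z.2))%:E = 0)%E.

(* Main.v *)
Require Import Defs.
From HB Require Import structures.
From mathcomp Require Import all_boot all_order all_algebra.
From mathcomp Require Import all_classical all_reals all_analysis.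
From mathcomp Require Import measurable_realfun.
From mathcomp Require Import ring lra zify.

Set Implicit Arguments.
Unset Strict Implicit.
Unset Printing Implicit Defensive.

Import Order.TTheory GRing.Theory Num.Theory.
Import numFieldNormedType.Exports.

Local Open Scope classical_set_scope.
Local Open Scope ring_scope.

(** Let mu = lambda / 3, let L be the cumulative rate of lambda, and let N_t be
    the number of events up to time t.

    If the particle is on the open horizontal diagonal at time t, then almost
    surely it has turned at least once and its directions alternate between
    d_0 and d_2.  Indeed a path without events ends at a vertex, and if the
    vertical velocities of a sequence of directions are not all equal then the
    vertical displacement has no atoms ([functional_atomless]).  An alternating
    sequence with n events has probability 3^-n / 4, so the factor 3^-n turns
    the rate lambda into mu, and the abscissa is, up to a sign, c (2 p - t),
    where p is the time spent in the direction held at time t ([flight_law]).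

    The joint law of N_t and of p comes from the last-jump equation
      e^(L t) E[g(Z_t); N_t = n+1]
        = int_0^t lambda(s) e^(L s) E[g(Z_s + a_(n+1) (t - s)); N_s = n] ds
    for Z_t = int_0^t a_(N_s) ds ([last_jump]).  It is proved without jump times: when
    the final time is replaced by an intermediate time s on both sides, they
    change over a short interval by the same amount up to the square of the
    increment of s + L(s), because two events in the interval have a probability
    of this order; and a function whose increments are quadratically small is
    constant ([quadratic_modulus_const]).  Iterating the equation, e^(L t) times the
    density of p on {N_t = n+1} is k_n(p, t - p) ([sojourn_law]), where
      k_0(p, q) = lambda(q),
      k_(n+1)(p, q) = int_0^p lambda(r + q) k_n(q, r) dr.

    Let S be the sum of these kernels for the rate mu.  It satisfies
      S(p, q) = mu(q) + int_0^p mu(r + q) S(q, r) dr   ([total_kernelE]),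
    hence d_p S(p, q) = mu(p + q) S(q, p).  With u = (t + x/c) / 2 and
    v = (t - x/c) / 2 the diagonal density is
      f(x, t) = e^(-L t) / (8 c) (S(u, v) + S(v, u))   ([motion_density]),
    and the same computation for the telegraph process of rate mu and speed c/2
    gives e^(-L t / 3) / (2 c) (S(u, v) + S(v, u)) at the point x/2
    ([telegraph_law]), which is the asserted relation.  The total mass is the
    sum of e^(-L t) (L t / 3)^n / (2 n!) over n > 0 ([diagonal_mass]).

    For the differential equation, put T = S(u, v) and T' = S(v, u).  They
    satisfy the transport equations
      (d_t + c d_x) T = mu T'  and  (d_t - c d_x) T' = mu T,
    so T_tt - c^2 T_xx = mu' T' + mu^2 T, and W = T + T' solves
    W_tt - c^2 W_xx = (mu' + mu^2) W.  This is the asserted equation for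
    f = e^(-L t) W / (8 c).  For lambda of class C^1 the second derivatives of T
    need not exist, but tested against phi the equation only says that a sum of
    derivatives, along the lines of slope c and -c, of compactly supported
    functions has integral zero ([compact_support_characteristic],
    [weak_wave_half]).  For lambda of class C^2 the renewal equation can be
    differentiated under the integral sign and the computation is literal
    ([total_kernel_derive2], [wave_classical]).

    Finally S is continuous, so these expressions are the continuous versions
    of the densities, and two continuous densities of the same law agree
    ([continuous_density_unique]). *)

(** * Cumulative rates *)

(** Splitting an interval at the point where G takes its mean value halves the
    constant K, so K can be replaced by 0. With G = id this is the usual
    criterion; G(s) = s + L(s) absorbs a rate that may blow up at 0. *)
Lemma quadratic_modulus_const (R : realType) (F G : R -> R) (K a b : R) :
  a <= b -> {within `[a, b], continuous G} ->
  (forall s s', a <= s -> s <= s' -> s' <= b -> G s <= G s') ->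
  (forall s s', a <= s -> s <= s' -> s' <= b ->
     `|F s' - F s| <= K * (G s' - G s) ^+ 2) ->
  F b = F a.
Proof.
move=> ab cG ndG FG.
have halve k : forall s s', a <= s -> s <= s' -> s' <= b ->
    `|F s' - F s| <= K * 2 ^- k * (G s' - G s) ^+ 2.
  elim: k => [|k IH] s s' as_ ss' s'b.
    by rewrite expr0 invr1 mulr1; exact: FG.
  have cG' : {within `[s, s'], continuous G}.
    apply: continuous_subspaceW cG; apply: subset_itv; rewrite bnd_simp //.
  have Gss' := ndG _ _ as_ ss' s'b.
  (* The midpoint is taken in the values of G, not in the interval. *)
  have [|m] := IVT ss' cG' (v := (G s + G s') / 2).
    by rewrite (min_idPl Gss') (max_idPr Gss'); apply/andP; split; lra.
  rewrite in_itv /= => /andP[sm ms'] Gm.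
  have -> : F s' - F s = (F s' - F m) + (F m - F s) by ring.
  apply: (le_trans (ler_normD _ _)).
  apply: (le_trans (lerD (IH _ _ (le_trans as_ sm) ms' s'b)
                         (IH _ _ as_ sm (le_trans ms' s'b)))).
  rewrite Gm (exprS 2 k) le_eqVlt; apply/orP; left; apply/eqP.
  by field; rewrite expf_neq0.
apply/eqP; rewrite -subr_eq0 -normr_le0.
have cv : (fun k => K * 2 ^- k * (G b - G a) ^+ 2) @ \oo --> (K * 0 * (G b - G a) ^+ 2 : R).
  apply: cvgM; last exact: cvg_cst.
  apply: cvgM; first exact: cvg_cst.
  under eq_fun do rewrite -exprVn.
  by apply: cvg_expr; rewrite ger0_norm; lra.
rewrite mulr0 mul0r in cv.
apply: (cvgr_to_ge cv); apply: nearW => k; exact: halve.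
Qed.

Section cumulative.
Context (R : realType) (rate : R -> R).
Notation mu := (@lebesgue_measure R).
Hypothesis rate0 : forall t : R, 0 < t -> 0 <= rate t.
Hypothesis rateI : forall t : R, 0 < t -> mu.-integrable `]0, t] (EFin \o rate).
Notation L := (cumulative_rate rate).

Lemma cumulative_rate0 : L 0 = 0.
Proof. by rewrite /cumulative_rate set_itv_ge ?bnd_simp// Rintegral_set0. Qed.

Lemma rate_integrable s t : 0 <= s -> mu.-integrable `]s, t] (EFin \o rate).
Proof.
move=> s0; have [ts|st] := leP t s.
  by rewrite set_itv_ge ?bnd_simp -?leNgt//; exact: integrable_set0.
apply: integrableS (rateI (le_lt_trans s0 st)) => //.
by apply: subset_itvr; rewrite bnd_simp.
Qed.

Lemma cumulative_rateB s t : 0 <= s -> s <= t ->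
  L t - L s = \int[mu]_(r in `]s, t]) rate r.
Proof.
move=> s0 st; apply: Rintegral_itvB; rewrite ?bnd_simp//.
exact: rate_integrable.
Qed.

Lemma cumulative_rate_nd s t : 0 <= s -> s <= t -> L s <= L t.
Proof.
move=> s0 st; rewrite -subr_ge0 cumulative_rateB//; apply: Rintegral_ge0 => x /=.
by rewrite in_itv/= => /andP[sx _]; apply/rate0/(le_lt_trans s0).
Qed.

Lemma cumulative_rate_ge0 t : 0 <= t -> 0 <= L t.
Proof. by move=> t0; rewrite -cumulative_rate0 cumulative_rate_nd. Qed.

Lemma cumulative_rate_continuous t : 0 <= t -> {within `[0, t], continuous L}.
Proof.
move=> t0; have I0 := rate_integrable t (lexx 0).
have I : mu.-integrable `[0, t] (EFin \o rate).
  apply/integrableP; case/integrableP: I0 => m0 i0; split.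
    exact/emeasurable_fun_itv_obnd_cbndP.
  by rewrite -integral_itv_obnd_cbnd//; apply: measurableT_comp.
have := parameterized_integral_continuous t0 I.
apply: subspace_eq_continuous => x; rewrite inE /= in_itv/= => /andP[x0 xt].
rewrite /from_subspace /parameterized_integral /cumulative_rate -(@Rintegral_itv_obnd_cbnd R 0 (BRight x) rate)//.
exact: rate_integrable.
Qed.

Lemma cumulative_rate_derive t : 0 < t -> {for t, continuous rate} ->
  is_derive t 1 L (rate t).
Proof.
move=> t0 ct; have t1 : t < t + 1 by rewrite ltrDl.
have [] := continuous_FTC1 t1 (rate_integrable (t + 1) (lexx 0)) _ ct.
  by [].
move=> d e; rewrite -[in X in is_derive _ _ _ X]e derive1E; exact/derivableP.
Qed.

Lemma cumulative_rate_continuous_at t : 0 < t -> {for t, continuous L}.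
Proof.
move=> t0.
have ct : {within `[0, t + 1], continuous L}.
  by apply: cumulative_rate_continuous; lra.
have t1 : 0 < t + 1 by lra.
case/(continuous_within_itvP _ t1): ct => + _ _; apply.
by rewrite in_itv/= t0 ltrDl ltr01.
Qed.

End cumulative.

(** * The past of a Poisson process *)

Section poisson.
Context (R : realType) (rate : R -> R).
Notation mu := (@lebesgue_measure R).
Hypothesis rate0 : forall t : R, 0 < t -> 0 <= rate t.
Hypothesis rateI : forall t : R, 0 < t -> mu.-integrable `]0, t] (EFin \o rate).
Notation L := (cumulative_rate rate).
Context (d : measure_display) (Om : measurableType d) (P : probability Om R).
Context (N : R -> Om -> nat).
Hypothesis hN : poisson_process P rate N.

Let count_eq (l : seq (R * nat)) (w : Om) := all (fun rk => N rk.1 w == rk.2) l.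

Let time_le (a b : R * nat) := a.1 <= b.1.

Fixpoint chain_event (a : R * nat) (l : seq (R * nat)) (w : Om) : bool :=
  if l is b :: l' then
    ((N b.1 w - N a.1 w)%N == (b.2 - a.2)%N) && chain_event b l' w
  else true.

Fixpoint chain_weight (a : R * nat) (l : seq (R * nat)) : R :=
  if l is b :: l' then
    poisson_weight (L b.1 - L a.1) (b.2 - a.2) * chain_weight b l'
  else 1.

Lemma chain_weight_rcons a l b :
  chain_weight a (rcons l b) =
  chain_weight a l * poisson_weight (L b.1 - L (last a l).1) (b.2 - (last a l).2).
Proof.
elim: l a => [|x l IH] a /=; first by rewrite mulr1 mul1r.
by rewrite IH mulrA.
Qed.

Lemma chain_weightE a l :
  chain_weight a l = \prod_(i < size l) poisson_weight
    (L (nth (last a l) (a :: l) i.+1).1 - L (nth (last a l) (a :: l) i).1)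
    ((nth (last a l) (a :: l) i.+1).2 - (nth (last a l) (a :: l) i).2).
Proof.
elim: l a => [|b l IH] a; first by rewrite big_ord0.
by rewrite /= big_ord_recl /= IH.
Qed.

Lemma chain_eventE a l w : chain_event a l w <->
  forall i, (i < size l)%N ->
    (N (nth (last a l) (a :: l) i.+1).1 w - N (nth (last a l) (a :: l) i).1 w)%N =
    ((nth (last a l) (a :: l) i.+1).2 - (nth (last a l) (a :: l) i).2)%N.
Proof.
elim: l a => [|b l IH] a; first by [].
split => /=.
  by move=> /andP[/eqP e /IH h] [|i] //= il; apply: h.
move=> h; apply/andP; split; first by apply/eqP; exact: (h 0%N).
by apply/IH => i il; exact: (h i.+1).
Qed.

Lemma chain_event_probability a l : 0 <= a.1 -> path time_le a l ->
  P [set w | chain_event a l w] = (chain_weight a l)%:E.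
Proof.
move=> a0 al.
pose t i := (nth (last a l) (a :: l) i).1.
have tnd i : t i <= t i.+1.
  rewrite /t; have [il|il] := ltnP i (size l); first by move/pathP : al; apply.
  rewrite [nth _ _ i.+1]/= (nth_default _ il).
  move: il; rewrite leq_eqVlt => /predU1P[<-|il]; first by rewrite -last_nth.
  by rewrite nth_default.
rewrite chain_weightE -(@pp_increments _ _ _ _ _ _ hN (size l) t
  (fun i => ((nth (last a l) (a :: l) i.+1).2 - (nth (last a l) (a :: l) i).2)%N)) //.
congr (P _); apply/seteqP; split => w /=.
  by move=> /chain_eventE h i /= il; exact: h.
by move=> h; apply/chain_eventE => i il; exact: h.
Qed.

(** Prescribing the values along an increasing sequence of times amounts to
    prescribing the increments, provided that the values are nondecreasing. *)
Lemma count_eq_chain_event a l w : path (fun a b => (a.1 <= b.1) && (a.2 <= b.2)%N) a l ->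
  0 <= a.1 -> N a.1 w = a.2 -> count_eq l w = chain_event a l w.
Proof.
elim: l a => [//|b l IH] a /= /andP[/andP[ab1 ab2] bl] a0 Na.
have b0 := le_trans a0 ab1.
have := pp_nondecreasing hN w a0 ab1; rewrite Na => Nab.
have [Nb|Nb] := eqVneq (N b.1 w) b.2.
  by rewrite Nb eqxx (IH b).
move/eqP: Nb => Nb; apply/esym/negbTE; rewrite negb_and; apply/orP; left; apply/eqP.
by move=> e; apply: Nb; rewrite -(subnK Nab) e subnK.
Qed.

Lemma count_eq_path a l w : 0 <= a.1 -> N a.1 w = a.2 -> path time_le a l ->
  count_eq l w -> path (fun a b => (a.1 <= b.1) && (a.2 <= b.2)%N) a l.
Proof.
elim: l a => [//|b l IH] a /= a0 Na /andP[ab bl] /andP[/eqP Nb lw].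
rewrite [a.1 <= b.1]ab /= IH ?(le_trans a0) // andbT -Nb -Na.
exact: (pp_nondecreasing hN).
Qed.

Lemma count_eq_probability_rcons l s s' k j :
  path time_le (0, 0%N) (rcons l (s, k)) -> 0 <= s -> s <= s' ->
  P [set w | count_eq (rcons (rcons l (s, k)) (s', k + j)%N) w] =
  (P [set w | count_eq (rcons l (s, k)) w] * (poisson_weight (L s' - L s) j)%:E)%E.
Proof.
move=> lp s0 ss'.
have N0 w : N 0 w = 0%N by exact: (pp_start hN).
case: (pselect (exists w, count_eq (rcons l (s, k)) w)) => [[w0 hw0]|nw]; last first.
  rewrite (_ : [set w | count_eq (rcons l (s, k)) w] = set0); last first.
    by apply/seteqP; split => // w /= hw; apply: nw; exists w.
  rewrite (_ : [set w | _] = set0) ?measure0 ?mul0e //.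
  apply/seteqP; split => // w /=; rewrite {1}/count_eq all_rcons => /andP[_ hw].
  by apply: nw; exists w.
have p1 := @count_eq_path (0, 0%N) _ _ (lexx 0) (N0 w0) lp hw0.
have p2 : path (fun a b => (a.1 <= b.1) && (a.2 <= b.2)%N) (0, 0%N)
    (rcons (rcons l (s, k)) (s', k + j)%N).
  by rewrite rcons_path p1 last_rcons /= ss' leq_addr.
have lp2 : path time_le (0, 0%N) (rcons (rcons l (s, k)) (s', k + j)%N).
  by rewrite rcons_path lp last_rcons /time_le /=.
rewrite (_ : [set w | _] = [set w | chain_event (0, 0%N)
    (rcons (rcons l (s, k)) (s', k + j)%N) w]); last first.
  by apply/seteqP; split => w /=; rewrite (count_eq_chain_event p2).
rewrite (_ : [set w | count_eq _ w] =
    [set w | chain_event (0, 0%N) (rcons l (s, k)) w]); last first.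
  by apply/seteqP; split => w /=; rewrite (count_eq_chain_event p1).
rewrite !chain_event_probability // chain_weight_rcons last_rcons /=.
by rewrite EFinM addKn.
Qed.

Definition past (s : R) := process_sigma [set r | 0 <= r <= s] N.

Lemma past_measurable s A : past s A -> measurable A.
Proof.
apply: smallest_sub; first exact: sigma_algebra_measurable.
by move=> _ [i [k [/andP[i0 _] ->]]]; exact: (pp_measurable hN).
Qed.

Let past_pi (s : R) : set (set Om) :=
  [set A | exists l : seq (R * nat), all (fun rk => 0 <= rk.1 <= s) l /\
     A = [set w | count_eq l w]].

Lemma past_sub_pi s A : past s A -> <<s past_pi s >> A.
Proof.
apply: smallest_sub; first exact: smallest_sigma_algebra.
move=> _ [i [k [is_ ->]]]; apply: sub_sigma_algebra.
exists [:: (i, k)]; rewrite /count_eq /= andbT; split => //.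
by apply/seteqP; split => w /=; rewrite andbT => /eqP.
Qed.

Lemma count_measurable t k : 0 <= t -> measurable [set w | N t w = k].
Proof. by move=> t0; have := pp_measurable hN k t0. Qed.

(** Finitely many counts at times up to s are a pi-system generating the past;
    there the identity is the law of the increments, and both sides are finite
    measures in A. *)
Lemma past_increment_independent s s' k j A : 0 <= s -> s <= s' -> past s A ->
  P (A `&` [set w | N s w = k /\ N s' w = (k + j)%N]) =
  (P (A `&` [set w | N s w = k]) * (poisson_weight (L s' - L s) j)%:E)%E.
Proof.
move=> s0 ss' sA.
have s'0 := le_trans s0 ss'.
have mk := count_measurable k s0; have mkj := count_measurable (k + j) s'0.
have w0 : 0 <= poisson_weight (L s' - L s) j.
  rewrite /poisson_weight divr_ge0 ?ler0n // mulr_ge0 ?expR_ge0 // exprn_ge0 //.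
  by rewrite subr_ge0 cumulative_rate_nd.
have mkk : measurable [set w | N s w = k /\ N s' w = (k + j)%N] by exact: measurableI.
pose m1 := mrestr P mkk.
pose m2 := mscale (NngNum w0) (mrestr P mk).
rewrite [RHS]muleC; change (m1 A = m2 A).
have piP B : past_pi s B -> m1 B = m2 B.
  move=> [l [ls ->]]; rewrite /m1 /m2 /mscale /mrestr /= muleC.
  pose sl := sort (fun a b => a.1 <= b.1) l.
  have cer l' b w : count_eq (rcons l' b) w = (N b.1 w == b.2) && count_eq l' w.
    exact: all_rcons.
  have slE w : count_eq l w = count_eq sl w by rewrite /count_eq all_sort.
  have psl : path time_le (0, 0%N) (rcons sl (s, k)).
    have sls : all (fun rk => 0 <= rk.1 <= s) sl by rewrite all_sort.
    have : sorted time_le sl by apply: sort_sorted => a b; exact: le_total.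
    case: (sl) sls => [|b l'] /=; first by rewrite /time_le /= s0.
    move=> /andP[/andP[b0 bs] h] bl'; rewrite {1}/time_le /= b0 rcons_path bl' /=.
    rewrite /time_le /=; case: (lastP l') h => [//|l'' x]; rewrite all_rcons last_rcons.
    by move=> /andP[/andP[]].
  rewrite (_ : _ `&` [set w | N s w = k /\ _] =
    [set w | count_eq (rcons (rcons sl (s, k)) (s', k + j)%N) w]); last first.
    apply/seteqP; split => w /=; rewrite !cer /= slE.
      by move=> [-> [-> ->]]; rewrite !eqxx.
    by move=> /and3P[/eqP-> /eqP-> ->].
  rewrite count_eq_probability_rcons //; congr (P _ * _)%E.
  apply/seteqP; split => w /=; rewrite !cer /= slE.
    by move=> /andP[/eqP-> ->].
  by move=> [-> ->]; rewrite eqxx.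
have piI : setI_closed (past_pi s).
  move=> _ _ [l1 [h1 ->]] [l2 [h2 ->]]; exists (l1 ++ l2); rewrite all_cat h1 h2.
  split => //; apply/seteqP; split => w /=; rewrite /count_eq all_cat.
    by move=> [-> ->].
  by move=> /andP.
have piT : past_pi s setT.
  by exists [::]; split => //; apply/seteqP; split.
have pim : past_pi s `<=` measurable.
  move=> _ [l [ls ->]]; elim: l ls => [|b l IH] /=.
    by rewrite (_ : [set _ | _] = setT) //; apply/seteqP; split.
  move=> /andP[/andP[b0 _] /IH ml].
  rewrite (_ : [set _ | _] = [set w | N b.1 w = b.2] `&` [set w | count_eq l w]).
    by apply: measurableI => //; exact: count_measurable.
  apply/seteqP; split => w /=; first by move=> /andP[/eqP].
  by move=> [/eqP -> ].
have piE : [set X | past_pi s X /\ X `<=` [set: Om]] = past_pi s.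
  by apply/seteqP; split => [X []|X].
have := @g_sigma_algebra_measure_unique_trace _ _ _ (past_pi s) setT measurableT.
rewrite piE; apply => //.
- exact: piP.
- by rewrite /m1 /mrestr /= (le_lt_trans (probability_le1 _ _)) ?ltry //; exact: measurableI.
- exact: past_sub_pi.
Qed.

End poisson.

(** * Functionals of the path of the counting process *)

Section paths.
Context (R : realType) (rate : R -> R).
Notation mu := (@lebesgue_measure R).
Hypothesis rate0 : forall t : R, 0 < t -> 0 <= rate t.
Hypothesis rateI : forall t : R, 0 < t -> mu.-integrable `]0, t] (EFin \o rate).
Notation L := (cumulative_rate rate).
Context (d : measure_display) (Om : measurableType d) (P : probability Om R).
Context (N : R -> Om -> nat).
Hypothesis hN : poisson_process P rate N.

Definition additive_functional (a : nat -> R) (t : R) (w : Om) : R :=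
  \int[mu]_(s in `[0, t]) a (N s w).
Notation Z := additive_functional.

Lemma path_measurable (a : nat -> R) (t : R) (w : Om) :
  measurable_fun `[0, t] (fun s => a (N s w)).
Proof.
move=> _ B mB.
rewrite (_ : _ `&` _ = \bigcup_(k in [set k | B (a k)])
    (`[0, t] `&` [set s | N s w = k])); last first.
  apply/seteqP; split => [s [s0 Bs]|s [k Bk [s0 /= Nk]]] /=.
    by exists (N s w).
  by rewrite Nk.
apply: bigcup_measurable => k _; apply: is_interval_measurable.
move=> x y /= [+ Nx] [+ Ny] z; rewrite !in_itv/= => /andP[x0 xt] /andP[y0 yt] /andP[xz zy].
have z0 := le_trans x0 xz.
split; first by rewrite z0 (le_trans zy).
apply/eqP; rewrite eqn_leq -{1}Ny -Nx !(pp_nondecreasing hN)//.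
Qed.

Variable C : R.
Let bounded (a : nat -> R) := forall k, `|a k| <= C.

Lemma path_integrable a t w : bounded a ->
  mu.-integrable `[0, t] (EFin \o (fun s => a (N s w))).
Proof.
move=> aC; apply: measurable_bounded_integrable => //.
- by rewrite /= lebesgue_measure_itv; case: ifP => // _; rewrite -EFinD ltry.
- exact: path_measurable.
- exists C; split; first exact: num_real.
  by move=> x Cx y _; apply: (le_trans (aC _)); exact: ltW.
Qed.

Lemma additive_functionalB a s t w : bounded a -> 0 <= s -> s <= t ->
  Z a t w - Z a s w = \int[mu]_(r in `]s, t]) a (N r w).
Proof.
by move=> aC s0 st; apply: Rintegral_itvB; rewrite ?bnd_simp//; exact: path_integrable.
Qed.

Lemma path_integrable_oc a s t w : bounded a -> 0 <= s ->
  mu.-integrable `]s, t] (EFin \o (fun s => a (N s w))).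
Proof.
move=> aC s0; apply: integrableS (path_integrable t w aC) => //.
by apply: subset_itvr; rewrite bnd_simp.
Qed.

Lemma additive_functional0 a w : Z a 0 w = 0.
Proof. by rewrite /additive_functional set_itv1 Rintegral_set1. Qed.

Lemma additive_functional_const a s t w n : bounded a -> 0 <= s -> s <= t ->
  N s w = n -> N t w = n -> Z a t w = Z a s w + a n * (t - s).
Proof.
move=> aC s0 st Ns Nt; apply/eqP; rewrite addrC -subr_eq; apply/eqP.
rewrite additive_functionalB//.
rewrite (@eq_Rintegral _ _ _ _ _ (cst (a n))); last first.
  move=> r; rewrite inE /= in_itv/= => /andP[sr rt]; congr a; apply/eqP.
  have r0 := le_trans s0 (ltW sr).
  by rewrite eqn_leq -{1}Nt -Ns !(pp_nondecreasing hN)// ltW.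
rewrite Rintegral_cst//= lebesgue_measure_itv/= lte_fin.
move: st; rewrite le_eqVlt => /predU1P[->|st]; first by rewrite ltxx subrr.
by rewrite st.
Qed.

Lemma additive_functional_lipschitz a s t w : bounded a -> 0 <= s -> s <= t ->
  `|Z a t w - Z a s w| <= C * (t - s).
Proof.
move=> aC s0 st; rewrite additive_functionalB//.
apply: (le_trans (le_normr_Rintegral _ _)) => //; first exact: path_integrable_oc.
apply: (le_trans (y := \int[mu]_(r in `]s, t]) C)).
  apply: le_Rintegral => //.
  - by apply: integrable_norm; exact: path_integrable_oc.
  - apply: (path_integrable_oc (a := fun=> C)) => // k.
    by rewrite ger0_norm// (le_trans (normr_ge0 (a 0%N))).
rewrite Rintegral_cst//= lebesgue_measure_itv/= lte_fin.
move: st; rewrite le_eqVlt => /predU1P[->|st]; first by rewrite ltxx subrr.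
by rewrite st.
Qed.

End paths.

Section measurability.
Context (R : realType) (rate : R -> R).
Notation mu := (@lebesgue_measure R).
Context (d : measure_display) (Om : measurableType d) (P : probability Om R).
Context (N : R -> Om -> nat).
Hypothesis hN : poisson_process P rate N.
Notation Z := (additive_functional N).

Let gens (t : R) := [set A | exists i s, [set r | 0 <= r <= t] i /\ A = N i @^-1` [set s]].

(** By right continuity the process stays at or below k for some time after r
    when N r <= k, so the time spent in {N <= k} exceeds r. *)
Lemma occupation_gt t k (r : R) w : 0 <= r < t ->
  (r < Z (fun i => (i <= k)%N%:R) t w) = (N r w <= k)%N.
Proof.
move=> /andP[r0 rt]; have t0 := le_lt_trans r0 rt.
pose a : nat -> R := fun i => (i <= k)%N%:R.
have aC i : `|a i| <= 1 by rewrite /a; case: (i <= k)%N; rewrite ?normr1// normr0.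
have Nrk r' : 0 <= r' -> r' <= t -> (N r' w <= k)%N -> r' <= Z a t w.
  move=> r'0 r't Nk; have := additive_functionalB hN w aC r'0 r't.
  have -> : Z a r' w = r'.
    rewrite /additive_functional (@eq_Rintegral _ _ _ _ _ (cst 1)); last first.
      move=> x; rewrite inE /= in_itv/= => /andP[x0 xr].
      by rewrite /a (leq_trans _ Nk)// (pp_nondecreasing hN).
    rewrite Rintegral_cst//= lebesgue_measure_itv/= lte_fin mul1r.
    by move: r'0; rewrite le_eqVlt => /predU1P[<-|r'0]; rewrite ?ltxx// r'0 /= subr0.
  move=> h; rewrite -subr_ge0 h; apply: Rintegral_ge0 => x _.
  by rewrite /a ler0n.
apply/idP/idP => [|Nk].
  apply: contraLR; rewrite -ltnNge -leNgt => kN.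
  have h := additive_functionalB hN w aC r0 (ltW rt).
  have h0 : \int[mu]_(x in `]r, t]) a (N x w) = 0.
    rewrite (@eq_Rintegral _ _ _ _ _ (cst 0)) ?Rintegral_cst ?mul0r//.
    move=> x; rewrite inE /= in_itv/= => /andP[rx xt].
    rewrite /a leqNgt (leq_trans kN)// (pp_nondecreasing hN)// ltW//.
  move: h; rewrite h0 => /eqP; rewrite subr_eq0 => /eqP ->.
  have := additive_functional_lipschitz hN w aC (lexx 0) r0.
  by rewrite additive_functional0 !subr0 mul1r; apply: le_trans; exact: ler_norm.
have [e /= e0 he] : \forall s \near r^'+, N s w = N r w by exact: (pp_right_continuous hN).
pose r' := Num.min (r + e / 2) t.
have rr' : r < r' by rewrite /r' lt_min rt andbT ltrDl divr_gt0.
have Nr' : N r' w = N r w.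
  apply: he => //=; rewrite ltr_distlC.
  apply/andP; split; first by rewrite (lt_trans _ rr')// gtrDl oppr_lt0.
  by rewrite /r' gt_min ltrD2l gtr_pMr// invf_lt1// ltr1n.
apply: (lt_le_trans rr'); apply: Nrk; rewrite ?(le_trans r0 (ltW rr'))//.
  by rewrite /r' ge_min lexx orbT.
by rewrite Nr'.
Qed.

(** This is what makes path integrals measurable without jump times. *)
Lemma occupation_measurable t k : 0 <= t ->
  measurable_fun [set: g_sigma_algebraType (gens t)]
    (Z (fun i => (i <= k)%N%:R) t : g_sigma_algebraType (gens t) -> R).
Proof.
move=> t0; apply: (measurability _ (RGenOInfty.measurableE R)) => _ [_ [r ->] <-].
rewrite setTI; have [r0|r0] := ltP r 0.
  rewrite (_ : _ @^-1` _ = setT) //; apply/seteqP; split => // w _ /=.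
  rewrite in_itv/= andbT (lt_le_trans r0)//; apply: Rintegral_ge0 => x _.
  by rewrite ler0n.
have [tr|rt] := leP t r.
  rewrite (_ : _ @^-1` _ = set0) //; apply/seteqP; split => // w /=.
  rewrite in_itv/= andbT ltNge => /negP; apply; apply: le_trans tr.
  have aC i : `|(i <= k)%N%:R : R| <= 1 by case: (i <= k)%N; rewrite ?normr1// normr0.
  have := additive_functional_lipschitz hN w aC (lexx 0) t0.
  by rewrite additive_functional0 !subr0 mul1r; apply: le_trans; exact: ler_norm.
rewrite (_ : _ @^-1` _ = \bigcup_(i in `I_k.+1) (N r @^-1` [set i])); last first.
  apply/seteqP; split => w /=; rewrite in_itv/= andbT (occupation_gt k w (r := r)) ?r0//.
    by move=> Nk; exists (N r w).
  by move=> [i /= ik ->].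
apply: bigcup_measurable => i _; apply: sub_sigma_algebra.
by exists r, i; split => //=; rewrite r0 ltW.
Qed.

(** Summation by parts writes Z as a combination of occupation times. *)
Lemma additive_functional_eventually_const_measurable t n (a : nat -> R) : 0 <= t ->
  (forall k, (n <= k)%N -> a k = a n) ->
  measurable_fun [set: g_sigma_algebraType (gens t)]
    (Z a t : g_sigma_algebraType (gens t) -> R).
Proof.
move=> t0; elim: n a => [|n IH] a an.
  rewrite (_ : Z a t = cst (\int[mu]_(s in `[0, t]) a 0%N)).
    exact: measurable_cst.
  by apply/funext => w; apply: eq_Rintegral => x _; rewrite an.
pose b k := if (k <= n)%N then a k - (a n - a n.+1) else a n.+1.
have bn k : (n <= k)%N -> b k = b n.
  rewrite /b leqnn leq_eqVlt => /predU1P[->|nk]; first by rewrite leqnn.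
  by rewrite leqNgt nk /= subKr.
have bd (f : nat -> R) m : (forall k, (m <= k)%N -> f k = f m) ->
    exists C, forall k, `|f k| <= C.
  move=> fm; exists (\sum_(i < m.+1) `|f i|) => k.
  have [km|mk] := ltnP k m.+1.
    by rewrite (bigD1 (Ordinal km)) //= lerDl sumr_ge0.
  rewrite fm 1?ltnW// (bigD1 ord_max) //= lerDl sumr_ge0//.
have [Cb hCb] := bd _ _ bn.
have aC i : `|(i <= n)%N%:R : R| <= 1 by case: (i <= n)%N; rewrite ?normr1// normr0.
rewrite (_ : Z a t = Z b t \+ (fun w => (a n - a n.+1) * Z (fun i => (i <= n)%N%:R) t w)).
  apply: measurable_funD; first exact: IH.
  by apply: measurable_funM => //; exact: occupation_measurable.
apply/funext => w; rewrite /= /additive_functional.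
have i1 := path_integrable hN t w aC.
rewrite -RintegralZl// -RintegralD//; first last.
- exact: (integrableZl _ (a n - a n.+1) i1).
- exact: (path_integrable hN t w hCb).
apply: eq_Rintegral => x _; rewrite /b; case: leqP => [h|h].
  by rewrite mulr1 subrK.
by rewrite mulr0 addr0 an.
Qed.

(** Only a_0, ..., a_n matter on {N_t = n}, so a may be frozen after n. *)
Lemma additive_functional_past t n (a : nat -> R) (A : set R) : 0 <= t -> measurable A ->
  past N t [set w | N t w = n /\ A (Z a t w)].
Proof.
move=> t0 mA; pose b k := a (minn k n).
have bn k : (n <= k)%N -> b k = b n by move=> nk; rewrite /b minnn (minn_idPr nk).
have mZ := additive_functional_eventually_const_measurable t0 bn.
rewrite (_ : [set w | _] = (N t @^-1` [set n]) `&` (Z b t @^-1` A)).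
  have m1 : @measurable _ (g_sigma_algebraType (gens t)) (N t @^-1` [set n]).
    by apply: sub_sigma_algebra; exists t, n; split => //=; rewrite t0 lexx.
  have := mZ measurableT A mA; rewrite setTI => m2.
  exact: (measurableI _ _ m1 m2).
have ZE w : N t w = n -> Z b t w = Z a t w.
  move=> Nt; apply: eq_Rintegral => x; rewrite inE/= in_itv/= => /andP[x0 xt].
  by rewrite /b (minn_idPl _)// -Nt (pp_nondecreasing hN).
by apply/seteqP; split => w /= [Nt]; [rewrite -ZE|rewrite ZE].
Qed.

End measurability.

(** * Expectations over one increment *)

Lemma ge0_integral_mrestr (d : measure_display) (T : measurableType d) (R : realType)
  (m : {measure set T -> \bar R}) (D : set T) (mD : measurable D) (f : T -> \bar R) :
  measurable_fun setT f -> (forall x, 0 <= f x)%E ->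
  (\int[mrestr m mD]_x f x = \int[m]_(x in D) f x)%E.
Proof.
move=> mf f0; have mCD := measurableC mD.
rewrite -(setUv D) ge0_integral_setU //; last 2 first.
- by rewrite setUv.
- by rewrite disj_set2E setICr.
rewrite [X in (_ + X)%E](_ : _ = 0%E) ?adde0.
  apply: eq_measure_integral => A mA AD.
  by change (m (A `&` D) = m A); rewrite setIidl.
rewrite (@eq_measure_integral _ _ _ _ (mzero : {measure set T -> \bar R})) ?integral_measure_zero//.
move=> A mA AD; change (m (A `&` D) = 0%E); rewrite (_ : A `&` D = set0) ?measure0//.
by apply/seteqP; split => // x [/AD].
Qed.

Lemma within_continuous_modulus (R : realType) (A : set R) (f G : R -> R) (K : R) :
  (forall x y, A x -> A y -> `|f x - f y| <= K * `|G x - G y|) ->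
  {within A, continuous G} -> {within A, continuous f}.
Proof.
move=> fG /subspace_continuousP cG; apply/subspace_continuousP => x Ax.
apply/cvgrPdist_lt => e e0; have K0 : 0 < `|K| + 1 by rewrite ltr_wpDl.
have /cvgrPdist_lt /(_ (e / (`|K| + 1))) := cG x Ax.
rewrite divr_gt0 // => /(_ isT) h; near=> y.
have Ay : A y by near: y; exact: withinT.
apply: (le_lt_trans (fG _ _ Ax Ay)).
have hy : `|G x - G y| < e / (`|K| + 1) by near: y; exact: h.
apply: (@le_lt_trans _ _ ((`|K| + 1) * `|G x - G y|)).
  by rewrite ler_wpM2r// (le_trans (ler_norm _))// lerDl.
by rewrite mulrC -ltr_pdivlMr.
Unshelve. all: by end_near. Qed.

Section last_jump.
Context (R : realType) (rate : R -> R).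
Notation mu := (@lebesgue_measure R).
Hypothesis rate0 : forall t : R, 0 < t -> 0 <= rate t.
Hypothesis rateI : forall t : R, 0 < t -> mu.-integrable `]0, t] (EFin \o rate).
Notation L := (cumulative_rate rate).
Context (d : measure_display) (Om : measurableType d) (P : probability Om R).
Context (N : R -> Om -> nat).
Hypothesis hN : poisson_process P rate N.
Notation Z := (additive_functional N).

Lemma functional_event_measurable t n a (A : set R) : 0 <= t -> measurable A ->
  measurable [set w | N t w = n /\ A (Z a t w)].
Proof.
by move=> t0 mA; apply: (past_measurable hN); exact: (additive_functional_past hN).
Qed.

Lemma functional_measurable t n a : 0 <= t ->
  measurable_fun [set w | N t w = n] (Z a t).
Proof.
move=> t0 _ A mA; exact: functional_event_measurable.
Qed.

(** Z at time s and the indicator of N_s = k belong to the past of s. *)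
Lemma increment_expectation s s' k j a (h : R -> R) (B : R) :
  0 <= s -> s <= s' -> measurable_fun setT h -> (forall x, 0 <= h x <= B) ->
  \int[P]_(w in [set w | N s w = k /\ N s' w = (k + j)%N]) h (Z a s w) =
  poisson_weight (L s' - L s) j * \int[P]_(w in [set w | N s w = k]) h (Z a s w).
Proof.
move=> s0 ss' mh hB; have s'0 := le_trans s0 ss'.
pose b i := a (minn i k).
have bk i : (k <= i)%N -> b i = b k by move=> ki; rewrite /b minnn (minn_idPr ki).
have pZ := additive_functional_eventually_const_measurable hN s0 bk.
have mZ : measurable_fun setT (Z b s).
  move=> _ A mA; apply: (past_measurable hN).
  exact: (pZ measurableT A mA).
have mk := count_measurable hN k s0.
have mkk : measurable [set w | N s w = k /\ N s' w = (k + j)%N].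
  by apply: measurableI => //; exact: (count_measurable hN (k + j) s'0).
have w0 : 0 <= poisson_weight (L s' - L s) j.
  rewrite /poisson_weight divr_ge0 ?ler0n // mulr_ge0 ?expR_ge0 // exprn_ge0 //.
  by rewrite subr_ge0 cumulative_rate_nd.
have ZE w : N s w = k -> Z a s w = Z b s w.
  move=> Ns; apply: eq_Rintegral => x; rewrite inE/= in_itv/= => /andP[x0 xs].
  by rewrite /b (minn_idPl _)// -Ns (pp_nondecreasing hN).
rewrite (@eq_Rintegral _ _ _ _ _ (h \o Z b s)); last first.
  by move=> w; rewrite inE => -[/ZE ->].
rewrite [in RHS](@eq_Rintegral _ _ _ _ _ (h \o Z b s)); last first.
  by move=> w; rewrite inE => /= /ZE ->.
have mhE : measurable_fun setT (EFin \o h) by exact/measurable_EFinP.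
have hZ : measurable_fun setT (EFin \o (h \o Z b s)).
  by apply/measurable_EFinP; exact: measurableT_comp.
have h0 x : 0 <= h x by case/andP: (hB x).
rewrite /Rintegral.
rewrite -(ge0_integral_mrestr _ mkk hZ) => [|x]; last by rewrite lee_fin; exact: h0.
rewrite -(ge0_integral_mrestr _ mk hZ) => [|x]; last by rewrite lee_fin; exact: h0.
have pf (m : {measure set Om -> \bar R}) :
    (\int[m]_x (h (Z b s x))%:E = \int[pushforward m (Z b s)]_x (h x)%:E)%E.
  by rewrite [RHS]ge0_integral_pushforward// => x _; rewrite lee_fin; exact: h0.
rewrite (pf (mrestr P mkk)) (pf (mrestr P mk)).
rewrite (@eq_measure_integral _ _ _ _
  (mscale (NngNum w0) (pushforward (mrestr P mk) (Z b s)))); last first.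
  move=> A mA _.
  change (P ((Z b s @^-1` A) `&` [set w | N s w = k /\ N s' w = (k + j)%N]) =
    ((poisson_weight (L s' - L s) j)%:E * P ((Z b s @^-1` A) `&` [set w | N s w = k]))%E).
  rewrite muleC.
  apply: (past_increment_independent rate0 rateI hN) => //.
  by have := pZ measurableT A mA; rewrite setTI.
rewrite ge0_integral_mscale//=; last by move=> x _; rewrite lee_fin; exact: h0.
rewrite fineM//.
rewrite -(pf (mrestr P mk)) ge0_integral_mrestr// => [|x]; last by rewrite lee_fin; exact: h0.
apply: integrable_fin_num => //.
apply: measurable_bounded_integrable => //.
- by rewrite (le_lt_trans (probability_le1 _ _))// ltry.
- by apply: measurable_funTS; apply: measurableT_comp.
- exists B; split; first exact: num_real.
  move=> x Bx y _ /=; rewrite ger0_norm//; apply: le_trans (ltW Bx).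
  by case/andP: (hB (Z b s y)).
Qed.

Lemma increment_measurable s s' (J : set nat) : 0 <= s -> 0 <= s' ->
  measurable [set w | J (N s' w - N s w)%N].
Proof.
move=> s0 s'0; rewrite (_ : [set w | _] = \bigcup_k \bigcup_(l in [set l | J (l - k)%N])
   ([set w | N s w = k] `&` [set w | N s' w = l])).
  apply: bigcupT_measurable => k; apply: bigcup_measurable => l _.
  by apply: measurableI; exact: (count_measurable hN).
apply/seteqP; split => w /=.
  by move=> Jw; exists (N s w) => //; exists (N s' w).
by move=> [k _ [l /= Jl [-> ->]]].
Qed.

Lemma increment_law s s' j : 0 <= s -> s <= s' ->
  P [set w | (N s' w - N s w)%N = j] = (poisson_weight (L s' - L s) j)%:E.
Proof.
move=> s0 ss'.
have := pp_increments hN 1 (t := fun i => if i is 0%N then s else s') (fun=> j).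
rewrite big_ord_recl big_ord0 mulr1 /= => <-//; last by case.
congr (P _); apply/seteqP; split => w /=; first by move=> h [].
by move=> /(_ 0%N); apply.
Qed.

Lemma count_law t k : 0 <= t -> P [set w | N t w = k] = (poisson_weight (L t) k)%:E.
Proof.
move=> t0; rewrite -[L t]subr0 -(cumulative_rate0 rate) -increment_law//.
by congr (P _); apply/seteqP; split => w /=; rewrite (pp_start hN) subn0.
Qed.

Lemma probability_fine_le (A B : set Om) : measurable A -> measurable B -> A `<=` B ->
  fine (P A) <= fine (P B).
Proof.
move=> mA mB AB; apply: fine_le; rewrite ?fin_num_measure//.
by apply: le_measure; rewrite ?inE.
Qed.

(** From 1 - exp(-x) <= x. *)
Lemma increment_neq0 s s' : 0 <= s -> s <= s' ->
  fine (P [set w | (N s' w - N s w)%N <> 0%N]) <= L s' - L s.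
Proof.
move=> s0 ss'; have s'0 := le_trans s0 ss'.
have m0 : measurable [set w | (N s' w - N s w)%N = 0%N].
  exact: (increment_measurable (fun k => k = 0%N) s0 s'0).
rewrite (_ : [set w | _] = ~` [set w | (N s' w - N s w)%N = 0%N]) //.
rewrite probability_setC// increment_law// /poisson_weight /= expr0 fact0 divr1 mulr1.
have := expR_ge1Dx (- (L s' - L s)); lra.
Qed.

(** From 1 - exp(-x) (1 + x) <= x^2. *)
Lemma increment_ge2 s s' : 0 <= s -> s <= s' ->
  fine (P [set w | (2 <= N s' w - N s w)%N]) <= (L s' - L s) ^+ 2.
Proof.
move=> s0 ss'; have s'0 := le_trans s0 ss'.
have mj j : measurable [set w | (N s' w - N s w)%N = j].
  exact: (increment_measurable (fun k => k = j) s0 s'0).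
rewrite (_ : [set w | _] = ~` ([set w | (N s' w - N s w)%N = 0%N] `|`
   [set w | (N s' w - N s w)%N = 1%N])); last first.
  apply/seteqP; split => w /=.
    by move=> h [] e; rewrite e in h.
  case: (N s' w - N s w)%N => [|[|n]] // h; first by case: h; left.
  by case: h; right.
rewrite probability_setC//; last exact: measurableU.
have -> : P ([set w | (N s' w - N s w)%N = 0%N] `|` [set w | (N s' w - N s w)%N = 1%N]) =
    (poisson_weight (L s' - L s) 0 + poisson_weight (L s' - L s) 1)%:E.
  rewrite measureU//; last by apply/seteqP; split => // w /= [->].
  by rewrite EFinD -(increment_law 0 s0 ss') -(increment_law 1 s0 ss').
rewrite /poisson_weight /= expr0 fact0 divr1 mulr1 expr1.
rewrite (_ : 1`! = 1%N) // divr1.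
have x0 : 0 <= L s' - L s by rewrite subr_ge0 cumulative_rate_nd.
have := expR_ge1Dx (- (L s' - L s)).
by set x := L s' - L s in x0 *; set e := expR _; nra.
Qed.

Lemma bounded_integrable (D : set Om) (f : Om -> R) (B : R) : measurable D ->
  measurable_fun D f -> (forall w, D w -> `|f w| <= B) -> P.-integrable D (EFin \o f).
Proof.
move=> mD mf fB; apply: measurable_bounded_integrable => //.
  by rewrite (le_lt_trans (probability_le1 _ _))// ltry.
exists B; split; first exact: num_real.
by move=> x Bx w Dw /=; apply: le_trans (ltW Bx); exact: fB.
Qed.

Lemma expectation_bound (D : set Om) (f : Om -> R) (B : R) : measurable D ->
  measurable_fun D f -> (forall w, D w -> `|f w| <= B) ->
  `|\int[P]_(w in D) f w| <= B * fine (P D).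
Proof.
move=> mD mf fB; have fi := bounded_integrable mD mf fB.
apply: (le_trans (le_normr_Rintegral mD fi)).
rewrite -Rintegral_cst//; apply: le_Rintegral => //; first exact: integrable_norm.
by apply: (@bounded_integrable _ _ `|B|).
Qed.

Lemma expectationB_bound (D : set Om) (f g : Om -> R) (B e : R) : measurable D ->
  measurable_fun D f -> measurable_fun D g ->
  (forall w, D w -> `|f w| <= B) -> (forall w, D w -> `|g w| <= B) ->
  (forall w, D w -> `|f w - g w| <= e) ->
  `|\int[P]_(w in D) f w - \int[P]_(w in D) g w| <= e * fine (P D).
Proof.
move=> mD mf mg fB gB fge.
rewrite -RintegralB//; [|exact: bounded_integrable fB|exact: bounded_integrable gB].
by apply: expectation_bound => //; exact: measurable_funB.
Qed.

End last_jump.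

(** * The last-jump equation *)

Lemma poisson_weight0 (R : realType) (m : R) : poisson_weight m 0 = expR (- m).
Proof. by rewrite /poisson_weight expr0 fact0 divr1 mulr1. Qed.

Lemma poisson_weight1 (R : realType) (m : R) : poisson_weight m 1 = expR (- m) * m.
Proof. by rewrite /poisson_weight expr1 divr1. Qed.

Lemma expR_addKl (R : realType) (x y z : R) : expR x * (expR (- (x - y)) * z) = expR y * z.
Proof. by rewrite mulrA -expRD opprB addrC subrK. Qed.

Lemma expR_addKl_mul (R : realType) (x y z : R) :
  expR x * (expR (- (x - y)) * (x - y) * z) = (x - y) * (expR y * z).
Proof. by rewrite -mulrA expR_addKl; ring. Qed.

Lemma within_continuous_idD (R : realType) (A : set R) (f : R -> R) :
  {within A, continuous f} -> {within A, continuous (fun s => s + f s)}.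
Proof.
move=> /subspace_continuousP cf; apply/subspace_continuousP => x Ax.
by apply: cvgD; [exact: cvg_within_filter|exact: cf].
Qed.

Section last_jump.
Context (R : realType) (rate : R -> R).
Notation mu := (@lebesgue_measure R).
Hypothesis rate0 : forall t : R, 0 < t -> 0 <= rate t.
Hypothesis rateI : forall t : R, 0 < t -> mu.-integrable `]0, t] (EFin \o rate).
Notation L := (cumulative_rate rate).
Context (d : measure_display) (Om : measurableType d) (P : probability Om R).
Context (N : R -> Om -> nat).
Hypothesis hN : poisson_process P rate N.
Notation Z := (additive_functional N).

Variables (a : nat -> R) (C : R) (g : R -> R) (B K : R).
Hypothesis aC : forall k, `|a k| <= C.
Hypothesis gm : measurable_fun setT g.
Hypothesis gB : forall x, 0 <= g x <= B.
Hypothesis gK : forall x y, `|g x - g y| <= K * `|x - y|.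

(** The factor exp(L s) cancels the probability of having no event, which leaves
    a function whose increments come from events only. *)
Definition weighted_expectation (b t : R) (n : nat) (s : R) : R :=
  expR (L s) * \int[P]_(w in [set w | N s w = n]) g (Z a s w + b * (t - s)).
Notation W := weighted_expectation.

Let C0 : 0 <= C. Proof. exact: le_trans (normr_ge0 _) (aC 0%N). Qed.
Let B0 : 0 <= B. Proof. by case/andP: (gB 0) => /le_trans; apply. Qed.
Let K0 : 0 <= K.
Proof. by have := gK 1 0; rewrite subr0 normr1 mulr1; apply: le_trans. Qed.
Let gN x : `|g x| <= B.
Proof. by case/andP: (gB x) => g0 gb; rewrite ger0_norm. Qed.

Lemma shifted_measurable s (D : set Om) n u : 0 <= s -> D `<=` [set w | N s w = n] ->
  measurable_fun D (fun w => g (Z a s w + u)).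
Proof.
move=> s0 Dn; apply: (@measurable_funS _ _ _ _ [set w | N s w = n]) => //.
  exact: (count_measurable hN).
apply: measurableT_comp => //; apply: measurable_funD => //.
exact: (functional_measurable hN).
Qed.

Lemma weighted_expectation_stay b t n s s' : 0 <= s -> s <= s' ->
  expR (L s') * \int[P]_(w in [set w | N s w = n /\ N s' w = n]) g (Z a s w + b * (t - s)) =
  W b t n s.
Proof.
move=> s0 ss'; rewrite /W.
have := @increment_expectation _ _ rate0 rateI _ _ _ _ hN s s' n 0 a
  (fun x => g (x + b * (t - s))) B s0 ss'.
rewrite addn0 => ->; first last.
- by move=> x; exact: gB.
- by apply: measurableT_comp => //; exact: measurable_funD.
rewrite poisson_weight0; move: (\int[P]_(w in _) _) => I.
exact: expR_addKl.
Qed.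

Lemma weighted_expectation_jump b t n s s' : 0 <= s -> s <= s' ->
  expR (L s') * \int[P]_(w in [set w | N s w = n /\ N s' w = n.+1]) g (Z a s w + b * (t - s)) =
  (L s' - L s) * W b t n s.
Proof.
move=> s0 ss'; rewrite /W.
have := @increment_expectation _ _ rate0 rateI _ _ _ _ hN s s' n 1 a
  (fun x => g (x + b * (t - s))) B s0 ss'.
rewrite addn1 => ->; first last.
- by move=> x; exact: gB.
- by apply: measurableT_comp => //; exact: measurable_funD.
rewrite poisson_weight1; move: (\int[P]_(w in _) _) => I.
exact: expR_addKl_mul.
Qed.

Let fin01 (A : set Om) : measurable A -> 0 <= fine (P A) <= 1.
Proof.
move=> mA; rewrite fine_ge0//= -lee_fin fineK ?fin_num_measure//.
exact: probability_le1.
Qed.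

Let mNN k l s s' : 0 <= s -> 0 <= s' -> measurable [set w | N s w = k /\ N s' w = l].
Proof. by move=> s0 s'0; apply: measurableI; exact: (count_measurable hN). Qed.

Let gI s n u (D : set Om) : 0 <= s -> measurable D -> D `<=` [set w | N s w = n] ->
  P.-integrable D (EFin \o (fun w => g (Z a s w + u))).
Proof.
move=> s0 mD Dn; apply: (@bounded_integrable _ _ _ _ _ _ B) => //.
exact: shifted_measurable Dn.
Qed.

Let Q (b t : R) : R := expR (L t) * (2 * K * (C + `|b|) + B).

Lemma weighted_expectation_modulus b t n s s' : 0 <= s -> s <= s' -> s' <= t ->
  `|W b t n s' - W b t n s| <= Q b t * ((s' - s) + (L s' - L s)).
Proof.
move=> s0 ss' s't; have s'0 := le_trans s0 ss'.
have x0 : 0 <= L s' - L s by rewrite subr_ge0 cumulative_rate_nd.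
rewrite -(weighted_expectation_stay b t n s0 ss') /W.
have mn := count_measurable hN n s'0.
have mnn := mNN n n s0 s'0.
pose D := [set w | N s' w = n] `\` [set w | N s w = n].
have mD : measurable D by apply: measurableD => //; exact: (count_measurable hN).
have DE : [set w | N s' w = n] = [set w | N s w = n /\ N s' w = n] `|` D.
  apply/seteqP; split => w /=; last by move=> [[]|[]].
  by have [->|h] := eqVneq (N s w) n; [left|right; split => //; apply/eqP].
rewrite {1}DE Rintegral_setU//; first last.
- by apply/disj_setPS => w [[? ?] []].
- by rewrite -DE; apply: (gI (n := n)).
rewrite -mulrBr normrM ger0_norm ?expR_ge0// /Q -mulrA.
have dD : fine (P D) <= L s' - L s.
  apply: le_trans (increment_neq0 hN s0 ss').
  apply: probability_fine_le => //.
    exact: (increment_measurable hN (fun k => k <> 0%N)).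
  move=> w /= [Nn Nsn]; have := pp_nondecreasing hN w s0 ss'.
  rewrite Nn leq_eqVlt => /predU1P[e|h]; first by case: Nsn.
  by apply/eqP; rewrite subn_eq0 -ltnNge.
have h1 := @expectation_bound _ _ _ P D (fun w => g (Z a s' w + b * (t - s'))) B mD
  (shifted_measurable _ s'0 (@subDsetl _ _ _)) (fun w _ => gN _).
have h2 := @expectationB_bound _ _ _ P [set w | N s w = n /\ N s' w = n]
  (fun w => g (Z a s' w + b * (t - s'))) (fun w => g (Z a s w + b * (t - s))) B
  (K * ((C + `|b|) * (s' - s))) mnn
  (shifted_measurable _ s'0 (@subIsetr _ _ _)) (shifted_measurable _ s0 (@subIsetl _ _ _))
  (fun w _ => gN _) (fun w _ => gN _).
have {}h2 := h2 _.
have eB : 0 <= B * (s' - s) by rewrite mulr_ge0// subr_ge0.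
have e2 : 0 <= K * (C + `|b|) by rewrite mulr_ge0// addr_ge0.
apply: ler_pM; [exact: expR_ge0|exact: normr_ge0| |].
  by rewrite ler_expR; exact: cumulative_rate_nd.
rewrite addrAC; apply: (le_trans (ler_normD _ _)).
apply: (@le_trans _ _ (K * ((C + `|b|) * (s' - s)) * 1 + B * (L s' - L s))); last first.
  have := mulr_ge0 e2 x0; have := mulr_ge0 e2 (_ : 0 <= s' - s).
  by rewrite subr_ge0 => /(_ ss'); nra.
apply: lerD; last by apply: (le_trans h1); rewrite ler_wpM2l.
apply: (le_trans (h2 _)).
  move=> w _; apply: (le_trans (gK _ _)); rewrite ler_wpM2l//.
  rewrite (_ : _ - _ = (Z a s' w - Z a s w) - b * (s' - s)); last by ring.
  apply: (le_trans (ler_normB _ _)); rewrite mulrDl lerD//.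
    exact: (additive_functional_lipschitz hN).
  by rewrite normrM (@ger0_norm _ (s' - s)) ?subr_ge0.
apply: ler_wpM2l; last by case/andP: (fin01 mnn).
by rewrite mulrA mulr_ge0// subr_ge0.
Qed.

(** Up to two events in ]s, s'] and to the displacement during that interval, N
    passes from n to n+1 between s and s' with weight L s' - L s. *)
Lemma weighted_expectation_step t n s s' : 0 <= s -> s <= s' -> s' <= t ->
  `|W (a n.+1) t n.+1 s' - W (a n.+1) t n.+1 s - (L s' - L s) * W (a n.+1) t n s| <=
  Q (a n.+1) t * ((s' - s) + (L s' - L s)) ^+ 2.
Proof.
move=> s0 ss' s't; have s'0 := le_trans s0 ss'; set b := a n.+1.
have x0 : 0 <= L s' - L s by rewrite subr_ge0 cumulative_rate_nd.
rewrite -(weighted_expectation_stay b t n.+1 s0 ss').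
rewrite -(weighted_expectation_jump b t n s0 ss') /W.
have mn := count_measurable hN n.+1 s'0.
have m0 := mNN n.+1 n.+1 s0 s'0; have m1 := mNN n n.+1 s0 s'0.
(* On D at least two events occur between s and s'. *)
pose D := [set w | N s' w = n.+1] `\` ([set w | N s w = n.+1] `|` [set w | N s w = n]).
have mD : measurable D.
  by apply: measurableD => //; apply: measurableU; exact: (count_measurable hN).
have m1D := measurableU _ _ m1 mD.
have DE : [set w | N s' w = n.+1] = [set w | N s w = n.+1 /\ N s' w = n.+1] `|`
   ([set w | N s w = n /\ N s' w = n.+1] `|` D).
  apply/seteqP; split => w /=; last by move=> [[]|[[]|[]]].
  have [->|h] := eqVneq (N s w) n.+1; first by left.
  have [->|h'] := eqVneq (N s w) n; first by right; left.
  by move=> e; right; right; split => // -[] /eqP; apply/negP.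
have gD (E : set Om) : measurable E -> E `<=` [set w | N s' w = n.+1] ->
    P.-integrable E (EFin \o (fun w => g (Z a s' w + b * (t - s')))).
  by move=> mE En; apply: (gI (n := n.+1)).
rewrite {1}DE Rintegral_setU//; first last.
- by apply/disj_setPS => w [[/= N1 _] [[/= N2 _]|[_ []]]]; [rewrite N1 in N2; lia|left].
- by rewrite -DE; apply: gD.
rewrite Rintegral_setU//; first last.
- by apply/disj_setPS => w [[/= N1 _] [_ []]]; right.
- by apply: gD => // w [[]|[]].
rewrite (_ : \int[P]_(w in [set w | N s w = n.+1 /\ N s' w = n.+1])
    g (Z a s' w + b * (t - s')) =
  \int[P]_(w in [set w | N s w = n.+1 /\ N s' w = n.+1])
    g (Z a s w + b * (t - s))); last first.
  apply: eq_Rintegral => w; rewrite inE /= => -[N1 N2]; congr g.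
  by rewrite (additive_functional_const hN aC s0 ss' N1 N2) /b; ring.
have alg (e x y z y' : R) : e * (x + (y + z)) - e * x - e * y' = e * (y - y' + z).
  by ring.
rewrite alg normrM ger0_norm ?expR_ge0// /Q -mulrA.
have dD : fine (P D) <= (L s' - L s) ^+ 2.
  apply: le_trans (increment_ge2 rate0 rateI hN s0 ss').
  apply: probability_fine_le => //.
    exact: (increment_measurable hN (fun k => (2 <= k)%N)).
  move=> w /= [Nn Nsn]; have := pp_nondecreasing hN w s0 ss'.
  rewrite Nn leq_eqVlt => /predU1P[e|]; first by case: Nsn; left.
  rewrite ltnS leq_eqVlt => /predU1P[e|h]; first by case: Nsn; right.
  by rewrite ltn_subRL addn1 ltnS.
have d1 : fine (P [set w | N s w = n /\ N s' w = n.+1]) <= L s' - L s.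
  apply: le_trans (increment_neq0 hN s0 ss').
  apply: probability_fine_le => //.
    exact: (increment_measurable hN (fun k => k <> 0%N)).
  by move=> w /= [-> ->]; rewrite subSnn.
have h1 := @expectation_bound _ _ _ P D (fun w => g (Z a s' w + b * (t - s'))) B mD
  (shifted_measurable _ s'0 (@subDsetl _ _ _)) (fun w _ => gN _).
have h2 := @expectationB_bound _ _ _ P [set w | N s w = n /\ N s' w = n.+1]
  (fun w => g (Z a s' w + b * (t - s'))) (fun w => g (Z a s w + b * (t - s))) B
  (K * ((C + `|b|) * (s' - s))) m1
  (shifted_measurable _ s'0 (@subIsetr _ _ _)) (shifted_measurable _ s0 (@subIsetl _ _ _))
  (fun w _ => gN _) (fun w _ => gN _).
have {}h2 := h2 _.
have e2 : 0 <= K * (C + `|b|) by rewrite mulr_ge0// addr_ge0.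
apply: ler_pM; [exact: expR_ge0|exact: normr_ge0| |].
  by rewrite ler_expR; exact: cumulative_rate_nd.
apply: (le_trans (ler_normD _ _)).
have y0 : 0 <= s' - s by rewrite subr_ge0.
apply: (@le_trans _ _ (K * ((C + `|b|) * (s' - s)) * (L s' - L s) + B * (L s' - L s) ^+ 2)); last first.
  move: (s' - s) (L s' - L s) y0 x0 => y x y0 x0.
  rewrite [X in _ <= X](_ : _ = 2 * (K * (C + `|b|)) * (y + x) ^+ 2 + B * (y + x) ^+ 2); last by ring.
  apply: lerD; last by rewrite ler_wpM2l// ler_sqr ?nnegrE ?addr_ge0// lerDr.
  rewrite [X in X <= _](_ : _ = K * (C + `|b|) * (y * x)); last by ring.
  rewrite [X in _ <= X](_ : _ = K * (C + `|b|) * (2 * (y + x) ^+ 2)); last by ring.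
  rewrite ler_wpM2l//.
  by have := sqr_ge0 y; have := sqr_ge0 x; have := mulr_ge0 y0 x0; nra.
apply: lerD; last by apply: (le_trans h1); rewrite ler_wpM2l.
apply: (le_trans (h2 _)).
  move=> w _; apply: (le_trans (gK _ _)); rewrite ler_wpM2l//.
  rewrite (_ : _ - _ = (Z a s' w - Z a s w) - b * (s' - s)); last by ring.
  apply: (le_trans (ler_normB _ _)); rewrite mulrDl lerD//.
    exact: (additive_functional_lipschitz hN).
  by rewrite normrM (@ger0_norm _ (s' - s)) ?subr_ge0.
by apply: ler_wpM2l => //; rewrite mulrA mulr_ge0.
Qed.

Lemma weighted_expectation_bound b t n s : 0 <= s -> s <= t ->
  0 <= W b t n s <= expR (L t) * B.
Proof.
move=> s0 st; have mn := count_measurable hN n s0.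
have g0 x : 0 <= g x by case/andP: (gB x).
have h0 : 0 <= \int[P]_(w in [set w | N s w = n]) g (Z a s w + b * (t - s)).
  by apply: Rintegral_ge0 => w _; exact: g0.
rewrite /W mulr_ge0 ?expR_ge0//=.
apply: ler_pM; rewrite ?expR_ge0 ?ler_expR ?cumulative_rate_nd//.
apply: (le_trans (ler_norm _)).
apply: (le_trans (@expectation_bound _ _ _ P _ _ B mn _ _)).
- exact: (@shifted_measurable _ _ n).
- by move=> w _; exact: gN.
- by rewrite ler_piMr//; case/andP: (fin01 mn).
Qed.

Lemma weighted_expectation_continuous b t n : 0 <= t ->
  {within `[0, t], continuous (W b t n)}.
Proof.
move=> t0; apply: (@within_continuous_modulus _ _ _ (fun s => s + L s) (Q b t)).
  have H x y : 0 <= x -> x <= y -> y <= t ->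
      `|W b t n x - W b t n y| <= Q b t * `|(x + L x) - (y + L y)|.
    move=> x0 xy yt; rewrite distrC (distrC (x + _)).
    rewrite (@ger0_norm _ (y + L y - _)); last first.
      by rewrite subr_ge0 lerD// cumulative_rate_nd.
    apply: (le_trans (weighted_expectation_modulus b n x0 xy yt)).
    by rewrite le_eqVlt; apply/orP; left; apply/eqP; ring.
  move=> x y /=; rewrite !in_itv/= => /andP[x0 xt] /andP[y0 yt].
  have [xy|yx] := leP x y; first exact: H.
  by rewrite distrC (distrC (x + _)); apply: H => //; exact: ltW.
exact/within_continuous_idD/(cumulative_rate_continuous rateI t0).
Qed.

Lemma weighted_rate_integrable b t n : 0 <= t ->
  mu.-integrable `]0, t] (EFin \o (fun s => rate s * W b t n s)).
Proof.
move=> t0; apply: (@le_integrable _ _ _ mu `]0, t] _ _ (fun s => (expR (L t) * B)%:E * (rate s)%:E)%E) => //.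
- apply/measurable_EFinP; apply: measurable_funM.
    by have /(measurable_int mu)/measurable_EFinP := rate_integrable rateI t (lexx 0).
  apply: (@measurable_funS _ _ _ _ `[0, t]) => //.
    by apply: subset_itvr; rewrite bnd_simp.
  by apply: subspace_continuous_measurable_fun => //; exact: weighted_expectation_continuous.
- move=> s /=; rewrite in_itv/= => /andP[s0 st]; rewrite lee_fin [X in X <= _]normrM [X in _ <= X]normrM mulrC.
  have /andP[W0 WB] := weighted_expectation_bound b n (ltW s0) st.
  apply: ler_wpM2r; first exact: normr_ge0.
  by rewrite ger0_norm//; exact: le_trans WB (ler_norm _).
- by apply: integrableZl => //; exact: (rate_integrable rateI).
Qed.

(** The function F below has quadratically small increments, so it is constant. *)
Theorem last_jump t n : 0 <= t ->
  expR (L t) * \int[P]_(w in [set w | N t w = n.+1]) g (Z a t w) =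
  \int[mu]_(s in `]0, t]) (rate s * W (a n.+1) t n s).
Proof.
move=> t0; set b := a n.+1.
(* The equation at an intermediate time s, with the velocity b kept until t. *)
pose F s := W b t n.+1 s - \int[mu]_(r in `]0, s]) (rate r * W b t n r).
have F0 : F 0 = 0.
  rewrite /F set_itv_ge ?bnd_simp// Rintegral_set0 subr0 /W.
  rewrite (_ : [set w | N 0 w = n.+1] = set0) ?Rintegral_set0 ?mulr0//.
  by apply/seteqP; split => // w /=; rewrite (pp_start hN).
have Ft : F t = F 0.
  apply: (@quadratic_modulus_const _ F (fun s => s + L s) (2 * Q b t)) => //.
  - exact/within_continuous_idD/(cumulative_rate_continuous rateI t0).
  - by move=> s s' s0 ss' _; rewrite lerD// cumulative_rate_nd.
  move=> s s' s0 ss' s't; have s'0 := le_trans s0 ss'.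
  have st := le_trans ss' s't.
  have x0 : 0 <= L s' - L s by rewrite subr_ge0 cumulative_rate_nd.
  have y0 : 0 <= s' - s by rewrite subr_ge0.
  have Q0 : 0 <= Q b t.
    by rewrite /Q mulr_ge0 ?expR_ge0// addr_ge0// mulr_ge0 ?addr_ge0// mulr_ge0.
  have Wi := weighted_rate_integrable b n t0.
  have Wi' : mu.-integrable `]0, s'] (EFin \o (fun s => rate s * W b t n s)).
    by apply: integrableS Wi => //; apply: subset_itvl; rewrite bnd_simp.
  have Wi'' : mu.-integrable `]s, s'] (EFin \o (fun s => rate s * W b t n s)).
    by apply: integrableS Wi' => //; apply: subset_itvr; rewrite bnd_simp.
  have rI := rate_integrable rateI s' s0.
  have alg (p q x z i0' i0 i j : R) : j = i - x * z -> i0' - i0 = i ->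
      (p - i0') - (q - i0) = (p - q - x * z) - j by lra.
  have rWI : mu.-integrable `]s, s'] (EFin \o (fun r => rate r * W b t n s)).
    exact: (integrableZr _ (W b t n s) rI).
  have -> : F s' - F s = (W b t n.+1 s' - W b t n.+1 s - (L s' - L s) * W b t n s)
     - \int[mu]_(r in `]s, s']) (rate r * W b t n r - rate r * W b t n s).
    have E : \int[mu]_(r in `]s, s']) (rate r * W b t n r - rate r * W b t n s) =
        \int[mu]_(r in `]s, s']) (rate r * W b t n r) - (L s' - L s) * W b t n s.
      apply: etrans (RintegralB _ Wi'' rWI) _ => //; congr (_ - _).
      apply: etrans (RintegralZr _ _ rI) _ => //; congr (_ * _).
      by rewrite (cumulative_rateB rateI s0 ss').
    have := @Rintegral_itvB _ _ (BRight 0) _ s Wi'; rewrite !bnd_simp => /(_ s0 ss').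
    exact: (alg _ _ _ _ _ _ _ _ E).
  apply: (le_trans (ler_normB _ _)).
  apply: (@le_trans _ _ (Q b t * ((s' - s) + (L s' - L s)) ^+ 2 +
     Q b t * ((s' - s) + (L s' - L s)) * (L s' - L s))).
    apply: lerD; first exact: weighted_expectation_step.
    have Ii : mu.-integrable `]s, s'] (EFin \o (fun r => rate r * W b t n r - rate r * W b t n s)).
      exact: (integrableB _ Wi'' rWI).
    apply: (le_trans (le_normr_Rintegral _ Ii)) => //.
    rewrite [X in _ <= _ * X](cumulative_rateB rateI s0 ss') -RintegralZl//.
    apply: le_Rintegral => //; first exact: integrable_norm.
      exact: (integrableZl _ (Q b t * (s' - s + (L s' - L s))) rI).
    move=> r /=; rewrite in_itv/= => /andP[sr rs'].
    have r0 : 0 <= rate r by apply: rate0; exact: le_lt_trans s0 sr.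
    rewrite -mulrBr normrM (ger0_norm r0) mulrC; apply: ler_wpM2r => //.
    apply: (le_trans (weighted_expectation_modulus b n s0 (ltW sr) (le_trans rs' s't))).
    rewrite ler_wpM2l// lerD ?lerB// cumulative_rate_nd//.
    exact: le_trans s0 (ltW sr).
  have e1 := mulr_ge0 Q0 (mulr_ge0 (addr_ge0 y0 x0) y0).
  rewrite [X in _ <= X](_ : _ = 2 * Q b t * (s' - s + (L s' - L s)) ^+ 2); last by ring.
  have -> : Q b t * (s' - s + (L s' - L s)) ^+ 2 = Q b t * ((s' - s + (L s' - L s)) * (s' - s)) +
     Q b t * (s' - s + (L s' - L s)) * (L s' - L s) by ring.
  have -> : 2 * Q b t * (s' - s + (L s' - L s)) ^+ 2 =
     2 * (Q b t * ((s' - s + (L s' - L s)) * (s' - s))) +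
     2 * (Q b t * (s' - s + (L s' - L s)) * (L s' - L s)) by ring.
  by lra.
move: Ft; rewrite F0 /F /W subrr mulr0 => /eqP; rewrite subr_eq0 => /eqP <-.
by congr (_ * _); apply: eq_Rintegral => w _; rewrite addr0.
Qed.

End last_jump.

(** * Iterated kernels of the changes of direction *)

Section change_of_variable.
Context (R : realType).
Notation mu := (@lebesgue_measure R).

Lemma affine_measurable (a b : R) : measurable_fun setT (fun x : R => a * x + b).
Proof. by apply: measurable_funD => //; exact: measurable_funM. Qed.

(** By uniqueness of the measure, from the case of intervals. *)
Lemma lebesgue_measure_affine (a b : R) (A : set R) : a != 0 -> measurable A ->
  (`|a|%:E * mu ((fun x : R => (a * x + b)%R) @^-1` A) = mu A)%E.
Proof.
move=> a0 mA; have an0 : 0 <= `|a| by [].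
pose f (x : R) := a * x + b.
pose m1 := @measure_function_pushforward__canonical__measure_function_Measure _ _
  (measurableTypeR R) (measurableTypeR R) _ mu _ (affine_measurable a b).
apply/esym; refine (@lebesgue_measure_unique R (mscale (NngNum an0) m1) _ A mA).
move=> _ [[x y] _ <-] /=.
change (mu `]x, y] = (`|a|%:E * mu (f @^-1` `]x, y]))%E).
rewrite lebesgue_measure_itv/= lte_fin.
have [xy|yx] := ltP x y; last first.
  rewrite (_ : _ @^-1` _ = set0) ?measure0 ?mule0//.
  by apply/seteqP; split => // z /=; rewrite in_itv/= => /andP[h /(lt_le_trans h)]; rewrite ltNge yx.
have [ap|an] := ltP 0 a.
  rewrite (_ : f @^-1` _ = `](x - b) / a, (y - b) / a]%classic); last first.
    apply/seteqP; split => z /=; rewrite !in_itv/= /f.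
      by rewrite ltr_pdivrMr// ler_pdivlMr// => /andP[h1 h2]; apply/andP; split; lra.
    by rewrite ltr_pdivrMr// ler_pdivlMr// => /andP[h1 h2]; apply/andP; split; lra.
  rewrite lebesgue_measure_itv/= lte_fin ltr_pM2r ?invr_gt0// ltrD2r xy.
  rewrite gtr0_norm// -!EFinB -EFinM; congr EFin; field.
  by rewrite gt_eqF.
have {an}an : a < 0 by rewrite lt_neqAle a0.
rewrite (_ : f @^-1` _ = `[(y - b) / a, (x - b) / a[%classic); last first.
  apply/seteqP; split => z /=; rewrite !in_itv/= /f.
    by rewrite ltr_ndivlMr// ler_ndivrMr// => /andP[h1 h2]; apply/andP; split; lra.
  by rewrite ltr_ndivlMr// ler_ndivrMr// => /andP[h1 h2]; apply/andP; split; lra.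
rewrite lebesgue_measure_itv/= lte_fin ltr_nM2r ?invr_lt0// ltrD2r xy.
rewrite ltr0_norm// -!EFinB -EFinM; congr EFin; field.
by rewrite lt_eqF.
Qed.

Lemma ge0_integral_affine (a b : R) (f : R -> \bar R) : a != 0 ->
  measurable_fun setT f -> (forall x, 0 <= f x)%E ->
  (`|a|%:E * \int[mu]_x f (a * x + b)%R = \int[mu]_x f x)%E.
Proof.
move=> a0 mf f0; have an0 : 0 <= `|a| by [].
pose m1 := @measure_function_pushforward__canonical__measure_function_Measure _ _
  (measurableTypeR R) (measurableTypeR R) _ mu _ (affine_measurable a b).
have mf' : measurable_fun (setT : set (measurableTypeR R)) f by [].
have E1 : (\int[mu]_x f (a * x + b)%R = \int[m1]_x f x)%E.
  apply/esym; exact: (@ge0_integral_pushforward _ _ (measurableTypeR R)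
    (measurableTypeR R) R _ (affine_measurable a b) mu setT f measurableT mf').
have E2 := ge0_integral_mscale m1 measurableT (NngNum an0) mf' (fun x _ => f0 x).
rewrite E1 -[LHS]E2.
refine (@eq_measure_integral _ _ _ setT mu (mscale (NngNum an0) m1) f _) => A mA _.
exact: lebesgue_measure_affine.
Qed.

Lemma ge0_integral_reflect (t : R) (f : R -> \bar R) :
  measurable_fun setT f -> (forall x, 0 <= f x)%E ->
  (\int[mu]_x f (t - x)%R = \int[mu]_x f x)%E.
Proof.
move=> mf f0; rewrite -[RHS](@ge0_integral_affine (-1) t)// ?oppr_eq0 ?oner_eq0//.
rewrite normrN1 mul1e; apply: eq_integral => x _; congr f; ring.
Qed.

Lemma ge0_integral_shift (t : R) (f : R -> \bar R) :
  measurable_fun setT f -> (forall x, 0 <= f x)%E ->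
  (\int[mu]_x f (x + t)%R = \int[mu]_x f x)%E.
Proof.
move=> mf f0; rewrite -[RHS](@ge0_integral_affine 1 t)// ?oner_eq0//.
by rewrite normr1 mul1e; under [RHS]eq_integral do rewrite mul1r.
Qed.

Lemma integral_itvoo_bool (a b : R) (f : R -> \bar R) :
  (\int[mu]_(x in `]a, b[) f x = \int[mu]_x ((((a < x) && (x < b))%R%:R)%:E * f x))%E.
Proof.
rewrite integral_mkcond; apply: eq_integral => x _.
rewrite /patch; have [|] := boolP (x \in `]a, b[%classic).
  by rewrite inE/= in_itv/= => ->; rewrite mul1e.
by rewrite notin_setE /= in_itv/= => /negP/negbTE ->; rewrite mul0e.
Qed.

End change_of_variable.

Lemma measurable_fun_ltr01 d (T : measurableType d) (R : realType) (f g : T -> R) :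
  measurable_fun setT f -> measurable_fun setT g ->
  measurable_fun setT (fun z => (f z < g z)%R%:R : R).
Proof.
move=> mf mg; apply: (measurableT_comp (f := fun b : bool => b%:R : R)) => //.
exact: measurable_fun_ltr.
Qed.

Lemma measurable_fun_between01 d (T : measurableType d) (R : realType) (f g h : T -> R) :
  measurable_fun setT f -> measurable_fun setT g -> measurable_fun setT h ->
  measurable_fun setT (fun z => ((f z < g z) && (g z < h z))%R%:R : R).
Proof.
move=> mf mg mh; under eq_fun do rewrite -mulnb natrM.
by apply: measurable_funM; exact: measurable_fun_ltr01.
Qed.

Lemma measurable_fun2_comp d (T : measurableType d) (R : realType) (k : R -> R -> \bar R)
    (f g : T -> R) :
  measurable_fun setT (fun z : R * R => k z.1 z.2) ->
  measurable_fun setT f -> measurable_fun setT g -> measurable_fun setT (fun x => k (f x) (g x)).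
Proof.
move=> mk mf mg.
exact: (measurableT_comp mk (measurable_fun_pair mf mg)).
Qed.

Section kernel.
Context (R : realType) (rho : R -> R).
Notation mu := (@lebesgue_measure R).
Hypothesis rho0 : forall x, 0 <= rho x.
Hypothesis rhom : measurable_fun setT rho.

Local Open Scope ereal_scope.

(** For rho the rate, kap n p q is exp(L (p + q)) times the density of having had
    n+1 events by time p + q, with a total time p in the current direction and q
    in the other one. Before the last event, at time r + q, the two directions
    exchange their roles. *)
Fixpoint switch_kernel (n : nat) (p q : R) : \bar R :=
  if n is n'.+1 then \int[mu]_(r in `]0%R, p[) ((rho (r + q))%:E * switch_kernel n' q r)
  else (rho q)%:E.
Notation kap := switch_kernel.

Lemma switch_kernel_ge0 n p q : 0 <= kap n p q.
Proof.
elim: n p q => [|n IH] p q /=; first by rewrite lee_fin.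
by apply: integral_ge0 => r _; rewrite mule_ge0// lee_fin.
Qed.

Lemma switch_kernel_measurable n : measurable_fun setT (fun z : R * R => kap n z.1 z.2).
Proof.
elim: n => [|n IH] /=.
  by apply/measurable_EFinP; apply: measurableT_comp.
under eq_fun do rewrite integral_itvoo_bool.
pose F (zr : (R * R) * R) : \bar R :=
  (((0 < zr.2)%R%:R * (zr.2 < zr.1.1)%R%:R * rho (zr.2 + zr.1.2))%:E) * kap n zr.1.2 zr.2.
have mF : measurable_fun setT F.
  apply: emeasurable_funM.
    apply/measurable_EFinP; apply: measurable_funM; first apply: measurable_funM.
    - exact: measurable_fun_ltr01.
    - apply: measurable_fun_ltr01 => //.
      exact: measurableT_comp measurable_fst measurable_fst.
    - apply: measurableT_comp => //; apply: measurable_funD => //.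
      exact: measurableT_comp measurable_snd measurable_fst.
  apply: measurable_fun2_comp => //.
  exact: measurableT_comp measurable_snd measurable_fst.
have F0 zr : 0 <= F zr.
  rewrite /F mule_ge0 ?switch_kernel_ge0// lee_fin mulr_ge0// mulr_ge0// ler0n.
have := @measurable_fun_fubini_tonelli_F _ _ _ _ R mu F mF F0.
apply: eq_measurable_fun => -[p q] _; rewrite /fubini_F; apply: eq_integral => r _.
by rewrite /F /= muleA -natrM mulnb EFinM.
Qed.

(** Both sides integrate over 0 < r < s < t, with p = t - r on the right. *)
Lemma switch_kernel_tonelli (t : R) (g : R -> R) (k : R -> R -> \bar R) :
  measurable_fun setT g -> (forall x, (0 <= g x)%R) ->
  measurable_fun setT (fun z : R * R => k z.1 z.2) -> (forall p q, 0 <= k p q) ->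
  \int[mu]_(s in `]0%R, t[) ((rho s)%:E *
     \int[mu]_(r in `]0%R, s[) ((g (t - r))%:E * k r (s - r)%R)) =
  \int[mu]_(p in `]0%R, t[) ((g p)%:E *
     \int[mu]_(r in `]0%R, p[) ((rho (r + (t - p)))%:E * k (t - p)%R r)).
Proof.
move=> mg g0 mk k0.
(* The integrand extended by 0, as a function of s and r. *)
pose F (sr : R * R) : \bar R := (((0 < sr.2)%R%:R * (sr.2 < sr.1)%R%:R * (sr.1 < t)%R%:R
   * (rho sr.1 * g (t - sr.2)))%:E) * k sr.2 (sr.1 - sr.2)%R.
have F0 z : 0 <= F z.
  by rewrite /F mule_ge0// lee_fin !mulr_ge0// ler0n.
have mF : measurable_fun setT F.
  apply: emeasurable_funM.
    apply/measurable_EFinP; apply: measurable_funM.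
      apply: measurable_funM; first apply: measurable_funM.
      - exact: measurable_fun_ltr01.
      - exact: measurable_fun_ltr01.
      - exact: measurable_fun_ltr01.
    apply: measurable_funM; first exact: measurableT_comp.
    by apply: measurableT_comp => //; exact: measurable_funB.
  by apply: measurable_fun2_comp => //; exact: measurable_funB.
have Fs r : measurable_fun setT (fun s => F (s, r)).
  by apply: measurableT_comp => //; exact: measurable_fun_pair.
have mF' : measurable_fun setT (fun r => \int[mu]_s F ((s + r)%R, r)).
  have mF2 : measurable_fun setT (fun rs : R * R => F ((rs.2 + rs.1)%R, rs.1)).
    apply: (measurableT_comp (f := F) (g := fun rs : R * R => ((rs.2 + rs.1)%R, rs.1))) => //.
    by apply: measurable_fun_pair => //; exact: measurable_funD.
  by have := @measurable_fun_fubini_tonelli_F _ _ _ _ R mu _ mF2 (fun _ => F0 _).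
transitivity (\int[mu]_s \int[mu]_r F (s, r)).
  rewrite integral_itvoo_bool; apply: eq_integral => s _.
  rewrite integral_itvoo_bool muleA -EFinM -ge0_integralZl//; last 3 first.
  - apply: emeasurable_funM.
      by apply/measurable_EFinP; exact: measurable_fun_between01.
    apply: emeasurable_funM.
      by apply/measurable_EFinP; apply: measurableT_comp => //; exact: measurable_funB.
    by apply: measurable_fun2_comp => //; exact: measurable_funB.
  - by move=> r _; rewrite !mule_ge0// lee_fin.
  - by rewrite lee_fin mulr_ge0.
  apply: eq_integral => r _; rewrite /F /=.
  case: (ltP 0%R r) => [r0|_]; last by rewrite !mul0r !mul0e mule0.
  case: (ltP r s) => [rs|_]; last by rewrite mulr0 !mul0r !mul0e mule0.
  rewrite (lt_trans r0 rs) /= !mul1r mul1e.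
  by rewrite !EFinM !muleA.
rewrite (@fubini_tonelli _ _ _ _ R mu mu F)//.
transitivity (\int[mu]_r \int[mu]_s F ((s + r)%R, r)).
  apply: eq_integral => r _.
  by rewrite (@ge0_integral_shift _ r (fun s => F (s, r))).
rewrite -(@ge0_integral_reflect _ t)//; last by move=> r; apply: integral_ge0.
rewrite integral_itvoo_bool; apply: eq_integral => p _.
rewrite integral_itvoo_bool muleA -EFinM -ge0_integralZl//; last 3 first.
- apply: emeasurable_funM.
    by apply/measurable_EFinP; exact: measurable_fun_between01.
  apply: emeasurable_funM.
    by apply/measurable_EFinP; apply: measurableT_comp => //; exact: measurable_funD.
  exact: measurable_fun2_comp.
- by move=> r _; rewrite !mule_ge0// lee_fin.
- by rewrite lee_fin mulr_ge0.
apply: eq_integral => r _; rewrite /F /= addrK subKr subr_gt0 ltrDr.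
rewrite (_ : (r + (t - p) < t)%R = (r < p)%R); last by apply/idP/idP; lra.
case: (ltP 0%R r) => [r0|_]; last by rewrite mulr0 !mul0r !mul0e mule0.
case: (ltP r p) => [rs|_]; last by rewrite mulr0 !mul0r !mul0e mule0.
rewrite (lt_trans r0 rs) !(mulr1, mul1r, mul1e).
by rewrite muleA; congr (_ * _); rewrite -!EFinM; congr EFin; ring.
Qed.

End kernel.

(** * Time spent in the last direction, tested against Lipschitz functions *)

(** The rate is only constrained at positive times; cutting it off elsewhere makes
    it measurable and nonnegative on the whole line. *)
Definition positive_rate (R : realType) (rate : R -> R) (x : R) : R :=
  if 0 < x then rate x else 0.

(** On {N_t = n+1} this is the indicator of the direction held at time t, for a
    motion that reverses at each event: after k events the direction is the
    current one when k and n+1 have the same parity. *)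
Definition last_direction (R : realType) (n k : nat) : R := (odd (k + n))%:R.

Section law.
Context (R : realType) (rate : R -> R).
Notation mu := (@lebesgue_measure R).
Hypothesis rate0 : forall t : R, 0 < t -> 0 <= rate t.
Hypothesis rateI : forall t : R, 0 < t -> mu.-integrable `]0, t] (EFin \o rate).
Notation L := (cumulative_rate rate).
Notation rho := (positive_rate rate).

Lemma positive_rate_ge0 x : 0 <= rho x.
Proof. by rewrite /positive_rate; case: ifP => // /rate0. Qed.

Lemma positive_rate_measurable : measurable_fun setT rho.
Proof.
have -> : rho = rate \_ `]0, +oo[.
  apply/funext => x; rewrite /positive_rate /patch.
  case: ifPn => x0; first by rewrite mem_set//= in_itv/= x0.
  by rewrite memNset//= in_itv/= andbT; exact/negP.
apply/(measurable_restrictT _ _).1 => //.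
rewrite (_ : `]0, +oo[%classic = \bigcup_k `]0, k.+1%:R]%classic); last first.
  apply/seteqP; split => x /=.
    rewrite in_itv/= andbT => x0; exists (Num.bound x) => //=.
    rewrite in_itv/= x0 (le_trans (ltW (archi_boundP (ltW x0))))// ler_nat//.
  by move=> [k _ /=]; rewrite !in_itv/= => /andP[->].
apply/measurable_fun_bigcup => // k.
by have /(measurable_int mu)/measurable_EFinP := rateI (ltr0Sn _ k).
Qed.

Context (d : measure_display) (Om : measurableType d) (P : probability Om R).
Context (N : R -> Om -> nat).
Hypothesis hN : poisson_process P rate N.
Notation Z := (additive_functional N).
Notation kap := (switch_kernel rho).

Let dC n k : `|last_direction R n k| <= 1.
Proof. by rewrite /last_direction; case: odd; rewrite ?normr1// normr0. Qed.

Lemma last_direction_self n : last_direction R n n.+1 = 1.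
Proof. by rewrite /last_direction addSn /= oddD addbb. Qed.

(** At the next event the two directions exchange their roles. *)
Lemma last_direction_functional n s w : 0 <= s ->
  Z (last_direction R n.+1) s w = s - Z (last_direction R n) s w.
Proof.
move=> s0; rewrite /additive_functional.
have i1 := path_integrable hN s w (dC n).
have Es : s = \int[mu]_(x in `[0, s]) 1.
  rewrite Rintegral_cst//= lebesgue_measure_itv/= lte_fin mul1r.
  by move: s0; rewrite le_eqVlt => /predU1P[<-|s0]; rewrite ?ltxx// s0 /= subr0.
have i2 : mu.-integrable `[0, s] (EFin \o (fun x => 1 : R)).
  by apply: (path_integrable (a := fun=> 1) (C := 1) hN s w) => k; rewrite normr1.
rewrite [X in _ = X - _]Es -[RHS](RintegralB _ i2 i1)//.
apply: eq_Rintegral => x _; rewrite /last_direction addnS /=.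
by case: odd; rewrite ?subrr// subr0.
Qed.

(** Induction on n: the last-jump equation reduces n+1 to n with g replaced by
    its reflection, and the order of integration is then exchanged. *)
Lemma law_functional n t (g : R -> R) (B K : R) : 0 < t ->
  measurable_fun setT g -> (forall x, 0 <= g x <= B) ->
  (forall x y, `|g x - g y| <= K * `|x - y|) ->
  ((expR (L t) * \int[P]_(w in [set w | N t w = n.+1]) g (Z (last_direction R n) t w))%:E
   = \int[mu]_(p in `]0%R, t[) ((g p)%:E * kap n p (t - p)))%E.
Proof.
elim: n t g => [|n IH] t g t0 mg gB gK.
  rewrite (last_jump rate0 rateI hN (dC 0) mg gB gK 0 (ltW t0)).
  have wI := weighted_rate_integrable rate0 rateI hN (dC 0) mg gB gK (last_direction R 0 1) 0 (ltW t0).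
  rewrite /Rintegral fineK; last exact: integrable_fin_num wI.
  rewrite -integral_itv_bndo_bndc; last first.
    apply: (measurable_funS _ _ (measurable_int mu wI)) => //.
    by apply: subset_itvl; rewrite bnd_simp.
  transitivity (\int[mu]_(s in `]0%R, t[) ((g (t - s))%:E * (rho s)%:E))%E.
    apply: eq_integral => s; rewrite inE /= in_itv/= => /andP[s0 st].
    rewrite /positive_rate s0 -EFinM; congr EFin; rewrite mulrC; congr (_ * _).
    rewrite /weighted_expectation.
    rewrite (@eq_Rintegral _ _ _ _ _ (cst (g (t - s)))); last first.
      move=> w; rewrite inE/= => Ns; congr g.
      rewrite -[RHS]add0r; congr (_ + _); last by rewrite /last_direction /= mul1r.
      rewrite (additive_functional_const hN (dC 0) (lexx 0) (ltW s0) (pp_start hN w) Ns).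
      by rewrite additive_functional0 /last_direction /= mul0r addr0.
    rewrite Rintegral_cst ?count_measurable//; last exact: (count_measurable hN 0 (ltW s0)).
    have e : fine (P [set w | N s w = 0%N]) = expR (- L s).
      by rewrite (count_law hN 0 (ltW s0)) /= poisson_weight0.
    transitivity (expR (L s) * (g (t - s) * expR (- L s))).
      by congr (_ * (_ * _)); exact: e.
    by rewrite mulrCA -expRD addrN expR0 mulr1.
  rewrite !integral_itvoo_bool.
  have g0 x : 0 <= g x by case/andP: (gB x).
  rewrite -(@ge0_integral_reflect _ t); last 2 first.
  - apply: emeasurable_funM.
      by apply/measurable_EFinP; exact: measurable_fun_between01.
    apply: emeasurable_funM; apply/measurable_EFinP; last exact: positive_rate_measurable.
    by apply: measurableT_comp => //; exact: measurable_funB.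
  - by move=> x; rewrite !mule_ge0// lee_fin// positive_rate_ge0.
  apply: eq_integral => p _; rewrite subKr subr_gt0 /=.
  rewrite (_ : (t - p < t) = (0 < p)) 1?andbC//.
  by rewrite gtrBl.
rewrite (last_jump rate0 rateI hN (dC n.+1) mg gB gK n.+1 (ltW t0)).
have wI := weighted_rate_integrable rate0 rateI hN (dC n.+1) mg gB gK (last_direction R n.+1 n.+2) n.+1 (ltW t0).
rewrite /Rintegral fineK; last exact: integrable_fin_num wI.
rewrite -integral_itv_bndo_bndc; last first.
  apply: (measurable_funS _ _ (measurable_int mu wI)) => //.
  by apply: subset_itvl; rewrite bnd_simp.
have g0 x : 0 <= g x by case/andP: (gB x).
rewrite /= -(@switch_kernel_tonelli _ _ positive_rate_ge0 positive_rate_measurable t g (kap n))//; last 2 first.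
- exact: (switch_kernel_measurable positive_rate_ge0 positive_rate_measurable).
- exact: (switch_kernel_ge0 positive_rate_ge0).
apply: eq_integral => s; rewrite inE /= in_itv/= => /andP[s0 st].
rewrite /positive_rate s0 EFinM; congr (_ * _)%E.
rewrite -(IH s (fun x => g (t - x)))//; last 2 first.
- by apply: measurableT_comp => //; exact: measurable_funB.
- move=> x y; apply: (le_trans (gK _ _)).
  by rewrite (_ : t - x - (t - y) = y - x) 1?distrC//; ring.
congr EFin; rewrite /weighted_expectation; congr (_ * _).
apply: eq_Rintegral => w _; congr g.
by rewrite last_direction_functional ?(ltW s0)// last_direction_self mul1r; ring.
Qed.

End law.

(** * Open sets and absence of atoms *)

Lemma cvg_monotone_integral d (T : measurableType d) (R : realType)
    (m : {measure set T -> \bar R}) (D : set T) (u : nat -> T -> \bar R) (f : T -> \bar R) :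
  measurable D -> (forall n, measurable_fun D (u n)) ->
  (forall n x, D x -> (0 <= u n x)%E) ->
  (forall x, D x -> nondecreasing_seq (u ^~ x)) ->
  (forall x, D x -> u n x @[n --> \oo] --> f x) ->
  (\int[m]_(x in D) u n x)%E @[n --> \oo] --> (\int[m]_(x in D) f x)%E.
Proof.
move=> mD mu u0 ndu uf.
rewrite (_ : (\int[m]_(x in D) f x)%E = (\int[m]_(x in D) limn (u ^~ x))%E).
  exact: cvg_monotone_convergence.
by apply: eq_integral => x /[1!inE] Dx; apply/esym/cvg_lim => //; exact: uf.
Qed.

(** For delta nonnegative and Lipschitz these functions are Lipschitz and increase
    to the indicator of {delta > 0}, and every open set is of this form. *)
Definition ramp (R : realType) (delta : R -> R) (k : nat) (y : R) : R :=
  Num.min 1 (k%:R * delta y).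

Section ramp.
Context (R : realType) (delta : R -> R).
Hypothesis delta0 : forall x, 0 <= delta x.
Hypothesis deltaK : forall x y, `|delta x - delta y| <= `|x - y|.

Lemma ramp_bounds k y : 0 <= ramp delta k y <= 1.
Proof. by rewrite /ramp le_min ler01 mulr_ge0//= ge_min lexx. Qed.

Lemma lipschitz1_measurable : measurable_fun setT delta.
Proof.
apply: continuous_measurable_fun => x; apply/cvgrPdist_lt => e e0.
near=> y; apply: (le_lt_trans (deltaK _ _)).
by near: y; exact: (@cvgr_dist_lt _ _ _ _ _ id).
Unshelve. all: by end_near. Qed.

Lemma ramp_measurable k : measurable_fun setT (ramp delta k).
Proof.
apply: measurable_minr => //; apply: measurable_funM => //.
exact: lipschitz1_measurable.
Qed.

Lemma ramp_lipschitz k x y : `|ramp delta k x - ramp delta k y| <= k%:R * `|x - y|.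
Proof.
have H a b : `|Num.min 1 a - Num.min 1 b| <= `|a - b| :> R.
  rewrite /Num.min; have h := ler_norm (a - b); have h' := ler_norm (b - a).
  rewrite distrC in h'.
  by case: ltP => ?; case: ltP => ?; rewrite ?subrr ?normr0// ler_norml; apply/andP; split; lra.
apply: (le_trans (H _ _)); rewrite -mulrBr normrM ger0_norm//.
by rewrite ler_wpM2l.
Qed.

Lemma ramp_nd y : {homo (ramp delta)^~ y : k l / (k <= l)%N >-> k <= l}.
Proof.
move=> k l kl; rewrite /ramp le_min ge_min lexx /= ge_min; apply/orP; right.
by rewrite ler_wpM2r// ler_nat.
Qed.

Lemma ramp_near y : \forall k \near \oo, ramp delta k y = (0 < delta y)%R%:R.
Proof.
have := delta0 y; rewrite le_eqVlt => /predU1P[e|d0].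
  by apply: nearW => k; rewrite /ramp -e mulr0 /Num.min ltNge ler01 ltxx.
near=> k; rewrite d0 /ramp (min_idPl _)//.
rewrite -ler_pdivrMr// mul1r; apply: ltW.
apply: (lt_le_trans (archi_boundP _)); first by rewrite invr_ge0 ltW.
by rewrite ler_nat; near: k; exact: nbhs_infty_ge.
Unshelve. all: by end_near. Qed.

Lemma ramp_cvg y (z : \bar R) :
  ((ramp delta k y)%:E * z)%E @[k --> \oo] --> (((0 < delta y)%R%:R : R)%:E * z)%E.
Proof.
apply: cvg_near_cst; have := ramp_near y; apply: filterS => k -> //.
Qed.

End ramp.

Section law.
Context (R : realType) (rate : R -> R).
Notation mu := (@lebesgue_measure R).
Hypothesis rate0 : forall t : R, 0 < t -> 0 <= rate t.
Hypothesis rateI : forall t : R, 0 < t -> mu.-integrable `]0, t] (EFin \o rate).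
Notation L := (cumulative_rate rate).
Notation rho := (positive_rate rate).
Context (d : measure_display) (Om : measurableType d) (P : probability Om R).
Context (N : R -> Om -> nat).
Hypothesis hN : poisson_process P rate N.
Notation Z := (additive_functional N).
Notation kap := (switch_kernel rho).

Lemma functional_integralE a n t (g : R -> R) (B u : R) : 0 <= t ->
  measurable_fun setT g -> (forall x, 0 <= g x <= B) ->
  ((\int[P]_(w in [set w | N t w = n]) g (Z a t w + u))%:E =
   \int[P]_(w in [set w | N t w = n]) (g (Z a t w + u))%:E)%E.
Proof.
move=> t0 mg gB; rewrite /Rintegral fineK//; apply: integrable_fin_num.
  exact: (count_measurable hN).
apply: (@bounded_integrable _ _ _ P _ (fun w => g (Z a t w + u)) B).
- exact: (count_measurable hN).
- apply: measurableT_comp => //; apply: measurable_funD => //.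
  exact: (functional_measurable hN).
- by move=> w _; case/andP: (gB (Z a t w + u)) => g0 gb; rewrite ger0_norm.
Qed.

Lemma functional_ramp_cvg a n t (delta : R -> R) (u : R) : 0 <= t ->
  (forall x, 0 <= delta x) -> (forall x y, `|delta x - delta y| <= `|x - y|) ->
  ((\int[P]_(w in [set w | N t w = n]) ramp delta k (Z a t w + u))%:E)%E @[k --> \oo] -->
  P [set w | N t w = n /\ 0 < delta (Z a t w + u)].
Proof.
move=> t0 d0 dK.
have mn := count_measurable hN n t0.
have mZ : measurable_fun [set w | N t w = n] (fun w => Z a t w + u).
  by apply: measurable_funD => //; exact: (functional_measurable hN).
have -> : P [set w | N t w = n /\ 0 < delta (Z a t w + u)] =
    (\int[P]_(w in [set w | N t w = n]) ((0 < delta (Z a t w + u))%R%:R)%:E)%E.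
  have mE : measurable [set w | N t w = n /\ 0 < delta (Z a t w + u)].
    have md := lipschitz1_measurable dK.
    have := measurableT_comp md mZ mn (measurable_itv `]0, +oo[).
    congr measurable; apply/seteqP; split => w /=; rewrite in_itv/= andbT//.
  rewrite -[X in P X = _](@setIidl _ _ [set w | N t w = n]); last by move=> w [].
  rewrite -integral_indic//; apply: eq_integral => w /[1!inE] /= Nw; congr EFin.
  rewrite indicE; case: ltP => h; first by rewrite mem_set.
  by rewrite memNset// => -[_]; rewrite ltNge h.
under eq_fun => k do rewrite (functional_integralE _ _ _ t0 (ramp_measurable dK k) (ramp_bounds d0 k)).
apply: cvg_monotone_integral => //.
- move=> k; apply/measurable_EFinP; apply: measurableT_comp => //.
  exact: ramp_measurable.
- by move=> k w _; rewrite lee_fin; case/andP: (ramp_bounds d0 k (Z a t w + u)).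
- by move=> w _ k l kl; rewrite lee_fin; exact: ramp_nd.
- move=> w _; have := @ramp_cvg _ _ d0 (Z a t w + u) 1%E; rewrite mule1.
  by under eq_fun do rewrite mule1.
Qed.

Lemma law_open n t (delta : R -> R) : 0 < t ->
  (forall x, 0 <= delta x) -> (forall x y, `|delta x - delta y| <= `|x - y|) ->
  ((expR (L t))%:E * P [set w | N t w = n.+1 /\ (0 < delta (Z (last_direction R n) t w))%R] =
   \int[mu]_(p in `]0%R, t[) (((0 < delta p)%R%:R)%:E * kap n p (t - p)))%E.
Proof.
move=> t0 d0 dK.
have mk := switch_kernel_measurable (positive_rate_ge0 rate0) (positive_rate_measurable rateI) n.
have k0 := switch_kernel_ge0 (positive_rate_ge0 rate0) n.
have := @functional_ramp_cvg (last_direction R n) n.+1 t delta 0 (ltW t0) d0 dK.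
under eq_fun do under eq_Rintegral do rewrite addr0.
have -> : [set w | N t w = n.+1 /\ 0 < delta (Z (last_direction R n) t w + 0)] =
  [set w | N t w = n.+1 /\ 0 < delta (Z (last_direction R n) t w)].
  by apply/seteqP; split => w /=; rewrite addr0.
move=> h; have {}h := cvgeZl (y := (expR (L t))%:E) isT h.
rewrite /= in h.
have h2 : (\int[mu]_(p in `]0%R, t[) ((ramp delta k p)%:E * kap n p (t - p)))%E @[k --> \oo] -->
   (\int[mu]_(p in `]0%R, t[) (((0 < delta p)%R%:R)%:E * kap n p (t - p)))%E.
  apply: cvg_monotone_integral => //.
  - move=> k; apply: measurable_funTS; apply: emeasurable_funM.
      by apply/measurable_EFinP; exact: ramp_measurable.
    by apply: measurable_fun2_comp => //; exact: measurable_funB.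
  - by move=> k p _; rewrite mule_ge0// lee_fin; case/andP: (ramp_bounds d0 k p).
  - by move=> p _ k l kl; rewrite lee_wpmul2r// lee_fin; exact: ramp_nd.
  - by move=> p _; exact: ramp_cvg.
apply: (cvg_unique _ h) => //.
move: h2; under eq_fun => k do rewrite -(law_functional rate0 rateI hN n t0 (ramp_measurable dK k)
  (ramp_bounds d0 k) (ramp_lipschitz dK k)) EFinM.
by [].
Qed.

(** Passage to the limit along the ramps of delta in the last-jump equation. *)
Lemma last_jump_open (a : nat -> R) (C : R) (n : nat) (t : R) (delta : R -> R) : (forall k, `|a k| <= C) ->
  0 <= t -> (forall x, 0 <= delta x) -> (forall x y, `|delta x - delta y| <= `|x - y|) ->
  (measurable_fun `]0%R, t] (fun s => (rate s * expR (L s))%:E *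
     P [set w | N s w = n /\ (0 < delta (Z a s w + a n.+1 * (t - s)))%R]) /\
  (expR (L t))%:E * P [set w | N t w = n.+1 /\ (0 < delta (Z a t w))%R] =
   \int[mu]_(s in `]0%R, t]) ((rate s * expR (L s))%:E *
     P [set w | N s w = n /\ (0 < delta (Z a s w + a n.+1 * (t - s)))%R]))%E.
Proof.
move=> aC t0 d0 dK.
have := @functional_ramp_cvg a n.+1 t delta 0 t0 d0 dK.
under eq_fun do under eq_Rintegral do rewrite addr0.
have -> : [set w | N t w = n.+1 /\ 0 < delta (Z a t w + 0)] =
  [set w | N t w = n.+1 /\ 0 < delta (Z a t w)].
  by apply/seteqP; split => w /=; rewrite addr0.
move=> h; have {}h := cvgeZl (y := (expR (L t))%:E) isT h.
have WI k := weighted_rate_integrable rate0 rateI hN aC (ramp_measurable dK k)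
  (ramp_bounds d0 k) (ramp_lipschitz dK k) (a n.+1) n t0.
set W := fun k s => (rate s * weighted_expectation rate P N a (ramp delta k) (a n.+1) t n s)%:E.
have mW k : measurable_fun `]0%R, t] (W k) by exact: (measurable_int mu (WI k)).
have WE k s : 0 <= s -> W k s = ((rate s * expR (L s))%:E *
    (\int[P]_(w in [set w | N s w = n]) ramp delta k (Z a s w + a n.+1 * (t - s)))%:E)%E.
  by move=> s0; rewrite /W /weighted_expectation mulrA EFinM.
have Wcvg s : 0 < s -> W k s @[k --> \oo] --> ((rate s * expR (L s))%:E *
     P [set w | N s w = n /\ (0 < delta (Z a s w + a n.+1 * (t - s)))%R])%E.
  move=> s0; under eq_fun do rewrite (WE _ _ (ltW s0)).
  by apply: cvgeZl => //; apply: functional_ramp_cvg => //; exact: ltW.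
have rL0 s : 0 < s -> 0 <= rate s * expR (L s).
  by move=> s0; rewrite mulr_ge0 ?expR_ge0// rate0.
split.
  apply: (emeasurable_fun_cvg W) => // s; rewrite /= in_itv/= => /andP[s0 _].
  exact: Wcvg.
have h2 : (\int[mu]_(s in `]0%R, t]) W k s)%E @[k --> \oo] -->
   (\int[mu]_(s in `]0%R, t]) ((rate s * expR (L s))%:E *
     P [set w | N s w = n /\ (0 < delta (Z a s w + a n.+1 * (t - s)))%R]))%E.
  apply: cvg_monotone_integral => //.
  - move=> k s; rewrite /= in_itv/= => /andP[s0 _]; rewrite (WE _ _ (ltW s0)) mule_ge0//.
      by rewrite lee_fin rL0.
    by rewrite lee_fin; apply: Rintegral_ge0 => w _; case/andP: (ramp_bounds d0 k (Z a s w + a n.+1 * (t - s))).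
  - move=> s; rewrite /= in_itv/= => /andP[s0 _] k l kl.
    rewrite !(WE _ _ (ltW s0)); apply: lee_wpmul2l; first by rewrite lee_fin rL0.
    rewrite !(functional_integralE _ _ _ (ltW s0) (ramp_measurable dK _) (ramp_bounds d0 _)).
    have mn := count_measurable hN n (ltW s0).
    have mZ : measurable_fun [set w | N s w = n] (fun w => Z a s w + a n.+1 * (t - s)).
      by apply: measurable_funD => //; apply: (functional_measurable hN); exact: ltW.
    apply: ge0_le_integral => //.
    - by move=> w _; rewrite lee_fin; case/andP: (ramp_bounds d0 k (Z a s w + a n.+1 * (t - s))).
    - apply/measurable_EFinP; exact: (measurableT_comp (ramp_measurable dK k) mZ).
    - apply/measurable_EFinP; exact: (measurableT_comp (ramp_measurable dK l) mZ).
    - by move=> w _; rewrite lee_fin; exact: ramp_nd.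
  - by move=> s; rewrite /= in_itv/= => /andP[s0 _]; exact: Wcvg.
apply: (cvg_unique _ h) => //.
have e k : (\int[mu]_(s in `]0%R, t]) W k s)%E = ((expR (L t))%:E *
    (\int[P]_(w in [set w | N t w = n.+1]) ramp delta k (Z a t w))%:E)%E.
  rewrite -EFinM (last_jump rate0 rateI hN aC (ramp_measurable dK k)
    (ramp_bounds d0 k) (ramp_lipschitz dK k) n t0).
  by rewrite /Rintegral fineK//; apply: integrable_fin_num (WI k).
by move: h2; under eq_fun do rewrite e.
Qed.

Lemma functional_before_change (a : nat -> R) n s w : 0 <= s ->
  (forall i, (i <= n)%N -> a i = a 0%N) -> N s w = n -> Z a s w = a 0%N * s.
Proof.
move=> s0 a0 Ns; rewrite /additive_functional.
rewrite (@eq_Rintegral _ _ _ _ _ (cst (a 0%N))); last first.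
  move=> x; rewrite inE /= in_itv/= => /andP[x0 xs]; apply: a0.
  by rewrite -Ns (pp_nondecreasing hN).
rewrite Rintegral_cst//= lebesgue_measure_itv/= lte_fin.
by move: s0; rewrite le_eqVlt => /predU1P[<-|s0]; rewrite ?ltxx// s0 /= subr0.
Qed.

(** Induction on n through the last-jump equation, comparing {Z <> z} with the
    whole event. Either a is not constant up to n, and the integrand has no atom
    by induction; or it is, and on {N_s = n} the sum Z_s + a_(n+1) (t - s) is a
    nonconstant affine function of s, equal to z for at most one s. *)
Lemma functional_atomless (a : nat -> R) (C : R) (n : nat) (t z : R) : (forall k, `|a k| <= C) -> 0 < t ->
  ~ (forall i, (i <= n)%N -> a i = a 0%N) ->
  P [set w | N t w = n /\ Z a t w = z] = 0%E.
Proof.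
move=> aC; elim: n t z => [|n IH] t z t0 na.
  by exfalso; apply: na => i; rewrite leqn0 => /eqP ->.
(* These functions encode the open sets {y <> z} and the whole line. *)
pose delta (y : R) := `|y - z|; pose one (y : R) := 1 : R.
have d0 x : 0 <= delta x by exact: normr_ge0.
have dK x y : `|delta x - delta y| <= `|x - y|.
  by rewrite (le_trans (ler_dist_dist _ _))// opprB addrA subrK.
have o0 x : 0 <= one x by [].
have oK x y : `|one x - one y| <= `|x - y| by rewrite subrr normr0.
have [m1 e1] := @last_jump_open a C n t delta aC (ltW t0) d0 dK.
have [m2 e2] := @last_jump_open a C n t one aC (ltW t0) o0 oK.
have mz s k u : 0 <= s -> measurable [set w | N s w = k /\ Z a s w + u = z].
  move=> s0; have := @functional_event_measurable _ _ _ _ _ _ hN s k a [set z - u] s0 (measurable_set1 _).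
  congr measurable; apply/seteqP; split => w /= [->] h; split => //.
    by rewrite h subrK.
  by rewrite -h addrK.
have md s k u : 0 <= s -> measurable [set w | N s w = k /\ 0 < delta (Z a s w + u)].
  move=> s0; rewrite (_ : [set w | _] = [set w | N s w = k] `\` [set w | N s w = k /\ Z a s w + u = z]).
    by apply: measurableD; [exact: (count_measurable hN)|exact: mz].
  apply/seteqP; split => w /=; rewrite /delta normr_gt0 subr_eq0.
    by move=> [-> /eqP h]; split => // -[].
  by move=> [Nk h]; split => //; apply/eqP => h'; apply: h.
have PE s k u : 0 <= s -> P [set w | N s w = k /\ Z a s w + u = z] = 0%E ->
    P [set w | N s w = k /\ 0 < delta (Z a s w + u)] = P [set w | N s w = k].
  move=> s0 p0.
  rewrite (_ : [set w | N s w = k] = [set w | N s w = k /\ 0 < delta (Z a s w + u)] `|`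
    [set w | N s w = k /\ Z a s w + u = z]).
    rewrite measureU//; [|exact: md|exact: mz|].
      by rewrite [X in (_ + X)%E](_ : _ = 0%E) ?adde0//; exact: p0.
    apply/seteqP; split => // w /= [[_ +] [_ h]].
    by rewrite h /delta subrr normr0 ltxx.
  apply/seteqP; split => w /=; last by move=> [[]|[]].
  move=> ->; have [h|h] := eqVneq (Z a s w + u) z; [by right|left].
  by rewrite /delta normr_gt0 subr_eq0.
have e : (\int[mu]_(s in `]0%R, t]) ((rate s * expR (L s))%:E *
     P [set w | N s w = n /\ (0 < delta (Z a s w + a n.+1 * (t - s)))%R]))%E =
   (\int[mu]_(s in `]0%R, t]) ((rate s * expR (L s))%:E *
     P [set w | N s w = n /\ (0 < one (Z a s w + a n.+1 * (t - s)))%R]))%E.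
  have oneE s : [set w | N s w = n /\ (0 < one (Z a s w + a n.+1 * (t - s)))%R] =
      [set w | N s w = n].
    by apply/seteqP; split => w /=; [case|rewrite /one ltr01].
  have [an|/IH an] := pselect (forall i, (i <= n)%N -> a i = a 0%N); last first.
    apply: eq_integral => s; rewrite inE /= in_itv/= => /andP[s0 st].
    rewrite oneE; congr (_ * _)%E; apply: PE; first exact: ltW.
    have := an s (z - a n.+1 * (t - s)) s0.
    congr (P _ = _); apply/seteqP; split => w /= [->] h; split => //.
      by rewrite h subrK.
    by rewrite -h addrK.
  have nab : a 0%N != a n.+1.
    apply/eqP => h; apply: na => i; rewrite leq_eqVlt => /predU1P[->//|].
    exact: an.
  apply: ae_eq_integral => //.
  exists [set (z - a n.+1 * t) / (a 0%N - a n.+1)]; split => //.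
    exact: lebesgue_measure_set1.
  move=> s /= hs; apply: contrapT => sz; apply: hs; rewrite in_itv/= => /andP[s0 st].
  rewrite oneE; congr (_ * _)%E; apply: PE; first exact: ltW.
  rewrite (_ : [set w | _] = set0) ?measure0//; apply/seteqP; split => // w /= [Ns].
  rewrite (functional_before_change (ltW s0) an Ns) => h; apply: sz.
  rewrite -h; field.
  by rewrite subr_eq0.
have eL : expR (L t) != 0 by rewrite gt_eqF ?expR_gt0.
rewrite e -e2 in e1.
have oneT : [set w | N t w = n.+1 /\ (0 < one (Z a t w))%R] = [set w | N t w = n.+1].
  by apply/seteqP; split => w /=; [case|rewrite /one ltr01].
rewrite oneT in e1.
have mz0 := mz t n.+1 0 (ltW t0); have md0 := md t n.+1 0 (ltW t0).
have zE : [set w | N t w = n.+1 /\ Z a t w + 0 = z] = [set w | N t w = n.+1 /\ Z a t w = z].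
  by apply/seteqP; split => w /=; rewrite addr0.
have dE : [set w | N t w = n.+1 /\ 0 < delta (Z a t w + 0)] = [set w | N t w = n.+1 /\ 0 < delta (Z a t w)].
  by apply/seteqP; split => w /=; rewrite addr0.
rewrite zE in mz0; rewrite dE in md0.
rewrite (_ : [set w | N t w = n.+1 /\ Z a t w = z] =
   [set w | N t w = n.+1] `\` [set w | N t w = n.+1 /\ 0 < delta (Z a t w)]); last first.
  apply/seteqP; split => w /=; rewrite /delta normr_gt0 subr_eq0.
    by move=> [-> ->]; split => // -[_]; rewrite eqxx.
  by move=> [Nn h]; split => //; apply/eqP/negP => /negP h'; apply: h.
have mn := count_measurable hN n.+1 (ltW t0).
have mm : P [set w | N t w = n.+1] = P [set w | N t w = n.+1 /\ 0 < delta (Z a t w)].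
  move/(congr1 (fun x => (expR (L t))^-1%:E * x)%E) : e1.
  by rewrite !muleA -!EFinM mulVf// !mul1e.
rewrite measureD//; last by rewrite (le_lt_trans (probability_le1 _ _))// ltry.
rewrite setIidr; last by move=> w [].
apply: etrans (subee (x := P [set w | N t w = n.+1]) _).
  by congr (_ - _)%E; exact/esym/mm.
exact: fin_num_measure.
Qed.

End law.

(** * The density of the sojourn time *)

(** The proofs are arguments so that the measure structure can be attached to the
    function itself. *)
Definition density_measure d (T : measurableType d) (R : realType)
    (m : {measure set T -> \bar R}) (f : T -> \bar R)
    (_ : measurable_fun setT f) (_ : forall x, (0 <= f x)%E) (A : set T) : \bar R :=
  (\int[m]_(x in A) f x)%E.

Section density_measure.
Context d (T : measurableType d) (R : realType) (m : {measure set T -> \bar R}).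
Variable f : T -> \bar R.
Hypotheses (mf : measurable_fun setT f) (f0 : forall x, (0 <= f x)%E).

Let density_measure0 : density_measure m mf f0 set0 = 0%E.
Proof. exact: integral_set0. Qed.

Let density_measure_ge0 A : (0 <= density_measure m mf f0 A)%E.
Proof. exact: integral_ge0. Qed.

Let density_measure_sigma_additive : semi_sigma_additive (density_measure m mf f0).
Proof. exact: semi_sigma_additive_nng_induced. Qed.

HB.instance Definition _ := isMeasure.Build _ _ _ (density_measure m mf f0)
  density_measure0 density_measure_ge0 density_measure_sigma_additive.

End density_measure.

Section law.
Context (R : realType) (rate : R -> R).
Notation mu := (@lebesgue_measure R).
Hypothesis rate0 : forall t : R, 0 < t -> 0 <= rate t.
Hypothesis rateI : forall t : R, 0 < t -> mu.-integrable `]0, t] (EFin \o rate).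
Notation L := (cumulative_rate rate).
Notation rho := (positive_rate rate).
Context (d : measure_display) (Om : measurableType d) (P : probability Om R).
Context (N : R -> Om -> nat).
Hypothesis hN : poisson_process P rate N.
Notation Z := (additive_functional N).
Notation kap := (switch_kernel rho).

Definition sojourn_density (n : nat) (t p : R) : \bar R :=
  ((((0 < p) && (p < t))%R%:R)%:E * kap n p (t - p))%E.

Lemma sojourn_density_measurable n t : measurable_fun setT (sojourn_density n t).
Proof.
have mk := switch_kernel_measurable (positive_rate_ge0 rate0) (positive_rate_measurable rateI) n.
apply: emeasurable_funM.
  by apply/measurable_EFinP; exact: measurable_fun_between01.
by apply: measurable_fun2_comp => //; exact: measurable_funB.
Qed.

Lemma sojourn_density_ge0 n t p : (0 <= sojourn_density n t p)%E.
Proof.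
by rewrite mule_ge0 ?lee_fin// (switch_kernel_ge0 (positive_rate_ge0 rate0)).
Qed.

(** Two finite measures that agree on the half-lines ]x, +oo[ are equal. *)
Lemma sojourn_law n t (A : set R) : 0 < t -> measurable A ->
  ((expR (L t))%:E * P [set w | N t w = n.+1 /\ A (Z (last_direction R n) t w)] =
   \int[mu]_(p in A) sojourn_density n t p)%E.
Proof.
move=> t0 mA; set a := last_direction R n; have t0' := ltW t0.
have mn := count_measurable hN n.+1 t0'.
pose b i := a (minn i n.+1).
have bk i : (n.+1 <= i)%N -> b i = b n.+1 by move=> ki; rewrite /b minnn (minn_idPr ki).
have pZ := additive_functional_eventually_const_measurable hN t0' bk.
have mZ : measurable_fun setT (Z b t).
  move=> _ B mB; apply: (past_measurable hN).
  exact: (pZ measurableT B mB).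
have ZE w : N t w = n.+1 -> Z a t w = Z b t w.
  move=> Ns; apply: eq_Rintegral => x; rewrite inE/= in_itv/= => /andP[x0 xs].
  by rewrite /b (minn_idPl _)// -Ns (pp_nondecreasing hN).
have EE (B : set R) : [set w | N t w = n.+1 /\ B (Z a t w)] =
    (Z b t @^-1` B) `&` [set w | N t w = n.+1].
  by apply/seteqP; split => w /=; [move=> [Nt]; rewrite (ZE w Nt)|move=> [+ Nt]; rewrite -(ZE w Nt)].
have e0 : 0 <= expR (L t) by exact: expR_ge0.
pose m0 := @measure_function_pushforward__canonical__measure_function_Measure _ _
  Om (measurableTypeR R) _ (mrestr P mn) _ mZ.
pose m1 := mscale (NngNum e0) m0.
pose m2 := density_measure (mu : {measure set (measurableTypeR R) -> \bar R})
  (sojourn_density_measurable n t) (sojourn_density_ge0 n t).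
rewrite EE; change (m1 A = m2 A).
have ray (x : R) : m1 `]x, +oo[%classic = m2 `]x, +oo[%classic.
  (* A Lipschitz function that is positive exactly on ]x, +oo[. *)
  pose delta (y : R) := Num.max 0 (y - x).
  have d0 y : 0 <= delta y by rewrite le_max lexx.
  have dK y z : `|delta y - delta z| <= `|y - z|.
    rewrite /delta /Num.max.
    have h := ler_norm (y - z); have h' := ler_norm (z - y); rewrite distrC in h'.
    by case: ltP => ?; case: ltP => ?; rewrite ?subrr ?normr0// ler_norml; apply/andP; split; lra.
  have dE y : (0 < delta y) = (x < y) by rewrite lt_max ltxx /= subr_gt0.
  have := law_open rate0 rateI hN n t0 d0 dK.
  rewrite (_ : [set w | _ /\ _] = (Z b t @^-1` `]x, +oo[%classic) `&` [set w | N t w = n.+1]); last first.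
    by rewrite -EE; apply/seteqP; split => w /=; rewrite dE in_itv/= andbT.
  rewrite -/a => h; change (m1 `]x, +oo[%classic = (\int[mu]_(p in `]x, +oo[) sojourn_density n t p)%E).
  apply: (etrans h); rewrite integral_itvoo_bool [RHS]integral_mkcond.
  apply: eq_integral => p _; rewrite dE /patch /sojourn_density.
  case: ifPn; rewrite ?inE ?notin_setE /= in_itv/= andbT.
    by move=> ->; rewrite mul1e.
  by move=> /negP/negbTE ->; rewrite mul0e mule0.
refine (@measure_unique _ _ (measurableTypeR R) (@RGenOInfty.G R) (fun k => `](- k%:R), +oo[%classic)
  (RGenOInfty.measurableE R) _ _ _ m1 m2 _ _ A mA).
- move=> _ _ [x ->] [y ->]; exists (Num.max x y); apply/seteqP; split => z /=; rewrite !in_itv/= !andbT gt_max.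
    by move=> [-> ->].
  by move=> /andP[].
- by move=> k; exists (- k%:R).
- apply/seteqP; split => // x _; exists (Num.bound `|x|) => //=.
  rewrite in_itv/= andbT ltrNl; apply: le_lt_trans (archi_boundP (normr_ge0 x)).
  by rewrite -normrN ler_norm.
- by move=> _ [x ->]; exact: ray.
- move=> k; change (((expR (L t))%:E * P ((Z b t @^-1` `](- k%:R)%R, +oo[%classic) `&` [set w | N t w = n.+1])) < +oo)%E.
  rewrite lte_mul_pinfty//; apply: (le_lt_trans (probability_le1 _ _)); last exact: ltry.
  by rewrite -EE; exact: (functional_event_measurable hN).
Qed.

Lemma sojourn_density_mass n t : 0 < t ->
  (\int[mu]_p sojourn_density n t p = (expR (L t) * poisson_weight (L t) n.+1)%:E)%E.
Proof.
move=> t0; rewrite -(sojourn_law n t0 measurableT) EFinM -(count_law hN _ (ltW t0)).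
by congr (_ * P _)%E; apply/seteqP; split => w /=; [case|].
Qed.

End law.

(** * Finiteness of the sum of the kernels *)

Section kernel_sum.
Context (R : realType) (rate : R -> R).
Notation mu := (@lebesgue_measure R).
Hypothesis rate0 : forall t : R, 0 < t -> 0 <= rate t.
Hypothesis rateI : forall t : R, 0 < t -> mu.-integrable `]0, t] (EFin \o rate).
Hypothesis ratec : forall t : R, 0 < t -> {for t, continuous rate}.
Notation rho := (positive_rate rate).
Notation kap := (switch_kernel rho).
Hypothesis mass : forall T : R, 0 < T -> exists B : R, forall t, 0 < t -> t <= T ->
  (\sum_(n <oo) \int[mu]_p sojourn_density rate n t p <= B%:E)%E.

Let rho0 := positive_rate_ge0 rate0.
Let rhom := positive_rate_measurable rateI.
Let mk := switch_kernel_measurable rho0 rhom.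
Let k0 := switch_kernel_ge0 rho0.

Definition kernel_sum (p q : R) : \bar R := (\sum_(n <oo) kap n p q)%E.
Notation Se := kernel_sum.

Lemma kernel_sum_ge0 p q : (0 <= Se p q)%E.
Proof. by apply: nneseries_ge0 => n _ _; exact: k0. Qed.

Lemma kernel_sum_measurable : measurable_fun setT (fun z : R * R => Se z.1 z.2).
Proof.
apply: (emeasurable_fun_cvg (fun n z => (\sum_(0 <= i < n) kap i z.1 z.2)%E)).
  by move=> n; exact: emeasurable_sum.
move=> z _; exact: is_cvg_nneseries.
Qed.

Let mSe (q : R) : measurable_fun setT (fun r => Se q r).
Proof. by apply: measurable_fun2_comp => //; exact: kernel_sum_measurable. Qed.

(** Separating the first kernel from the series gives the renewal equation. *)
Lemma kernel_sumE p q :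
  (Se p q = (rho q)%:E + \int[mu]_(r in `]0%R, p[) ((rho (r + q))%:E * Se q r))%E.
Proof.
rewrite /kernel_sum nneseries_recl//; congr (_ + _)%E.
under [RHS]eq_integral do rewrite -nneseriesZl//.
rewrite integral_nneseries//.
- by rewrite -nneseries_addn//; apply: eq_eseriesr => n _; rewrite addn1.
- move=> n; apply: measurable_funTS; apply: emeasurable_funM.
    by apply/measurable_EFinP; apply: measurableT_comp => //; exact: measurable_funD.
  exact: measurable_fun2_comp.
- by move=> n r _; rewrite mule_ge0// lee_fin.
Qed.

(** The inner integral is the sum of the masses of the sojourn densities, bounded
    by hypothesis, and the rate is integrable. *)
Lemma kernel_sum_triangle (T : R) : 0 < T ->
  (\int[mu]_(s in `]0%R, T[) ((rho s)%:E * \int[mu]_(r in `]0%R, s[) Se r (s - r)%R) < +oo)%E.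
Proof.
move=> T0; have [B hB] := mass T0.
have mIT : measurable_fun `]0, T[ (EFin \o rho) by apply/measurable_EFinP/measurable_funTS.
have B0 : 0 <= B.
  rewrite -lee_fin; apply: le_trans (hB _ T0 (lexx T)); apply: nneseries_ge0 => n _ _.
  by apply: integral_ge0 => p _; exact: sojourn_density_ge0.
have inner s : 0 < s -> s <= T -> (\int[mu]_(r in `]0%R, s[) Se r (s - r)%R <= B%:E)%E.
  move=> s0 sT; apply: le_trans (hB _ s0 sT); rewrite integral_nneseries//; last first.
    by move=> n; apply: measurable_funTS; apply: measurable_fun2_comp => //; exact: measurable_funB.
  by under eq_eseriesr do rewrite integral_itvoo_bool.
apply: (@le_lt_trans _ _ (\int[mu]_(s in `]0%R, T[) (B%:E * (rho s)%:E))%E).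
  apply: ge0_le_integral => //.
  - move=> s _; rewrite mule_ge0// ?lee_fin//; apply: integral_ge0 => r _; exact: kernel_sum_ge0.
  - apply: emeasurable_funM => //; apply: measurable_funTS.
    under eq_fun do rewrite integral_itvoo_bool.
    have mF : measurable_fun setT (fun sr : R * R =>
       ((((0 < sr.2) && (sr.2 < sr.1))%R%:R)%:E * Se sr.2 (sr.1 - sr.2)%R)%E).
      apply: emeasurable_funM.
        by apply/measurable_EFinP; exact: measurable_fun_between01.
      apply: measurable_fun2_comp => //; first exact: kernel_sum_measurable.
      exact: measurable_funB.
    have F0 : forall sr : R * R,
       (0 <= (((0 < sr.2) && (sr.2 < sr.1))%R%:R)%:E * Se sr.2 (sr.1 - sr.2)%R)%E.
      by move=> sr; rewrite mule_ge0 ?lee_fin// kernel_sum_ge0.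
    exact: (@measurable_fun_fubini_tonelli_F _ _ _ _ R mu _ mF F0).
  - by apply: emeasurable_funM.
  - move=> s /=; rewrite in_itv/= => /andP[s0 sT].
    by rewrite muleC lee_wpmul2r// ?lee_fin// inner// ltW.
rewrite ge0_integralZl//; last by move=> s _; rewrite lee_fin.
apply: lte_mul_pinfty => //.
have /integrableP[_] := rateI T0; apply: le_lt_trans.
have mr : measurable_fun `]0, T[ (fun x => `|(EFin \o rate) x|)%E.
  apply: measurableT_comp => //.
  by apply: (measurable_funS _ _ (measurable_int mu (rateI T0))) => //; apply: subset_itvl; rewrite bnd_simp.
rewrite -integral_itv_bndo_bndc//.
apply: ge0_le_integral => //.
- by move=> s _; rewrite lee_fin.
- move=> s /=; rewrite in_itv/= => /andP[s0 sT].
  by rewrite /positive_rate /= s0 lee_fin; exact: ler_norm.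
Qed.

(** No pointwise bound on the series is available a priori. After the renewal
    equation the integral runs over a rectangle contained in the triangle
    r + s < p + q, where it is finite by the previous lemma. *)
Lemma kernel_sum_integral_lty (p q : R) : 0 < p -> 0 < q ->
  (\int[mu]_(r in `]0%R, p[) Se q r < +oo)%E.
Proof.
move=> p0 q0.
have T0 : 0 < p + q by rewrite addr_gt0.
have mrho : measurable_fun setT (EFin \o rho) by exact/measurable_EFinP.
under eq_integral do rewrite kernel_sumE.
pose G (T' : R -> R) (r : R) : \bar R := (\int[mu]_(s in `]0%R, T' r[) ((rho (s + r))%:E * Se r s))%E.
have G0 T' r : (0 <= G T' r)%E.
  by apply: integral_ge0 => s _; rewrite mule_ge0 ?lee_fin// kernel_sum_ge0.
have mG T' : measurable_fun setT T' -> measurable_fun setT (G T').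
  move=> mT'; rewrite /G; under eq_fun do rewrite integral_itvoo_bool.
  have mF : measurable_fun setT (fun rs : R * R =>
     ((((0 < rs.2) && (rs.2 < T' rs.1))%R%:R)%:E * ((rho (rs.2 + rs.1))%:E * Se rs.1 rs.2))%E).
    apply: emeasurable_funM.
      apply/measurable_EFinP; apply: measurable_fun_between01 => //.
      exact: measurableT_comp.
    apply: emeasurable_funM; last exact: kernel_sum_measurable.
    by apply/measurable_EFinP; apply: measurableT_comp => //; exact: measurable_funD.
  have F0 : forall rs : R * R, (0 <=
     (((0 < rs.2) && (rs.2 < T' rs.1))%R%:R)%:E * ((rho (rs.2 + rs.1))%:E * Se rs.1 rs.2))%E.
    by move=> rs; rewrite !mule_ge0 ?lee_fin// kernel_sum_ge0.
  exact: (@measurable_fun_fubini_tonelli_F _ _ _ _ R mu _ mF F0).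
have mi (r : R) : measurable_fun setT (fun s : R => (rho (s + r)%R)%:E * Se r s)%E.
  apply: emeasurable_funM => //.
  by apply/measurable_EFinP; apply: measurableT_comp => //; exact: measurable_funD.
have mq : measurable_fun setT (G (cst q)) by exact: mG.
(* The rectangle 0 < r < p, 0 < s < q lies in the triangle 0 < s < p + q - r. *)
pose Tr (r : R) := p + q - r.
have mT : measurable_fun setT (G Tr) by apply: mG; exact: measurable_funB.
rewrite ge0_integralD//; [|by move=> r _; rewrite lee_fin|exact: measurable_funTS|by move=> r _; exact: (G0 (cst q))|exact: (measurable_funTS mq)].
apply: lte_add_pinfty.
  have /integrableP[_] := rateI p0; apply: le_lt_trans.
  rewrite -integral_itv_bndo_bndc; last first.
    apply: measurableT_comp => //.
    by apply: (measurable_funS _ _ (measurable_int mu (rateI p0))) => //; apply: subset_itvl; rewrite bnd_simp.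
  have mr : measurable_fun `]0, p[ (fun x => `|(EFin \o rate) x|)%E.
    apply: measurableT_comp => //.
    by apply: (measurable_funS _ _ (measurable_int mu (rateI p0))) => //; apply: subset_itvl; rewrite bnd_simp.
  apply: ge0_le_integral => //.
  - by move=> s _; rewrite lee_fin.
  - exact: measurable_funTS.
  move=> s /=; rewrite in_itv/= => /andP[s0 _].
  by rewrite /positive_rate /= s0 lee_fin; exact: ler_norm.
suff h : (\int[mu]_(r in `]0%R, (p + q)%R[) G Tr r < +oo)%E.
  apply: le_lt_trans h.
  apply: (@le_trans _ _ (\int[mu]_(r in `]0%R, p[) G Tr r)%E).
    apply: ge0_le_integral => //.
    - by move=> r _; exact: (G0 (cst q)).
    - exact: (measurable_funTS mq).
    - exact: (measurable_funTS mT).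
    move=> r /=; rewrite in_itv/= => /andP[r0 rp].
    apply: ge0_subset_integral => //.
    - exact: (measurable_funTS (mi r)).
    - by move=> s _; rewrite mule_ge0 ?lee_fin// kernel_sum_ge0.
    - by apply: subset_itvl; rewrite bnd_simp /Tr; lra.
  apply: ge0_subset_integral => //; first exact: (measurable_funTS mT).
  by apply: subset_itvl; rewrite bnd_simp lerDl ltW.
have := kernel_sum_triangle T0.
have := @switch_kernel_tonelli R rho rho0 rhom (p + q) (cst 1) Se (measurable_cst _)
  (fun _ => ler01) kernel_sum_measurable kernel_sum_ge0.
under eq_integral do under eq_integral do rewrite mul1e.
under [RHS]eq_integral do rewrite mul1e.
move=> ->; apply: le_lt_trans; rewrite !integral_itvoo_bool.
rewrite -(@ge0_integral_reflect _ (p + q)) => [| |r]; last 2 first.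
- by apply: emeasurable_funM => //; apply/measurable_EFinP; exact: measurable_fun_between01.
- by rewrite mule_ge0 ?lee_fin.
rewrite le_eqVlt; apply/orP; left; apply/eqP; apply: eq_integral => r _.
rewrite subr_gt0 (_ : (p + q - r < p + q) = (0 < r)) 1?andbC; last by rewrite gtrBl.
by rewrite /G /Tr subKr.
Qed.

Lemma positive_rate_bounded (a b : R) : 0 < a ->
  exists C : R, forall x, a <= x <= b -> 0 <= rho x <= C.
Proof.
move=> a0; have [ba|ab] := ltP b a.
  by exists 0 => x /andP[ax xb]; have := le_lt_trans (le_trans ax xb) ba; rewrite ltxx.
have cr : {within `[a, b], continuous rate}.
  apply: continuous_in_subspaceT => x; rewrite inE /= in_itv/= => /andP[ax _].
  by apply: ratec; exact: lt_le_trans ax.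
have [c _ hc] := EVT_max ab cr.
exists (rate c) => x /andP[ax xb]; have x0 := lt_le_trans a0 ax.
by rewrite rho0 /positive_rate x0 hc// in_itv/= ax xb.
Qed.

Lemma kernel_sum_lty (p q : R) : 0 < p -> 0 < q -> (Se p q < +oo)%E.
Proof.
move=> p0 q0; rewrite kernel_sumE; apply: lte_add_pinfty; first exact: ltry.
have [C hC] := positive_rate_bounded (p + q) q0.
apply: (@le_lt_trans _ _ (\int[mu]_(r in `]0%R, p[) (C%:E * Se q r))%E).
  apply: ge0_le_integral => //.
  - by move=> r _; rewrite mule_ge0 ?lee_fin// kernel_sum_ge0.
  - apply: measurable_funTS; apply: emeasurable_funM => //.
    by apply/measurable_EFinP; apply: measurableT_comp => //; exact: measurable_funD.
    exact: mSe.
  - by apply: measurable_funTS; apply: measurable_funeM; exact: mSe.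
  - move=> r /=; rewrite in_itv/= => /andP[r0 rp].
    rewrite lee_wpmul2r ?kernel_sum_ge0// lee_fin.
    by have /andP[] : 0 <= rho (r + q) <= C by apply: hC; apply/andP; split; lra.
have C0 : 0 <= C.
  have /andP[h1 h2] : 0 <= rho q <= C by apply: hC; apply/andP; split; lra.
  exact: le_trans h1 h2.
rewrite ge0_integralZl//; [|apply: measurable_funTS; exact: mSe|by move=> r _; exact: kernel_sum_ge0].
by apply: lte_mul_pinfty => //; exact: kernel_sum_integral_lty.
Qed.

End kernel_sum.

(** * Regularity of the total kernel *)

Lemma near_continuous (T U : topologicalType) (f g : T -> U) (p : T) :
  (\forall x \near p, f x = g x) -> {for p, continuous g} -> {for p, continuous f}.
Proof.
move=> fg cg; rewrite /prop_for /continuous_at (nbhs_singleton fg).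
by apply: cvg_trans cg; apply: near_eq_cvg; apply: filterS fg => x ->.
Qed.

Section total_kernel.
Context (R : realType) (rate : R -> R).
Notation mu := (@lebesgue_measure R).
Hypothesis rate0 : forall t : R, 0 < t -> 0 <= rate t.
Hypothesis rateI : forall t : R, 0 < t -> mu.-integrable `]0, t] (EFin \o rate).
Hypothesis ratec : forall t : R, 0 < t -> {for t, continuous rate}.
Hypothesis mass : forall T : R, 0 < T -> exists B : R, forall t, 0 < t -> t <= T ->
  (\sum_(n <oo) \int[mu]_p sojourn_density rate n t p <= B%:E)%E.

Definition total_kernel (p q : R) : R := fine (kernel_sum rate p q).
Notation S := total_kernel.

Lemma total_kernel_ge0 p q : 0 <= S p q.
Proof. by rewrite fine_ge0// kernel_sum_ge0. Qed.

Lemma EFin_total_kernel p q : 0 < p -> 0 < q -> (S p q)%:E = kernel_sum rate p q.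
Proof.
move=> p0 q0; rewrite fineK// ge0_fin_numE ?kernel_sum_ge0//.
exact: kernel_sum_lty.
Qed.

Lemma total_kernel_measurable q : measurable_fun setT (S q).
Proof.
have mk : measurable_fun setT (fun r => kernel_sum rate q r).
  by apply: measurable_fun2_comp => //; exact: kernel_sum_measurable.
exact: (measurableT_comp (f := fine) _ mk).
Qed.

Lemma total_kernel_integrable q p : 0 < q -> mu.-integrable `]0, p] (EFin \o S q).
Proof.
move=> q0; have [p0|p0] := ltP 0 p; last first.
  by rewrite set_itv_ge ?bnd_simp -?leNgt//; exact: integrable_set0.
apply/integrableP; split.
  by apply/measurable_EFinP/measurable_funTS; exact: total_kernel_measurable.
rewrite -integral_itv_bndo_bndc; last first.
  apply: measurableT_comp => //.
  by apply/measurable_EFinP/measurable_funTS; exact: total_kernel_measurable.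
apply: le_lt_trans (kernel_sum_integral_lty rate0 rateI mass p0 q0).
rewrite le_eqVlt; apply/orP; left; apply/eqP; apply: eq_integral => r.
rewrite inE /= in_itv/= => /andP[r0 _].
by rewrite /= ger0_norm ?total_kernel_ge0// EFin_total_kernel.
Qed.

Definition renewal_integrand (q r : R) : R := rate (r + q) * S q r.
Notation h := renewal_integrand.

Lemma renewal_integrand_ge0 q r : 0 < q -> 0 < r -> 0 <= h q r.
Proof. by move=> q0 r0; rewrite mulr_ge0 ?total_kernel_ge0// rate0// addr_gt0. Qed.

Lemma rate_bounded (a b : R) : 0 < a -> exists2 C : R, 0 <= C & forall x, a <= x <= b -> `|rate x| <= C.
Proof.
move=> a0; have [C hC] := positive_rate_bounded rate0 ratec b a0.
exists `|C| => // x /andP[ax xb]; have x0 := lt_le_trans a0 ax.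
have := hC x; rewrite ax xb => /(_ isT) /andP[]; rewrite /positive_rate x0 => r0 rC.
by rewrite ger0_norm// (le_trans rC)// ler_norm.
Qed.

Lemma shifted_rate_measurable (q p : R) : 0 < q -> measurable_fun `]0, p] (fun r => rate (r + q)).
Proof.
move=> q0; apply: (eq_measurable_fun (fun r : R => positive_rate rate (r + q))).
  move=> r; rewrite inE /= in_itv/= => /andP[r0 _].
  by rewrite /positive_rate addr_gt0.
apply: measurable_funTS; apply: measurableT_comp; first exact: positive_rate_measurable.
exact: measurable_funD.
Qed.

Lemma renewal_integrand_integrable q p : 0 < q -> mu.-integrable `]0, p] (EFin \o h q).
Proof.
move=> q0; have [C C0 hC] := rate_bounded (p + q) q0.
apply: (@le_integrable _ _ _ mu `]0, p] _ _ (fun r => C%:E * (S q r)%:E)%E) => //.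
- apply/measurable_EFinP; apply: measurable_funM; first exact: shifted_rate_measurable.
  by apply: measurable_funTS; exact: total_kernel_measurable.
- move=> r /=; rewrite in_itv/= => /andP[r0 rp].
  rewrite lee_fin [X in X <= _]normrM [X in _ <= X]normrM.
  apply: ler_wpM2r; first exact: normr_ge0.
  by rewrite (ger0_norm C0); apply: hC; apply/andP; split; lra.
- by apply: integrableZl => //; exact: total_kernel_integrable.
Qed.

Lemma total_kernelE p q : 0 < p -> 0 < q -> S p q = rate q + cumulative_rate (h q) p.
Proof.
move=> p0 q0; have hI := renewal_integrand_integrable p q0.
apply: EFin_inj; rewrite EFin_total_kernel// kernel_sumE// EFinD; congr (_ + _)%E.
  by rewrite /positive_rate q0.
rewrite /cumulative_rate /Rintegral fineK; last exact: integrable_fin_num hI.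
rewrite -integral_itv_bndo_bndc; last first.
  by apply: (measurable_funS _ _ (measurable_int mu hI)) => //; apply: subset_itvl; rewrite bnd_simp.
apply: eq_integral => r; rewrite inE /= in_itv/= => /andP[r0 rp].
by rewrite /positive_rate addr_gt0// -EFin_total_kernel.
Qed.

Let h0 q : 0 < q -> forall t : R, 0 < t -> 0 <= h q t.
Proof. by move=> q0 t t0; exact: renewal_integrand_ge0. Qed.
Let hI q : 0 < q -> forall t : R, 0 < t -> mu.-integrable `]0, t] (EFin \o h q).
Proof. by move=> q0 t t0; exact: renewal_integrand_integrable. Qed.

Lemma total_kernel_nd p p' q : 0 < p -> p <= p' -> 0 < q -> S p q <= S p' q.
Proof.
move=> p0 pp' q0; have p0' := lt_le_trans p0 pp'.
rewrite (total_kernelE p0 q0) (total_kernelE p0' q0) lerD2l.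
by apply: (cumulative_rate_nd (h0 q0) (hI q0)) => //; exact: ltW.
Qed.

Let near_pos (p : R) : 0 < p -> \forall x \near p, 0 < x.
Proof. by move=> p0; exact: lt_nbhsr. Qed.

Lemma total_kernel_continuous1 p q : 0 < p -> 0 < q -> {for p, continuous (S^~ q)}.
Proof.
move=> p0 q0; apply: (near_continuous (g := fun p => rate q + cumulative_rate (h q) p)).
  by near=> x; rewrite total_kernelE//; near: x; exact: near_pos.
apply: cvgD; first exact: cvg_cst.
exact: (cumulative_rate_continuous_at (hI q0)).
Unshelve. all: by end_near. Qed.

Lemma renewal_integrand_continuous1 q r : 0 < q -> 0 < r -> {for q, continuous (h^~ r)}.
Proof.
move=> q0 r0; apply: cvgM; last exact: total_kernel_continuous1.
apply: (@continuous_comp _ _ _ (fun q => r + q) rate).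
  by apply: cvgD; [exact: cvg_cst|exact: cvg_id].
by apply: ratec; rewrite addr_gt0.
Qed.

(** By domination, S being nondecreasing in its first argument. *)
Lemma total_kernel_continuous2 p q : 0 < p -> 0 < q -> {for q, continuous (S p)}.
Proof.
move=> p0 q0; apply: (near_continuous
    (g := fun q => rate q + \int[mu]_(r in `]0, p]) h q r)).
  by near=> x; rewrite total_kernelE//; near: x; exact: near_pos.
apply: cvgD; first exact: ratec.
have u0 : 0 < q / 2 by rewrite divr_gt0.
have [C C0 hC] := rate_bounded (p + (q + 1)) u0.
apply: (@continuity_under_integral R _ _ mu h `]0, p] (measurable_itv _) (q / 2) (q + 1) _ _
  (fun r => C * S (q + 1) r)).
- move=> x; rewrite /= in_itv/= => /andP[x0 _]; apply: renewal_integrand_integrable.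
  exact: lt_trans x0.
- apply: aeW => r; rewrite /= in_itv/= => /andP[r0 _] x; rewrite inE /= in_itv/= => /andP[x0 _].
  by apply: renewal_integrand_continuous1 => //; exact: lt_trans x0.
- have Si : mu.-integrable `]0, p] (EFin \o S (q + 1)) by apply: total_kernel_integrable; lra.
  exact: (integrableZl _ C Si).
- move=> x; rewrite /= in_itv/= => /andP[x0 x1]; apply: aeW => r; rewrite /= in_itv/= => /andP[r0 rp].
  have x0' := lt_trans u0 x0.
  rewrite /h normrM ler_pM//.
    by apply: hC; apply/andP; split; lra.
  rewrite ger0_norm ?total_kernel_ge0//; apply: total_kernel_nd => //; exact: ltW.
- by rewrite inE /= in_itv/=; apply/andP; split; lra.
Unshelve. all: by end_near. Qed.

Lemma renewal_integrand_continuous2 q r : 0 < q -> 0 < r -> {for r, continuous (h q)}.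
Proof.
move=> q0 r0; apply: cvgM; last exact: total_kernel_continuous2.
apply: (@continuous_comp _ _ _ (fun r => r + q) rate).
  by apply: cvgD; [exact: cvg_id|exact: cvg_cst].
by apply: ratec; rewrite addr_gt0.
Qed.

(** The fundamental theorem of calculus in the renewal equation. *)
Lemma total_kernel_derive1 (p q : R) : 0 < p -> 0 < q ->
  is_derive p 1 (S^~ q) (rate (p + q) * S q p).
Proof.
move=> p0 q0.
have d1 := cumulative_rate_derive (hI q0) p0 (renewal_integrand_continuous2 q0 p0).
have d2 : is_derive p 1 (fun p => rate q + cumulative_rate (h q) p) (h q p).
  by have := is_deriveD (is_derive_cst (rate q) p 1) d1; rewrite add0r.
apply: near_eq_is_derive d2.
by near=> x; rewrite total_kernelE//; near: x; exact: near_pos.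
Unshelve. all: by end_near. Qed.

(** S is nondecreasing and continuous in p: its values at p - delta and p + delta,
    which are continuous in q, enclose those at nearby points. *)
Lemma total_kernel_continuous (p q : R) : 0 < p -> 0 < q ->
  {for (p, q), continuous (fun z : R * R => S z.1 z.2)}.
Proof.
move=> p0 q0; apply/cvgrPdist_lt => e e0.
have e20 : 0 < e / 2 by rewrite divr_gt0.
have /cvgrPdist_lt /(_ _ e20) := total_kernel_continuous1 p0 q0.
move=> /nbhs_ballP[dl /= dl0 hdl].
(* Halving keeps p - d positive and within the radius of continuity. *)
pose d := Num.min dl p / 2.
have m0 : 0 < Num.min dl p by rewrite lt_min dl0.
have d0 : 0 < d by rewrite divr_gt0.
have ddl : d < dl by rewrite /d ltr_pdivrMr// gt_min; apply/orP; left; rewrite mulr2n mulrDr mulr1 ltrDl.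
have dp : d < p.
  by rewrite /d ltr_pdivrMr// gt_min; apply/orP; right; rewrite mulr2n mulrDr mulr1 ltrDl.
have pl0 : 0 < p - d by rewrite subr_gt0.
have pr0 : 0 < p + d by rewrite addr_gt0.
have hl : `|S p q - S (p - d) q| < e / 2.
  by apply: hdl; rewrite /ball/= subKr gtr0_norm.
have hr : `|S p q - S (p + d) q| < e / 2.
  by apply: hdl; rewrite /ball/= opprD addNKr normrN gtr0_norm.
have /cvgrPdist_lt /(_ _ e20) cl := total_kernel_continuous2 pl0 q0.
have /cvgrPdist_lt /(_ _ e20) cr := total_kernel_continuous2 pr0 q0.
have : \forall z \near (p, q), ball p d z.1 /\
    [/\ 0 < z.2, `|S (p - d) q - S (p - d) z.2| < e / 2 & `|S (p + d) q - S (p + d) z.2| < e / 2].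
  exists (ball p d, fun y => [/\ 0 < y, `|S (p - d) q - S (p - d) y| < e / 2 &
      `|S (p + d) q - S (p + d) y| < e / 2]) => //=; split; first exact: nbhsx_ballx.
  by near=> y; split; near: y => //; exact: near_pos.
apply: filterS => -[x y] /= [+ [y0 h1 h2]]; rewrite /ball/= ltr_distlC => /andP[x1 x2].
have x0 : 0 < x by exact: lt_trans x1.
have := total_kernel_nd pl0 (ltW x1) y0; have := total_kernel_nd x0 (ltW x2) y0.
move: hl hr h1 h2; rewrite !ltr_norml => /andP[? ?] /andP[? ?] /andP[? ?] /andP[? ?] ? ?.
by apply/andP; split; lra.
Unshelve. all: by end_near. Qed.

End total_kernel.

(** * From sojourn times to positions *)

Lemma switch_kernel_scale (R : realType) (rho : R -> R) (a : R) n p q :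
  0 <= a -> (forall x, 0 <= rho x) -> measurable_fun setT rho ->
  (switch_kernel (fun x => (a * rho x)%R) n p q = (a ^+ n.+1)%:E * switch_kernel rho n p q)%E.
Proof.
move=> a0 rho0 mrho; elim: n p q => [|n IH] p q; first by rewrite /= expr1 EFinM.
rewrite [LHS]/= [switch_kernel rho n.+1 p q]/=.
rewrite -ge0_integralZl//; last 3 first.
- apply: measurable_funTS; apply: emeasurable_funM.
    by apply/measurable_EFinP; apply: measurableT_comp => //; exact: measurable_funD.
  by apply: measurable_fun2_comp => //; exact: switch_kernel_measurable.
- by move=> r _; rewrite mule_ge0 ?lee_fin// switch_kernel_ge0.
- by rewrite lee_fin exprn_ge0.
apply: eq_integral => r _; rewrite IH (exprS a n.+1) !EFinM.
by rewrite muleACA.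
Qed.

Lemma positive_rateZ (R : realType) (rate : R -> R) (a : R) :
  positive_rate (fun t => rate t * a) = (fun x => a * positive_rate rate x).
Proof.
by apply/funext => x; rewrite /positive_rate; case: ifP; rewrite ?mulr0// mulrC.
Qed.

Lemma sojourn_density_scale (R : realType) (rate : R -> R) (a : R) n t p :
  0 <= a -> (forall t, 0 < t -> 0 <= rate t) ->
  (forall t, 0 < t -> (@lebesgue_measure R).-integrable `]0, t] (EFin \o rate)) ->
  (sojourn_density (fun t => (rate t * a)%R) n t p =
   (a ^+ n.+1)%:E * sojourn_density rate n t p)%E.
Proof.
move=> a0 rate0 rateI; rewrite /sojourn_density positive_rateZ switch_kernel_scale//.
- by rewrite muleCA.
- exact: positive_rate_ge0.
- exact: positive_rate_measurable.
Qed.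

Section flight.
Context (R : realType) (rate : R -> R).
Notation mu := (@lebesgue_measure R).
Hypothesis rate0 : forall t : R, 0 < t -> 0 <= rate t.
Hypothesis rateI : forall t : R, 0 < t -> mu.-integrable `]0, t] (EFin \o rate).
Notation L := (cumulative_rate rate).
Context (d : measure_display) (Om : measurableType d) (P : probability Om R).
Context (N : R -> Om -> nat).
Hypothesis hN : poisson_process P rate N.
Notation Z := (additive_functional N).

(** A motion on the line that has spent the time Z out of t in its last direction,
    of sign sg, is at sg v (2 Z - t). *)
Lemma flight_law n t (v sg : R) (A : set R) : 0 < t -> 0 < v -> `|sg| = 1 -> measurable A ->
  ((expR (L t))%:E * P [set w | N t w = n.+1 /\ A (sg * v * (2 * Z (last_direction R n) t w - t))%R] =
   ((2 * v)^-1)%:E * \int[mu]_(x in A) sojourn_density rate n t ((t + sg * x / v) / 2)%R)%E.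
Proof.
move=> t0 v0 sg1 mA.
have sgE : sg * sg = 1 by rewrite -expr2 -real_normK ?num_real// sg1 expr1n.
have sg0 : sg != 0 by rewrite -normr_eq0 sg1 oner_eq0.
pose f (p : R) := sg * v * (2 * p - t).
have mf : measurable_fun setT f.
  apply: measurable_funM => //; apply: measurable_funB => //; exact: measurable_funM.
have mfA : measurable (f @^-1` A) by rewrite -[X in measurable X]setTI; exact: mf.
have -> : [set w | N t w = n.+1 /\ A (sg * v * (2 * Z (last_direction R n) t w - t))] =
   [set w | N t w = n.+1 /\ (f @^-1` A) (Z (last_direction R n) t w)] by [].
rewrite (sojourn_law rate0 rateI hN n t0 mfA) [LHS]integral_mkcond [in RHS]integral_mkcond.
have a0 : sg / (2 * v) != 0 by rewrite mulf_neq0// invr_eq0 mulf_neq0// gt_eqF.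
have ms := sojourn_density_measurable rate0 rateI n t.
have s0 := sojourn_density_ge0 rate0 n t.
rewrite -(@ge0_integral_affine _ (sg / (2 * v)) (t / 2))//; last 2 first.
- exact/(measurable_restrictT _ _).1/measurable_funTS.
- by move=> x; rewrite erestrict_ge0.
congr (_ * _)%E.
  by rewrite normrM sg1 mul1r normfV ger0_norm// mulr_ge0// ltW.
apply: eq_integral => x _; rewrite /patch.
have fE : f (sg / (2 * v) * x + t / 2) = x.
  rewrite /f (_ : _ * _ = (sg * sg) * x); first by rewrite sgE mul1r.
  by field; rewrite gt_eqF.
have -> : (sg / (2 * v) * x + t / 2 \in f @^-1` A) = (x \in A).
  by apply/idP/idP; rewrite !inE /= fE.
by case: ifP => // _; congr sojourn_density; field; rewrite gt_eqF.
Qed.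

Lemma count_series_le1 t : 0 <= t -> (\sum_(n <oo) P [set w | N t w = n.+1] <= 1)%E.
Proof.
move=> t0.
have mF (n : nat) : measurable [set w | N t w = n.+1] by exact: (count_measurable hN).
have tF : trivIset setT (fun n : nat => [set w | N t w = n.+1]).
  by apply/trivIsetP => i j _ _ /eqP ij; apply/seteqP; split => // w /= [-> [e]]; apply: ij.
rewrite -(measure_semi_bigcup P mF tF).
  by apply: probability_le1; exact: bigcupT_measurable.
exact: bigcupT_measurable.
Qed.

(** Scaling the rate by a <= 1 multiplies the n-th density by a power of a, and
    the densities of the unscaled rate sum to at most exp(L t). *)
Lemma sojourn_mass_scaled (a : R) : 0 <= a -> a <= 1 ->
  forall T : R, 0 < T -> exists B : R, forall t, 0 < t -> t <= T ->
  (\sum_(n <oo) \int[mu]_p sojourn_density (fun t => (rate t * a)%R) n t p <= B%:E)%E.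
Proof.
move=> a0 a1 T T0; exists (expR (L T)) => t t0 tT.
apply: (@le_trans _ _ ((expR (L t))%:E * \sum_(n <oo) P [set w | N t w = n.+1])%E).
  rewrite -nneseriesZl; last by [].
  apply: lee_nneseries => n _.
    by move=> _; apply: integral_ge0 => p _; rewrite sojourn_density_scale// mule_ge0 ?lee_fin ?exprn_ge0// sojourn_density_ge0.
  have -> : [set w | N t w = n.+1] = [set w | N t w = n.+1 /\ setT (Z (last_direction R n) t w)].
    by apply/seteqP; split => w //= [].
  rewrite (sojourn_law rate0 rateI hN n t0 measurableT).
  under eq_integral do rewrite sojourn_density_scale//.
  apply: ge0_le_integral => //.
  - by move=> p _; rewrite mule_ge0 ?lee_fin ?exprn_ge0// sojourn_density_ge0.
  - by apply: measurable_funeM; exact: sojourn_density_measurable.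
  - exact: sojourn_density_measurable.
  - move=> p _; rewrite -[leRHS]mul1e lee_wpmul2r ?sojourn_density_ge0// lee_fin.
    by rewrite exprn_ile1.
apply: (@le_trans _ _ ((expR (L t))%:E * 1)%E).
  by rewrite lee_wpmul2l ?lee_fin ?expR_ge0// count_series_le1// ltW.
by rewrite mule1 lee_fin ler_expR (cumulative_rate_nd rate0 rateI)// ltW.
Qed.

End flight.

Section cone_density.
Context (R : realType) (rate : R -> R).
Notation mu := (@lebesgue_measure R).
Hypothesis rate0 : forall t : R, 0 < t -> 0 <= rate t.
Hypothesis rateI : forall t : R, 0 < t -> mu.-integrable `]0, t] (EFin \o rate).
Hypothesis ratec : forall t : R, 0 < t -> {for t, continuous rate}.
Hypothesis mass : forall T : R, 0 < T -> exists B : R, forall t, 0 < t -> t <= T ->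
  (\sum_(n <oo) \int[mu]_p sojourn_density rate n t p <= B%:E)%E.
Notation S := (total_kernel rate).

(** The last direction may be the positive or the negative one; at the point x of
    the line the time spent in it is then (t + x/v) / 2 or (t - x/v) / 2. *)
Definition cone_profile (v x t : R) : R :=
  S ((t + x / v) / 2) ((t - x / v) / 2) + S ((t - x / v) / 2) ((t + x / v) / 2).

Lemma cone_coordinates (v x t : R) : 0 < v -> `|x| < v * t ->
  0 < (t + x / v) / 2 /\ 0 < (t - x / v) / 2.
Proof.
move=> v0; rewrite ltr_norml => /andP[h1 h2].
have h : (x / v) * v = x by rewrite mulfVK// gt_eqF.
by split; rewrite divr_gt0//; nra.
Qed.

Let flight_measurable n (v t sg : R) :
  measurable_fun setT (fun x : R => sojourn_density rate n t ((t + sg * x / v) / 2)).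
Proof.
apply: measurableT_comp; first exact: sojourn_density_measurable.
apply: measurable_funM => //; apply: measurable_funD => //.
by apply: measurable_funM => //; exact: measurable_funM.
Qed.

Let m1 n (v t : R) : measurable_fun setT (fun x : R => sojourn_density rate n t ((t + x / v) / 2)).
Proof. by have := flight_measurable n v t 1; under eq_fun do rewrite mul1r. Qed.

Let m2 n (v t : R) : measurable_fun setT (fun x : R => sojourn_density rate n t ((t - x / v) / 2)).
Proof. by have := flight_measurable n v t (-1); under eq_fun do rewrite mulN1r mulNr. Qed.

Let s0 n t x := sojourn_density_ge0 rate0 n t x.

Definition cone_extension (v t x : R) : \bar R :=
  if `|x| < v * t then (cone_profile v x t)%:E else 0%E.

Lemma cone_extensionE (v t x : R) : 0 < v -> cone_extension v t x =
  (\sum_(n <oo) (sojourn_density rate n t ((t + x / v) / 2)%R +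
                 sojourn_density rate n t ((t - x / v) / 2)%R))%E.
Proof.
move=> v0; rewrite nneseriesD//.
have k0 := switch_kernel_ge0 (positive_rate_ge0 rate0).
have Sp (p : R) : (\sum_(n <oo) sojourn_density rate n t p)%E =
    if (0 < p) && (p < t) then (S p (t - p))%:E else 0%E.
  rewrite /sojourn_density; under eq_eseriesr do rewrite muleC.
  case: ifPn => [/andP[p0 pt]|_].
    rewrite EFin_total_kernel// ?subr_gt0//.
    by apply: eq_eseriesr => n _; rewrite mule1.
  by apply: eseries0 => n _ _; rewrite mule0.
rewrite !Sp.
have e1 : t - (t + x / v) / 2 = (t - x / v) / 2 by lra.
have e2 : t - (t - x / v) / 2 = (t + x / v) / 2 by lra.
rewrite /cone_extension; case: (boolP (`|x| < v * t)) => xv.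
  have [u0 w0] := cone_coordinates v0 xv.
  have u1 : (t + x / v) / 2 < t by rewrite -subr_gt0 e1.
  have w1 : (t - x / v) / 2 < t by rewrite -subr_gt0 e2.
  by rewrite u0 w0 u1 w1 e1 e2 -EFinD.
have h : (x / v) * v = x by rewrite mulfVK// gt_eqF.
have hn : ~ (- (v * t) < x /\ x < v * t).
  by move=> h'; move: xv; rewrite ltr_norml => /negP; apply; apply/andP.
rewrite ifF; last by apply/negP => /andP[a1 a2]; apply: hn; split; nra.
rewrite ifF; last by apply/negP => /andP[a1 a2]; apply: hn; split; nra.
by rewrite adde0.
Qed.

Lemma cone_extension_measurable (v t : R) : 0 < v -> measurable_fun setT (cone_extension v t).
Proof.
move=> v0; pose F i (x : R) := (sojourn_density rate i t ((t + x / v) / 2)%R +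
  sojourn_density rate i t ((t - x / v) / 2)%R)%E.
apply: (emeasurable_fun_cvg (fun n x => (\sum_(0 <= i < n) F i x)%E)).
  by move=> n; apply: emeasurable_sum => i; exact: emeasurable_funD.
move=> x _; rewrite cone_extensionE//; apply: is_cvg_nneseries => n _ _.
by rewrite adde_ge0.
Qed.

Lemma cone_extension_ge0 (v t x : R) : (0 <= cone_extension v t x)%E.
Proof.
rewrite /cone_extension; case: ifP => // _.
by rewrite lee_fin addr_ge0// total_kernel_ge0.
Qed.

Lemma cone_profile_series (v t : R) (A : set R) : 0 < v -> measurable A ->
  (\sum_(n <oo) (\int[mu]_(x in A) sojourn_density rate n t ((t + x / v) / 2)%R +
                 \int[mu]_(x in A) sojourn_density rate n t ((t - x / v) / 2)%R) =
   \int[mu]_(x in A) cone_extension v t x)%E.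
Proof.
move=> v0 mA.
have sD n : (\int[mu]_(x in A) sojourn_density rate n t ((t + x / v) / 2)%R +
    \int[mu]_(x in A) sojourn_density rate n t ((t - x / v) / 2)%R =
    \int[mu]_(x in A) (sojourn_density rate n t ((t + x / v) / 2)%R +
      sojourn_density rate n t ((t - x / v) / 2)%R))%E.
  by apply/esym/ge0_integralD => //; apply: measurable_funTS; [exact: m1|exact: m2].
rewrite (eq_eseriesr (fun n _ => sD n)) -integral_nneseries//.
- by apply: eq_integral => x _; rewrite cone_extensionE.
- by move=> n; apply: measurable_funTS; apply: emeasurable_funD; [exact: m1|exact: m2].
- by move=> n x _; rewrite adde_ge0.
Qed.

End cone_density.

(** * Reduction of the planar motion to the horizontal axis *)

(** The alternating sequences d_0, d_2, d_0, ... and d_2, d_0, d_2, ... *)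
Definition flip_direction (b : bool) (k : nat) : 'I_4 :=
  if odd (b + k) then inord 2 else ord0.

Lemma flip_direction_neq b k : flip_direction b k.+1 != flip_direction b k.
Proof. by rewrite /flip_direction addnS /=; case: odd; apply/eqP => /(congr1 val); rewrite /= inordK. Qed.

Section directions.
Context (R : realType).

Lemma cos_direction_flip_direction b k : cos (direction_angle R (flip_direction b k)) = (-1) ^+ (b + k).
Proof.
rewrite /flip_direction /direction_angle -signr_odd; case: odd => /=.
  by rewrite inordK// mulrAC divff// mul1r cospi expr1.
by rewrite mul0r mul0r cos0 expr0.
Qed.

Lemma sin_direction_flip_direction b k : sin (direction_angle R (flip_direction b k)) = 0.
Proof.
rewrite /flip_direction /direction_angle; case: odd => /=.
  by rewrite inordK// mulrAC divff// mul1r sinpi.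
by rewrite mul0r mul0r sin0.
Qed.

Lemma sin_direction_eq0 (k : 'I_4) : sin (direction_angle R k) = 0 ->
  k = ord0 \/ k = inord 2.
Proof.
case: k => -[|[|[|[|//]]]] hk; rewrite /direction_angle /= => h.
- by left; exact/val_inj.
- by move: h; rewrite mul1r sin_pihalf => /eqP; rewrite oner_eq0.
- by right; apply/val_inj; rewrite /= inordK.
- move: h; rewrite (_ : 3%:R * pi / 2 = pi / 2 + pi); last by field.
  by rewrite sinDpi sin_pihalf => /eqP; rewrite oppr_eq0 oner_eq0.
Qed.

(** Relates the velocity after k events to the last one, of index n+1. *)
Lemma signed_direction_functional (b : bool) (n k : nat) :
  (-1) ^+ (b + k) = (-1) ^+ (b + n.+1) * (2 * last_direction R n k - 1) :> R.
Proof.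
rewrite /last_direction -[in LHS]signr_odd -[in RHS]signr_odd !oddD /=.
by case: b; case: (odd k); case: (odd n); rewrite /= ?expr0 ?expr1; ring.
Qed.

End directions.

Section motion.
Context (R : realType) (c : R) (rate : R -> R).
Notation mu := (@lebesgue_measure R).
Hypothesis c0 : 0 < c.
Hypothesis rate0 : forall t : R, 0 < t -> 0 <= rate t.
Hypothesis rateI : forall t : R, 0 < t -> mu.-integrable `]0, t] (EFin \o rate).
Notation L := (cumulative_rate rate).
Context (d : measure_display) (Om : measurableType d) (P : probability Om R).
Context (N : R -> Om -> nat) (D : nat -> Om -> 'I_4).
Hypothesis hN : poisson_process P rate N.
Hypothesis hD : reflecting_directions P D.
Hypothesis hI : independent_sigma P (process_sigma [set t | 0 <= t] N) (process_sigma setT D).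
Notation Z := (additive_functional N).

Definition direction_event (n : nat) (e : nat -> 'I_4) : set Om :=
  \bigcap_(j in `I_n.+1) (D j @^-1` [set e j]).

Lemma direction_event_measurable n e : measurable (direction_event n e).
Proof.
by apply: bigcap_measurable => [|k _]; [exists 0%N|exact: (rd_measurable hD)].
Qed.

Lemma direction_event_sigma n e : process_sigma setT D (direction_event n e).
Proof.
pose gens := [set A | exists i s, [set: nat] i /\ A = D i @^-1` [set s]].
have := @bigcap_measurable _ (g_sigma_algebraType gens) (fun j => D j @^-1` [set e j]) `I_n.+1.
by apply => [|k _]; [exists 0%N|apply: sub_sigma_algebra; exists k, (e k)].
Qed.

Lemma past_process_sigma t A : past N t A -> process_sigma [set t | 0 <= t] N A.
Proof.
apply: smallest_sub; first exact: smallest_sigma_algebra.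
move=> _ [i [k [/andP[i0 _] ->]]]; apply: sub_sigma_algebra.
by exists i, k.
Qed.

Lemma past_direction_independent t A n e : past N t A ->
  P (A `&` direction_event n e) = (P A * P (direction_event n e))%E.
Proof.
by move=> tA; apply: hI; [exact: (past_process_sigma tA)|exact: direction_event_sigma].
Qed.

Lemma flip_direction_event_law n b :
  P (direction_event n (flip_direction b)) = (4^-1 * 3^-1 ^+ n)%:E.
Proof.
rewrite (rd_law hD); congr (_ * _)%:E.
under eq_bigr do rewrite flip_direction_neq.
by rewrite prodr_const card_ord.
Qed.

Lemma repeated_direction_null n e j : (j < n)%N -> e j.+1 = e j ->
  P (direction_event n e) = 0%E.
Proof.
move=> jn ej; rewrite (rd_law hD) (bigD1 (Ordinal jn)) //= ej eqxx mul0r mulr0 //.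
Qed.

Variables (X Y : R -> Om -> R).
Hypothesis hXY : forall (t : R) (w : Om), 0 <= t ->
  X t w = \int[mu]_(s in `[0, t]) (c * cos (direction_angle R (D (N s w) w))) /\
  Y t w = \int[mu]_(s in `[0, t]) (c * sin (direction_angle R (D (N s w) w))).

Let ax (e : nat -> 'I_4) k := c * cos (direction_angle R (e k)).
Let ay (e : nat -> 'I_4) k := c * sin (direction_angle R (e k)).

Lemma motion_functional t w n e : 0 <= t -> N t w = n -> direction_event n e w ->
  X t w = Z (ax e) t w /\ Y t w = Z (ay e) t w.
Proof.
move=> t0 Nt De; have [-> ->] := hXY w t0.
have H s : s \in `[0, t]%classic -> D (N s w) w = e (N s w).
  rewrite inE /= in_itv/= => /andP[s0 st].
  by apply: De; rewrite /= ltnS -Nt (pp_nondecreasing hN).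
by split; apply: eq_Rintegral => s st; rewrite H.
Qed.

Let ayC e k : `|ay e k| <= c.
Proof.
by rewrite /ay normrM gtr0_norm// ler_piMr ?(ltW c0)// ler_norml sin_le1 sin_geN1.
Qed.

Variables (t : R) (A : set R).
Hypotheses (t0 : 0 < t) (mA : measurable A) (AC : A `<=` `](- (c * t)), (c * t)[).

Let Ev : set Om := [set w | A (X t w) /\ Y t w = 0].

Let E n e : set Om := ([set w | N t w = n /\ A (Z (ax e) t w)] `&`
  [set w | N t w = n /\ [set (0 : R)] (Z (ay e) t w)]) `&` direction_event n e.

Let EE n e : E n e = Ev `&` [set w | N t w = n] `&` direction_event n e.
Proof.
apply/seteqP; split => w /=.
  move=> [[[Nn Aw] [_ Yw]] De]; have [hx hy] := motion_functional (ltW t0) Nn De.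
  by rewrite /Ev /= hx hy.
move=> [[[Aw Yw] Nn] De]; have [hx hy] := motion_functional (ltW t0) Nn De.
by rewrite /E /= -hx -hy.
Qed.

Let mE n e : measurable (E n e).
Proof.
apply: measurableI; last exact: direction_event_measurable.
by apply: measurableI; apply: (functional_event_measurable hN) => //; exact: ltW.
Qed.

Let axis_alternating n e : (forall i, (i <= n)%N -> e i = ord0 \/ e i = inord 2) ->
  (forall j, (j < n)%N -> e j.+1 <> e j) ->
  exists b, forall i, (i <= n)%N -> e i = flip_direction b i.
Proof.
move=> h02 ne; have n02 : ord0 <> inord 2 :> 'I_4 by move=> /(congr1 val); rewrite /= inordK.
exists (e 0%N == inord 2); elim=> [_|i IH ilt].
  rewrite /flip_direction addn0; case: (h02 0%N (leq0n _)) => ->.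
    by case: eqP => // /n02.
  by rewrite eqxx.
have := ne i ilt; rewrite (IH (ltnW ilt)) /flip_direction addnS /=.
by case: odd => /=; case: (h02 i.+1 ilt) => ->.
Qed.

(** A sequence of directions contributes only if it alternates along the axis and
    has at least one event: otherwise the ordinate has no atom, or is nonzero, or
    the abscissa is a vertex, or a direction is repeated. *)
Let E_null n e : ~ ((0 < n)%N /\ exists b, forall i, (i <= n)%N -> e i = flip_direction b i) ->
  P (E n e) = 0%E.
Proof.
move=> na; have tw := ltW t0.
have le0 B : measurable B -> E n e `<=` B -> P B = 0%E -> P (E n e) = 0%E.
  move=> mB EB PB; apply/eqP; rewrite -measure_le0 -PB.
  by apply: le_measure; rewrite ?inE.
have empty : E n e `<=` set0 -> P (E n e) = 0%E.
  by move=> h; apply: (le0 set0) => //; rewrite measure0.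
have [h|h] := pselect (forall i, (i <= n)%N -> ay e i = ay e 0%N); last first.
  apply: (le0 [set w | N t w = n /\ Z (ay e) t w = 0]).
  - exact: (functional_event_measurable hN n _ (A := [set 0])).
  - by move=> w [[_ []]].
  - exact: (functional_atomless rate0 rateI hN 0 (ayC e)).
have [a0|a0] := eqVneq (ay e 0%N) 0; last first.
  apply: empty => w [[_ [/= Nt]]]; rewrite (functional_before_change hN tw h Nt) => /eqP.
  by rewrite mulf_eq0 (negbTE a0) gt_eqF.
have h02 i : (i <= n)%N -> e i = ord0 \/ e i = inord 2.
  move=> il; apply: (@sin_direction_eq0 R); have := h i il; rewrite a0 => /eqP.
  by rewrite mulf_eq0 gt_eqF//= => /eqP.
have [n0|n0] := posnP n.
  apply: empty => w [[[/= Nt Aw] _] De].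
  have ax1 i : (i <= n)%N -> ax e i = ax e 0%N by rewrite n0 leqn0 => /eqP ->.
  have := AC Aw; rewrite (functional_before_change hN tw ax1 Nt) /= in_itv/=.
  have c1 : cos (direction_angle R ord0) = 1 by rewrite -[1](cos_direction_flip_direction R false 0).
  have c2 : cos (direction_angle R (inord 2)) = -1.
    by have := cos_direction_flip_direction R true 0; rewrite expr1.
  case: (h02 0%N (leq0n _)) => e0; rewrite /ax e0 ?c1 ?c2.
    by rewrite mulr1 ltxx andbF.
  by rewrite mulrN1 mulNr ltxx.
have [[j jn ej]|nj] := pselect (exists2 j, (j < n)%N & e j.+1 = e j).
  apply: (le0 (direction_event n e)); first exact: direction_event_measurable.
    by move=> w [].
  exact: repeated_direction_null ej.
exfalso; apply: na; split => //; apply: axis_alternating => // j jn ej.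
by apply: nj; exists j.
Qed.

Definition axis_event (n : nat) (b : bool) : set Om :=
  [set w | N t w = n.+1 /\
     A ((-1) ^+ (b + n.+1) * c * (2 * Z (last_direction R n) t w - t))] `&`
  direction_event n.+1 (flip_direction b).

Let axis_eventE n b : axis_event n b = E n.+1 (flip_direction b).
Proof.
have tw := ltW t0.
have i1 w : mu.-integrable `[0, t] (EFin \o (fun s => last_direction R n (N s w))).
  apply: (path_integrable (a := last_direction R n) (C := 1) hN t w) => k.
  by rewrite /last_direction; case: odd; rewrite ?normr1// normr0.
have i2 (w : Om) : mu.-integrable `[0, t] (EFin \o (fun s => 1 : R)).
  have h1 (k : nat) : `|(fun=> 1 : R) k| <= 1 by rewrite normr1.
  exact: (path_integrable hN t w h1).
have i3 w : mu.-integrable `[0, t] (EFin \o (fun s => 2 * last_direction R n (N s w))).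
  exact: (integrableZl _ 2 (i1 w)).
have i4 w : mu.-integrable `[0, t] (EFin \o (fun s => 2 * last_direction R n (N s w) - 1)).
  exact: (integrableB _ (i3 w) (i2 w)).
have It : \int[mu]_(x in `[0, t]) 1 = t.
  by rewrite Rintegral_cst//= lebesgue_measure_itv/= lte_fin mul1r t0 /= subr0.
have Xe w : Z (ax (flip_direction b)) t w =
    (-1) ^+ (b + n.+1) * c * (2 * Z (last_direction R n) t w - t).
  rewrite /additive_functional -[X in _ - X]It.
  rewrite -(RintegralZl 2 _ (i1 w))// -(RintegralB _ (i3 w) (i2 w))//.
  rewrite -(RintegralZl _ _ (i4 w))//; apply: eq_Rintegral => s _.
  rewrite /ax cos_direction_flip_direction (signed_direction_functional _ _ n).
  by rewrite mulrA (mulrC c).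
have Ye w : Z (ay (flip_direction b)) t w = 0.
  rewrite /additive_functional (@eq_Rintegral _ _ _ _ _ (cst 0)).
    by rewrite Rintegral_cst// mul0r.
  by move=> s _; rewrite /ay sin_direction_flip_direction mulr0.
rewrite /axis_event /E; congr (_ `&` _); apply/seteqP; split => w /=.
  by move=> [Nn Aw]; split; split => //; rewrite Xe.
by move=> [[Nn Aw] _]; split => //; rewrite -Xe.
Qed.

(** There are countably many finite sequences of directions, so the event can be
    decomposed over codes. *)
Let decode_directions n w i : (i < n)%N ->
  D i w = nth ord0 (odflt [::] (unpickle (pickle (mkseq (D^~ w) n)))) i.
Proof. by move=> ilt; rewrite pickleK [odflt _ _]/= nth_mkseq. Qed.

Lemma motion_event_measurable : measurable Ev.
Proof.
pose ek k (i : nat) : 'I_4 := nth ord0 (odflt [::] (unpickle k)) i.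
rewrite (_ : Ev = \bigcup_n \bigcup_k E n (ek k)).
  by apply: bigcupT_measurable => n; apply: bigcupT_measurable => k.
apply/seteqP; split => w /=; last first.
  by move=> [n _ [k _]]; rewrite EE => -[[]].
move=> Ew; exists (N t w) => //; exists (pickle (mkseq (D^~ w) (N t w).+1)) => //.
rewrite EE; split => // j /= jn.
exact: decode_directions.
Qed.

Lemma axis_event_measurable n b : measurable (axis_event n b).
Proof. by rewrite axis_eventE. Qed.

Lemma motion_event_law :
  P Ev = (\sum_(n <oo) (P (axis_event n false) + P (axis_event n true)))%E.
Proof.
have mU n : measurable (axis_event n false `|` axis_event n true).
  by apply: measurableU; exact: axis_event_measurable.
have U_N n w : (axis_event n false `|` axis_event n true) w -> N t w = n.+1.
  by move=> [[[]]|[[]]].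
have tU : trivIset setT (fun n => axis_event n false `|` axis_event n true).
  apply/trivIsetP => i j _ _ /eqP ij; apply/seteqP; split => // w [/U_N e1 /U_N e2].
  by apply: ij; move: e2; rewrite e1 => -[].
have mV : measurable (\bigcup_n (axis_event n false `|` axis_event n true)).
  exact: bigcupT_measurable.
have -> : P Ev = P (\bigcup_n (axis_event n false `|` axis_event n true)).
  have VE : \bigcup_n (axis_event n false `|` axis_event n true) `<=` Ev.
    by move=> w [n _] []; rewrite axis_eventE EE => -[[]].
  rewrite -[in LHS](setDUK VE) measureU//; last 2 first.
  - by apply: measurableD => //; exact: motion_event_measurable.
  - by rewrite setDIK.
  rewrite [X in (_ + X)%E](_ : _ = 0%E) ?adde0//.
  apply: measure_negligible.
    by apply: measurableD => //; exact: motion_event_measurable.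
  pose ek k (i : nat) : 'I_4 := nth ord0 (odflt [::] (unpickle k)) i.
  pose good n k := (0 < n)%N /\ exists b, forall i, (i <= n)%N -> ek k i = flip_direction b i.
  apply: (@negligibleS _ _ _ _ (\bigcup_n \bigcup_k (if `[< good n k >] then set0 else E n (ek k)))).
    move=> w [Ew nV]; exists (N t w) => //.
    exists (pickle (mkseq (D^~ w) (N t w).+1)) => //.
    set k := pickle _.
    have ekE j : (j <= N t w)%N -> ek k j = D j w.
      by move=> jn; exact/esym/decode_directions.
    have Ek : E (N t w) (ek k) w.
      by rewrite EE; split => // j /= jn; rewrite ekE.
    case: asboolP => // -[n0 [b hb]]; apply: nV.
    have [m Nm] : exists m, N t w = m.+1 by exists (N t w).-1; rewrite prednK.
    exists m => //; suff : axis_event m b w by case: b {hb}; [right|left].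
    rewrite axis_eventE EE; split => // j /= jm.
    by rewrite -ekE ?Nm// hb// Nm.
  apply: negligible_bigcup => n; apply: negligible_bigcup => k.
  case: asboolP => h; first exact: negligible_set0.
  by apply/negligibleP => //; exact: E_null.
rewrite (measure_semi_bigcup P mU tU mV); apply: eq_eseriesr => n _.
rewrite measureU//; [exact: axis_event_measurable|exact: axis_event_measurable|].
apply/seteqP; split => // w [[_ h1] [_ h2]].
have := h1 0%N isT; rewrite /= (h2 0%N isT) => /(congr1 val).
by rewrite /= /flip_direction /= inordK.
Qed.

Lemma axis_event_law n b :
  ((expR (L t))%:E * P (axis_event n b) = ((8 * c)^-1)%:E *
   \int[mu]_(x in A) sojourn_density (fun t => (rate t / 3)%R) n t
      ((t + (-1) ^+ (b + n.+1) * x / c) / 2)%R)%E.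
Proof.
have tw := ltW t0; pose sg : R := (-1) ^+ (b + n.+1).
have sg1 : `|sg| = 1 by rewrite /sg normrX normrN1 expr1n.
pose f (p : R) := sg * c * (2 * p - t).
have mf : measurable_fun setT f.
  apply: measurable_funM => //; apply: measurable_funB => //; exact: measurable_funM.
have mfA : measurable (f @^-1` A) by rewrite -[X in measurable X]setTI; exact: mf.
have pE : past N t [set w | N t w = n.+1 /\ (f @^-1` A) (Z (last_direction R n) t w)].
  exact: (additive_functional_past hN).
rewrite /axis_event (past_direction_independent _ _ pE) flip_direction_event_law.
rewrite muleA (flight_law rate0 rateI hN n t0 c0 sg1 mA).
under [in RHS]eq_integral do rewrite sojourn_density_scale//.
have ms0 : measurable_fun A (fun x : R => sojourn_density rate n t ((t + sg * x / c) / 2)).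
  apply: measurable_funTS; apply: measurableT_comp; first exact: sojourn_density_measurable.
  apply: measurable_funM => //; apply: measurable_funD => //.
  by apply: measurable_funM => //; exact: measurable_funM.
have e0 : (0 <= (3^-1 ^+ n.+1)%:E :> \bar R)%E by rewrite lee_fin exprn_ge0.
rewrite (ge0_integralZl mu mA ms0 (fun x _ => sojourn_density_ge0 rate0 n t _) e0).
rewrite muleAC muleA -!EFinM; congr (_%:E * _)%E.
by move: (3^-1 ^+ n.+1) => z; field; rewrite gt_eqF.
Qed.

End motion.

(** * The law on the diagonal *)

Section motion_density.
Context (R : realType) (c : R) (rate : R -> R).
Notation mu := (@lebesgue_measure R).
Hypothesis c0 : 0 < c.
Hypothesis rate0 : forall t : R, 0 < t -> 0 <= rate t.
Hypothesis rateI : forall t : R, 0 < t -> mu.-integrable `]0, t] (EFin \o rate).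
Hypothesis ratec : forall t : R, 0 < t -> {for t, continuous rate}.
Notation L := (cumulative_rate rate).
Context (d : measure_display) (Om : measurableType d) (P : probability Om R).
Context (N : R -> Om -> nat) (D : nat -> Om -> 'I_4).
Hypothesis hN : poisson_process P rate N.
Hypothesis hD : reflecting_directions P D.
Hypothesis hI : independent_sigma P (process_sigma [set t | 0 <= t] N) (process_sigma setT D).
Variables (X Y : R -> Om -> R).
Hypothesis hXY : forall (t : R) (w : Om), 0 <= t ->
  X t w = \int[mu]_(s in `[0, t]) (c * cos (direction_angle R (D (N s w) w))) /\
  Y t w = \int[mu]_(s in `[0, t]) (c * sin (direction_angle R (D (N s w) w))).

Notation third := (fun t => rate t / 3).

(** The constant is 1/4 for the initial direction times the Jacobian 1/(2c); the
    probability 1/3 of each turn is absorbed by the rate lambda / 3. *)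
Definition diagonal_profile (x t : R) : R :=
  expR (- L t) / (8 * c) * cone_profile third c x t.

Lemma third_ge0 (t : R) : 0 < t -> 0 <= third t.
Proof. by move=> t0; rewrite divr_ge0// rate0. Qed.

Lemma third_integrable (t : R) : 0 < t -> mu.-integrable `]0, t] (EFin \o third).
Proof. by move=> t0; exact: (integrableZr _ 3^-1 (rateI t0)). Qed.

Lemma third_continuous (t : R) : 0 < t -> {for t, continuous third}.
Proof. by move=> t0; apply: cvgM; [exact: ratec|exact: cvg_cst]. Qed.

Lemma third_mass (T : R) : 0 < T -> exists B : R, forall t, 0 < t -> t <= T ->
  (\sum_(n <oo) \int[mu]_p sojourn_density third n t p <= B%:E)%E.
Proof.
apply: (sojourn_mass_scaled rate0 rateI hN); first by rewrite invr_ge0.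
by rewrite invf_le1// ler1n.
Qed.

Let sum_axis (F : bool -> \bar R) n :
  (F false + F true = F (odd n.+1) + F (odd n))%E.
Proof. by rewrite /=; case: odd => //=; rewrite addeC. Qed.

Let sign_eq n : (-1) ^+ (odd n.+1 + n.+1)%N = 1 :> R.
Proof. by rewrite -signr_odd oddD oddb addbb expr0. Qed.

Let sign_neq n : (-1) ^+ (odd n + n.+1)%N = -1 :> R.
Proof. by rewrite -signr_odd oddD oddb /= addbN addbb expr1. Qed.

Lemma motion_density t (A : set R) : 0 < t -> measurable A ->
  A `<=` `](- (c * t)), (c * t)[ ->
  P [set w | A (X t w) /\ Y t w = 0] = (\int[mu]_(x in A) (diagonal_profile x t)%:E)%E.
Proof.
move=> t0 mA AC.
have e0 : expR (L t) != 0 by rewrite gt_eqF// expR_gt0.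
have cs := cone_profile_series third_ge0 third_integrable third_continuous third_mass t c0 mA.
have e1 : ((expR (L t))%:E * P [set w | A (X t w) /\ Y t w = 0%R] =
    ((8 * c)^-1)%:E * \int[mu]_(x in A) cone_extension third c t x)%E.
  rewrite (motion_event_law c0 rate0 rateI hN hD hXY t0 mA AC).
  rewrite -nneseriesZl; last by move=> n _; rewrite adde_ge0.
  have H n : ((expR (L t))%:E * (P (axis_event c N D t A n false) + P (axis_event c N D t A n true)) =
     ((8 * c)^-1)%:E *
     (\int[mu]_(x in A) sojourn_density third n t ((t + x / c) / 2)%R +
      \int[mu]_(x in A) sojourn_density third n t ((t - x / c) / 2)%R))%E.
    rewrite (sum_axis (fun b => P (axis_event c N D t A n b)) n).
    rewrite ge0_muleDr// !(axis_event_law c0 rate0 rateI hN hD hI t0 mA).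
    rewrite sign_eq sign_neq -ge0_muleDr//; last 2 first.
    - by apply: integral_ge0 => x _; exact: (sojourn_density_ge0 third_ge0).
    - by apply: integral_ge0 => x _; exact: (sojourn_density_ge0 third_ge0).
    congr (_ * (_ + _))%E; apply: eq_integral => x _; congr sojourn_density.
      by rewrite mul1r.
    by rewrite mulN1r mulNr.
  rewrite (eq_eseriesr (fun n _ => H n)) nneseriesZl.
    by rewrite cs.
  move=> n _; rewrite adde_ge0//; apply: integral_ge0 => x _;
    exact: (sojourn_density_ge0 third_ge0).
have {}e1 := congr1 (fun x => ((expR (L t))^-1%:E * x)%E) e1.
rewrite !muleA -!EFinM mulVf// mul1e in e1.
rewrite e1 -expRN -ge0_integralZl//.
- apply: eq_integral => x; rewrite inE => /AC; rewrite /= in_itv/= -ltr_norml => xc.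
  by rewrite /cone_extension xc -EFinM.
- by apply: measurable_funTS; apply: (cone_extension_measurable third_ge0 third_integrable third_continuous third_mass).
- by move=> x _; exact: (cone_extension_ge0 third_ge0).
- by rewrite lee_fin mulr_ge0 ?expR_ge0// invr_ge0 mulr_ge0// ltW.
Qed.

End motion_density.

(** * The law of the telegraph process *)

Section telegraph.
Context (R : realType) (v : R) (rate : R -> R).
Notation mu := (@lebesgue_measure R).
Hypothesis v0 : 0 < v.
Hypothesis rate0 : forall t : R, 0 < t -> 0 <= rate t.
Hypothesis rateI : forall t : R, 0 < t -> mu.-integrable `]0, t] (EFin \o rate).
Hypothesis ratec : forall t : R, 0 < t -> {for t, continuous rate}.
Hypothesis mass : forall T : R, 0 < T -> exists B : R, forall t, 0 < t -> t <= T ->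
  (\sum_(n <oo) \int[mu]_p sojourn_density rate n t p <= B%:E)%E.
Notation L := (cumulative_rate rate).
Context (d : measure_display) (Om : measurableType d) (P : probability Om R).
Context (N : R -> Om -> nat) (B : Om -> bool).
Hypothesis hN : poisson_process P rate N.
Hypothesis hB : forall b, measurable (B @^-1` [set b]) /\ P (B @^-1` [set b]) = (2%:R^-1)%:E.
Hypothesis hI : independent_sigma P (process_sigma [set t | 0 <= t] N)
                            (process_sigma setT (fun _ : unit => B)).
Variable W : R -> Om -> R.
Hypothesis hW : forall (t : R) (w : Om), 0 <= t ->
  W t w = \int[mu]_(s in `[0, t]) (v * (-1) ^+ (B w + N s w)%N).
Notation Z := (additive_functional N).

Definition telegraph_profile (x t : R) : R :=
  if `|x| < v * t then expR (- L t) / (4 * v) * cone_profile rate v x t else 0.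

Lemma telegraph_reversed t w n : 0 < t -> N t w = n.+1 ->
  W t w = (-1) ^+ (B w + n.+1) * v * (2 * Z (last_direction R n) t w - t).
Proof.
move=> t0 Nt; rewrite hW ?ltW//.
have i1 : mu.-integrable `[0, t] (EFin \o (fun s => last_direction R n (N s w))).
  apply: (path_integrable (a := last_direction R n) (C := 1) hN t w) => k.
  by rewrite /last_direction; case: odd; rewrite ?normr1// normr0.
have i2 : mu.-integrable `[0, t] (EFin \o (fun s => 1 : R)).
  have h1 (k : nat) : `|(fun=> 1 : R) k| <= 1 by rewrite normr1.
  exact: (path_integrable hN t w h1).
have i3 : mu.-integrable `[0, t] (EFin \o (fun s => 2 * last_direction R n (N s w))).
  exact: (integrableZl _ 2 i1).
have i4 : mu.-integrable `[0, t] (EFin \o (fun s => 2 * last_direction R n (N s w) - 1)).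
  exact: (integrableB _ i3 i2).
have It : \int[mu]_(x in `[0, t]) 1 = t.
  by rewrite Rintegral_cst//= lebesgue_measure_itv/= lte_fin mul1r t0 /= subr0.
rewrite /additive_functional -[X in _ - X]It.
rewrite -(RintegralZl 2 _ i1)// -(RintegralB _ i3 i2)// -(RintegralZl _ _ i4)//.
apply: eq_Rintegral => s _.
by rewrite (signed_direction_functional _ _ n) mulrA (mulrC v).
Qed.

(** The singular part of the law sits at the two ends of the segment. *)
Lemma telegraph_unreversed t w : 0 < t -> N t w = 0%N ->
  W t w = v * t \/ W t w = - (v * t).
Proof.
move=> t0 Nt; rewrite hW ?ltW//.
rewrite (@eq_Rintegral _ _ _ _ _ (cst (v * (-1) ^+ B w))); last first.
  move=> s; rewrite inE /= in_itv/= => /andP[s0 st].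
  have := pp_nondecreasing hN w s0 st; rewrite Nt leqn0 => /eqP ->.
  by rewrite addn0.
rewrite Rintegral_cst//= lebesgue_measure_itv/= lte_fin t0 /= subr0.
by case: (B w); rewrite ?expr0 ?expr1 ?mulr1; [right; rewrite mulrN1 mulNr|left].
Qed.

Definition telegraph_event (t : R) (A : set R) (n : nat) (b : bool) : set Om :=
  [set w | N t w = n.+1 /\
     A ((-1) ^+ (b + n.+1) * v * (2 * Z (last_direction R n) t w - t))] `&`
  (B @^-1` [set b]).

Lemma telegraph_event_measurable t A n b : 0 < t -> measurable A ->
  measurable (telegraph_event t A n b).
Proof.
move=> t0 mA; apply: measurableI; last by have [] := hB b.
pose f (p : R) := (-1) ^+ (b + n.+1) * v * (2 * p - t).
have mf : measurable_fun setT f.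
  apply: measurable_funM => //; apply: measurable_funB => //; exact: measurable_funM.
have mfA : measurable (f @^-1` A) by rewrite -[X in measurable X]setTI; exact: mf.
exact: (functional_event_measurable hN n.+1 _ (ltW t0) mfA).
Qed.

Lemma telegraph_event_law t A n b : 0 < t -> measurable A ->
  ((expR (L t))%:E * P (telegraph_event t A n b) = ((4 * v)^-1)%:E *
   \int[mu]_(x in A) sojourn_density rate n t ((t + (-1) ^+ (b + n.+1) * x / v) / 2)%R)%E.
Proof.
move=> t0 mA; pose sg : R := (-1) ^+ (b + n.+1).
have sg1 : `|sg| = 1 by rewrite /sg normrX normrN1 expr1n.
pose f (p : R) := sg * v * (2 * p - t).
have mf : measurable_fun setT f.
  apply: measurable_funM => //; apply: measurable_funB => //; exact: measurable_funM.
have mfA : measurable (f @^-1` A) by rewrite -[X in measurable X]setTI; exact: mf.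
have pE : past N t [set w | N t w = n.+1 /\ (f @^-1` A) (Z (last_direction R n) t w)].
  exact: (additive_functional_past hN _ _ (ltW t0) mfA).
have Bb : process_sigma setT (fun _ : unit => B) (B @^-1` [set b]).
  by apply: sub_sigma_algebra; exists tt, b.
have [_ PB] := hB b.
have -> : P (telegraph_event t A n b) =
    (P [set w | N t w = n.+1 /\ (f @^-1` A) (Z (last_direction R n) t w)] * (2^-1)%:E)%E.
  by rewrite -PB; apply: hI => //; exact: (past_process_sigma pE).
rewrite muleA (flight_law rate0 rateI hN n t0 v0 sg1 mA) muleAC -EFinM.
by congr (_%:E * _)%E; field; rewrite gt_eqF.
Qed.

Let sum_axis (F : bool -> \bar R) n : (F false + F true = F (odd n.+1) + F (odd n))%E.
Proof. by rewrite /=; case: odd => //=; rewrite addeC. Qed.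

Let sign_eq n : (-1) ^+ (odd n.+1 + n.+1)%N = 1 :> R.
Proof. by rewrite -signr_odd oddD oddb addbb expr0. Qed.

Let sign_neq n : (-1) ^+ (odd n + n.+1)%N = -1 :> R.
Proof. by rewrite -signr_odd oddD oddb /= addbN addbb expr1. Qed.

(** The ends of the segment, where the paths without events are, lie outside A; with
    n+1 events the two initial signs give the two terms of the profile. *)
Lemma telegraph_law t (A : set R) : 0 < t -> measurable A ->
  ~ A (v * t) -> ~ A (- (v * t)) ->
  P [set w | A (W t w)] = (\int[mu]_(x in A) (telegraph_profile x t)%:E)%E.
Proof.
move=> t0 mA A1 A2.
have e0 : expR (L t) != 0 by rewrite gt_eqF// expR_gt0.
have cs := cone_profile_series rate0 rateI ratec mass t v0 mA.
pose T n b := telegraph_event t A n b.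
have mT n b : measurable (T n b) by exact: telegraph_event_measurable.
have mU n : measurable (T n false `|` T n true) by exact: measurableU.
have U_N n w : (T n false `|` T n true) w -> N t w = n.+1 by move=> [[[]]|[[]]].
have tU : trivIset setT (fun n => T n false `|` T n true).
  apply/trivIsetP => i j _ _ /eqP ij; apply/seteqP; split => // w [/U_N h1 /U_N h2].
  by apply: ij; move: h2; rewrite h1 => -[].
have mV : measurable (\bigcup_n (T n false `|` T n true)) by exact: bigcupT_measurable.
have WE : [set w | A (W t w)] = \bigcup_n (T n false `|` T n true).
  apply/seteqP; split => w /=.
    move=> Aw; case Nw : (N t w) => [|n].
      by exfalso; case: (telegraph_unreversed t0 Nw) => h; rewrite h in Aw.
    exists n => //; suff : T n (B w) w by case: (B w); [right|left].
    by split => //=; split => //; rewrite -(telegraph_reversed t0 Nw).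
  move=> [n _ hw]; have Nw := U_N _ _ hw.
  by rewrite (telegraph_reversed t0 Nw); case: hw => -[[_ +] /= ->].
have PE : P [set w | A (W t w)] = (\sum_(n <oo) (P (T n false) + P (T n true)))%E.
  rewrite WE (measure_semi_bigcup P mU tU mV); apply: eq_eseriesr => n _.
  rewrite measureU//.
  by apply/seteqP; split => // w [[_ /= h1] [_ /=]]; rewrite h1.
have e1 : ((expR (L t))%:E * P [set w | A (W t w)] =
    ((4 * v)^-1)%:E * \int[mu]_(x in A) cone_extension rate v t x)%E.
  rewrite PE -nneseriesZl; last by move=> n _; rewrite adde_ge0.
  have H n : ((expR (L t))%:E * (P (T n false) + P (T n true)) =
     ((4 * v)^-1)%:E *
     (\int[mu]_(x in A) sojourn_density rate n t ((t + x / v) / 2)%R +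
      \int[mu]_(x in A) sojourn_density rate n t ((t - x / v) / 2)%R))%E.
    rewrite (sum_axis (fun b => P (T n b)) n).
    rewrite ge0_muleDr// !(telegraph_event_law _ _ t0 mA).
    rewrite sign_eq sign_neq -ge0_muleDr//; last 2 first.
    - by apply: integral_ge0 => x _; exact: (sojourn_density_ge0 rate0).
    - by apply: integral_ge0 => x _; exact: (sojourn_density_ge0 rate0).
    congr (_ * (_ + _))%E; apply: eq_integral => x _; congr sojourn_density.
      by rewrite mul1r.
    by rewrite mulN1r mulNr.
  rewrite (eq_eseriesr (fun n _ => H n)) nneseriesZl.
    by rewrite cs.
  move=> n _; rewrite adde_ge0//; apply: integral_ge0 => x _;
    exact: (sojourn_density_ge0 rate0).
have {}e1 := congr1 (fun x => ((expR (L t))^-1%:E * x)%E) e1.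
rewrite !muleA -!EFinM mulVf// mul1e in e1.
rewrite e1 -expRN -ge0_integralZl//.
- apply: eq_integral => x _; rewrite /cone_extension /telegraph_profile.
  by case: ifP => _; rewrite ?mule0// -EFinM.
- by apply: measurable_funTS; apply: (cone_extension_measurable rate0 rateI ratec mass).
- by move=> x _; exact: (cone_extension_ge0 rate0).
- by rewrite lee_fin mulr_ge0 ?expR_ge0// invr_ge0 mulr_ge0// ltW.
Qed.

End telegraph.

(** * Total mass and uniqueness of continuous densities *)

Lemma exp_tail_series (R : realType) (x : R) : 0 <= x ->
  (\sum_(n <oo) (x ^+ n.+1 / n.+1`!%:R)%:E = (expR x - 1)%:E)%E.
Proof.
move=> x0.
have u0 n : (0 <= (x ^+ n / n`!%:R)%:E)%E by rewrite lee_fin divr_ge0// exprn_ge0.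
have E : (\sum_(n <oo) (x ^+ n / n`!%:R)%:E = (expR x)%:E)%E.
  rewrite expRE -EFin_lim; last first.
    by rewrite /pseries/=; under eq_fun do rewrite mulrC; exact: is_cvg_series_exp_coeff.
  apply/congr_lim/funext => n/=; rewrite /pseries/= /series/= -sumEFin//.
  by apply: eq_bigr => i _; rewrite mulrC.
have := @nneseries_recl R xpredT _ (fun k _ => u0 k) isT.
rewrite E -(nneseries_addn 1 u0).
under eq_eseriesr do rewrite addn1.
rewrite expr0 fact0 divr1 EFinB => ->.
by rewrite addeAC subee ?add0e.
Qed.

Section diagonal_mass.
Context (R : realType) (c : R) (rate : R -> R).
Notation mu := (@lebesgue_measure R).
Hypothesis c0 : 0 < c.
Hypothesis rate0 : forall t : R, 0 < t -> 0 <= rate t.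
Hypothesis rateI : forall t : R, 0 < t -> mu.-integrable `]0, t] (EFin \o rate).
Hypothesis ratec : forall t : R, 0 < t -> {for t, continuous rate}.
Notation L := (cumulative_rate rate).
Context (d : measure_display) (Om : measurableType d) (P : probability Om R).
Context (N : R -> Om -> nat).
Hypothesis hN : poisson_process P rate N.
Notation third := (fun t => rate t / 3).

Let flight_mass n (t sg : R) : 0 < t -> `|sg| = 1 ->
  (\int[mu]_x sojourn_density third n t ((t + sg * x / c) / 2)%R =
   (2 * c * ((L t / 3) ^+ n.+1 / n.+1`!%:R))%:E)%E.
Proof.
move=> t0 sg1.
have a0 : sg / (2 * c) != 0.
  rewrite mulf_neq0//; first by rewrite -normr_eq0 sg1 oner_eq0.
  by rewrite invr_eq0 mulf_neq0// gt_eqF.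
have ms := sojourn_density_measurable (third_ge0 rate0) (third_integrable rateI) n t.
have s0 := sojourn_density_ge0 (third_ge0 rate0) n t.
have aE : `|sg / (2 * c)| = (2 * c)^-1.
  by rewrite normrM sg1 mul1r normfV ger0_norm// mulr_ge0// ltW.
have h := ge0_integral_affine (t / 2) a0 ms s0.
have {}h := congr1 (fun z => ((2 * c)%:E * z)%E) h.
rewrite aE muleA -EFinM mulfV ?mul1e in h; last by rewrite mulf_neq0// gt_eqF.
rewrite (_ : (\int[mu]_x _)%E = (2 * c)%:E * \int[mu]_x sojourn_density third n t x)%E; last first.
  rewrite -h; apply: eq_integral => x _; congr sojourn_density; field; rewrite gt_eqF//.
under eq_integral do rewrite sojourn_density_scale//.
rewrite ge0_integralZl//; last 2 first.
- exact: (sojourn_density_measurable rate0 rateI).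
- by move=> x _; exact: sojourn_density_ge0.
rewrite (sojourn_density_mass rate0 rateI hN n t0) -!EFinM; congr EFin; congr (_ * _).
rewrite /poisson_weight exprMn expRN.
have e0 : expR (L t) != 0 by rewrite gt_eqF// expR_gt0.
by field; rewrite e0 pnatr_eq0 -lt0n fact_gt0.
Qed.

(** Each of the two directions contributes the masses of the sojourn densities of
    lambda / 3, which add up to exp(L t / 3) - 1. *)
Lemma diagonal_mass t : 0 < t ->
  (\int[mu]_(x in `](- (c * t))%R, (c * t)%R[) (diagonal_profile c rate x t)%:E)%E =
  (2%:R^-1 * (expR (- (2%:R / 3%:R * L t)) - expR (- L t)))%:E.
Proof.
move=> t0; have L0 : 0 <= L t by apply: (cumulative_rate_ge0 rate0 rateI); exact: ltW.
have mass := third_mass rate0 rateI hN.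
have t3 := third_ge0 rate0; have tI := third_integrable rateI; have tc := third_continuous ratec.
have mce := cone_extension_measurable t3 tI tc mass t c0.
have cs := cone_profile_series t3 tI tc mass t c0 measurableT.
have e1 : (\int[mu]_x cone_extension third c t x = (4 * c * (expR (L t / 3) - 1))%:E)%E.
  rewrite -cs (EFinM (4 * c)) -(exp_tail_series (divr_ge0 L0 _))// -nneseriesZl; last first.
    by move=> n _; rewrite lee_fin divr_ge0// exprn_ge0// divr_ge0.
  apply: eq_eseriesr => n _.
  have h1 := flight_mass n t0 (normr1 _); have h2 := flight_mass n t0 (normrN1 _).
  rewrite [X in (X + _ = _)%E](_ : _ = (2 * c * ((L t / 3) ^+ n.+1 / n.+1`!%:R))%:E); last first.
    by rewrite -h1; apply: eq_integral => x _; rewrite mul1r.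
  rewrite [X in (_ + X = _)%E](_ : _ = (2 * c * ((L t / 3) ^+ n.+1 / n.+1`!%:R))%:E); last first.
    by rewrite -h2; apply: eq_integral => x _; rewrite mulN1r mulNr.
  by rewrite -EFinD -EFinM; congr EFin; ring.
transitivity ((expR (- L t) / (8 * c))%:E * \int[mu]_x cone_extension third c t x)%E.
  rewrite -ge0_integralZl//; last 2 first.
  - by move=> x _; exact: (cone_extension_ge0 t3).
  - by rewrite lee_fin divr_ge0 ?expR_ge0// mulr_ge0// ltW.
  rewrite [LHS]integral_mkcond; apply: eq_integral => x _.
  rewrite /patch /cone_extension; case: ifPn.
    by rewrite inE /= in_itv/= -ltr_norml => ->; rewrite -EFinM.
  by rewrite notin_setE /= in_itv/= -ltr_norml => /negP/negbTE ->; rewrite mule0.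
rewrite e1 -EFinM; congr EFin.
have -> : - (2 / 3 * L t) = - L t + L t / 3 by field.
rewrite expRD; field; rewrite gt_eqF//.
Qed.

End diagonal_mass.

(** The derivative of the integral over [u, y] recovers the density at y. *)
Lemma continuous_density_unique (R : realType) (f g : R -> R) (a b : R) :
  {in `]a, b[, forall x, {for x, continuous f}} -> {in `]a, b[, forall x, {for x, continuous g}} ->
  (forall u v, a < u -> u < v -> v < b ->
    (\int[@lebesgue_measure R]_(x in `[u, v]) (f x)%:E =
     \int[@lebesgue_measure R]_(x in `[u, v]) (g x)%:E)%E) ->
  {in `]a, b[, f =1 g}.
Proof.
move=> cf cg fg x; rewrite in_itv/= => /andP[ax xb].
pose u := (a + x) / 2; pose v := (x + b) / 2.
have au : a < u by rewrite /u; lra.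
have ux : u < x by rewrite /u; lra.
have xv : x < v by rewrite /v; lra.
have vb : v < b by rewrite /v; lra.
have uv := lt_trans ux xv.
have inab z : u <= z <= v -> z \in `]a, b[.
  by rewrite in_itv/= => /andP[uz zv]; apply/andP; split; lra.
have wc (h : R -> R) : {in `]a, b[, forall x, {for x, continuous h}} -> {within `[u, v], continuous h}.
  move=> ch; apply: continuous_in_subspaceT => z; rewrite inE /= in_itv/= => zuv.
  by apply: ch; exact: inab.
have I (h : R -> R) : {in `]a, b[, forall x, {for x, continuous h}} ->
    (@lebesgue_measure R).-integrable `[u, v] (EFin \o h).
  move=> /wc ch; apply: continuous_compact_integrable => //; exact: segment_compact.
pose F (h : R -> R) y := \int[@lebesgue_measure R]_(z in `[u, y]) h z.
have D (h : R -> R) : {in `]a, b[, forall x, {for x, continuous h}} -> derive1 (F h) x = h x.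
  move=> ch; have [] := continuous_FTC1_closed xv (I h ch) ux _ => //.
  by apply: ch; rewrite in_itv/= ax xb.
rewrite -(D f cf) -(D g cg) !derive1E; apply: near_eq_derive.
near=> y; rewrite /F /Rintegral fg//; near: y.
  exact: lt_nbhsr.
exact: lt_nbhsl.
Unshelve. all: by end_near. Qed.

(** * Calculus in two variables *)

Lemma mean_value (R : realType) (f df : R -> R) (x y : R) :
  (forall z, `|z - x| <= `|y - x| -> is_derive z 1 f (df z)) ->
  exists2 z, `|z - x| <= `|y - x| & f y - f x = df z * (y - x).
Proof.
move=> D.
have cf a b : (forall z, a <= z <= b -> `|z - x| <= `|y - x|) -> {within `[a, b], continuous f}.
  move=> H; apply: continuous_in_subspaceT => z; rewrite inE /= in_itv/= => zab.
  by have [+ _] := D z (H z zab) => /derivable1_diffP/differentiable_continuous.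
have [xy|yx] := leP x y.
  have H z : x <= z <= y -> `|z - x| <= `|y - x|.
    by move=> /andP[xz zy]; rewrite !ger0_norm ?subr_ge0// lerD2r.
  have [|z zI zE] := MVT_segment (f := f) (df := df) xy _ (cf _ _ H).
    by move=> z; rewrite in_itv/= => /andP[xz zy]; apply: D; apply: H; rewrite !ltW.
  by exists z => //; apply: H; move: zI; rewrite in_itv.
have H z : y <= z <= x -> `|z - x| <= `|y - x|.
  move=> /andP[yz zx]; rewrite !ler0_norm ?subr_le0//; last exact: ltW.
  by rewrite lerN2 lerD2r.
have [|z zI zE] := MVT_segment (f := f) (df := df) (ltW yx) _ (cf _ _ H).
  by move=> z; rewrite in_itv/= => /andP[xz zy]; apply: D; apply: H; rewrite !ltW.
by exists z; [apply: H; move: zI; rewrite in_itv|rewrite -opprB zE -mulrN opprB].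
Qed.

Lemma is_derive_little (R : realType) (r : R -> R) (s l : R) :
  (forall e, 0 < e -> \forall h \near 0, `|r (s + h) - r s - l * h| <= e * `|h|) ->
  is_derive s 1 r l.
Proof.
move=> H.
have cv : (h^-1 *: (r (h *: 1 + s) - r s) @[h --> 0^'] --> l).
  apply/cvgrPdist_le => e e0.
  near=> h; have h0 : h != 0 by near: h; exact: nbhs_dnbhs_neq.
  rewrite [X in _ - X](_ : _ = h^-1 * (r (s + h) - r s)); last by rewrite /GRing.scale/= mulr1 (addrC h).
  have -> : l - h^-1 * (r (s + h) - r s) = - (h^-1 * (r (s + h) - r s - l * h)) by field.
  rewrite normrN normrM normfV ler_pdivrMl ?normr_gt0// (mulrC `|h|).
  by near: h; apply: nbhs_dnbhs; exact: H.
by apply: DeriveDef; [apply/cvg_ex; exists l|exact/cvg_lim].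
Unshelve. all: by end_near. Qed.

(** The mean value theorem treats the first variable, where the derivative is
    continuous; the increment in the second one is taken at the base point. The
    kernel is used in this form: its second derivative in the second argument is
    only shown to exist. *)
Lemma is_derive_affine_path (R : realType) (g g1 : R -> R -> R) (p q a b s l : R) :
  (\forall z \near (p + a * s, q + b * s) : R * R, is_derive (z.1 : R) 1 (g^~ z.2) (g1 z.1 z.2)) ->
  {for (p + a * s, q + b * s), continuous (fun z : R * R => g1 z.1 z.2)} ->
  is_derive (q + b * s) 1 (g (p + a * s)) l ->
  is_derive s 1 (fun s => g (p + a * s) (q + b * s)) (a * g1 (p + a * s) (q + b * s) + l * b).
Proof.
set p0 := p + a * s; set q0 := q + b * s => Dg1 cg1 Dl.
have D2 : is_derive s 1 (fun s => g p0 (q + b * s)) (l * b).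
  have Db : is_derive s 1 (fun s => q + b * s) b.
    have := is_deriveD (is_derive_cst q s 1) (is_deriveZ b (is_derive_id s (1 : R))).
    by rewrite add0r /GRing.scale/= mulr1.
  exact: (@is_derive1_comp R (g p0) (fun s => q + b * s) s l b Dl Db).
suff D1 : is_derive s 1 (fun s => g (p + a * s) (q + b * s) - g p0 (q + b * s)) (a * g1 p0 q0).
  have := is_deriveD D1 D2; apply: near_eq_is_derive; exists 1 => /= [|x _ /=]; first exact: ltr01.
  by rewrite subrK.
apply: is_derive_little => e e0.
(* The slope a may be 0, hence the denominator. *)
pose e' := e / (`|a| + 1).
have a1 : 0 < `|a| + 1 by rewrite ltr_wpDl.
have e'0 : 0 < e' by rewrite divr_gt0.
move/cvgrPdist_le : cg1 => /(_ _ e'0) cg1.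
have [[U V] [/= U0 V0] UV] : nbhs (p0, q0) (fun z : R * R =>
    is_derive z.1 1 (g^~ z.2) (g1 z.1 z.2) /\ `|g1 p0 q0 - g1 z.1 z.2| <= e').
  exact: filterI.
move/nbhs_ballP : U0 => [r /= r0 rU].
have hV : \forall h \near 0, V (q + b * (s + h)).
  have cV : (q + b * (s + h)) @[h --> 0] --> q0.
    rewrite /q0 -{2}(addr0 s); apply: cvgD; first exact: cvg_cst.
    by apply: cvgM; [exact: cvg_cst|apply: cvgD; [exact: cvg_cst|exact: cvg_id]].
  exact: (cV _ V0).
have hU : \forall h \near 0, `|a * h| < r.
  have cU : (`|a * h|) @[h --> 0] --> `|a * 0|.
    by apply: cvg_norm; apply: cvgM; [exact: cvg_cst|exact: cvg_id].
  rewrite mulr0 normr0 in cU; exact: (cvgr_lt _ cU).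
near=> h.
have Vh : V (q + b * (s + h)) by near: h.
have Uh : `|a * h| < r by near: h.
have pE : p + a * (s + h) - p0 = a * h by rewrite /p0; ring.
have [|z zU zE] := @mean_value R (g^~ (q + b * (s + h))) (g1^~ (q + b * (s + h))) p0 (p + a * (s + h)).
  move=> z; rewrite pE => zh.
  have [] // := UV (z, q + b * (s + h)); split => //=.
  by apply: rU; rewrite /ball/= distrC (le_lt_trans zh).
rewrite pE in zU.
have [_ /= hz] : is_derive z 1 (g^~ (q + b * (s + h))) (g1 z (q + b * (s + h))) /\
    `|g1 p0 q0 - g1 z (q + b * (s + h))| <= e'.
  apply: (UV (z, q + b * (s + h))); split => //=.
  by apply: rU; rewrite /ball/= distrC (le_lt_trans zU).
rewrite /= zE pE subrr subr0.
have -> : g1 z (q + b * (s + h)) * (a * h) - a * g1 p0 q0 * h =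
  (g1 p0 q0 - g1 z (q + b * (s + h))) * (- a * h) by ring.
rewrite normrM normrM normrN mulrA ler_wpM2r//.
apply: (le_trans (ler_wpM2r (normr_ge0 a) hz)).
by rewrite /e' mulrAC ler_pdivrMr// ler_wpM2l ?ltW// ltrDl.
Unshelve. all: by end_near. Qed.

(** Both are the limit of the second difference of g over a shrinking square. *)
Lemma mixed_derivatives_equal (R : realType) (g : R -> R -> R) (gx gt gxt gtx : R -> R -> R) (x t : R) :
  (forall z : R * R, is_derive z.1 1 (g^~ z.2) (gx z.1 z.2)) ->
  (forall z : R * R, is_derive z.2 1 (g z.1) (gt z.1 z.2)) ->
  (forall z : R * R, is_derive z.2 1 (gx z.1) (gxt z.1 z.2)) ->
  (forall z : R * R, is_derive z.1 1 (gt^~ z.2) (gtx z.1 z.2)) ->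
  {for (x, t), continuous (fun z : R * R => gxt z.1 z.2)} ->
  {for (x, t), continuous (fun z : R * R => gtx z.1 z.2)} ->
  gxt x t = gtx x t.
Proof.
move=> Dx Dt Dxt Dtx cxt ctx; apply/eqP; rewrite -subr_eq0 -normr_le0.
apply/ler_addgt0Pl => e e0; rewrite addr0.
have e20 : 0 < e / 2 by rewrite divr_gt0.
move/cvgrPdist_le : cxt => /(_ _ e20) cxt; move/cvgrPdist_le : ctx => /(_ _ e20) ctx.
have [[U V] [/= U0 V0] UV] : nbhs (x, t) (fun z : R * R =>
    `|gxt x t - gxt z.1 z.2| <= e / 2 /\ `|gtx x t - gtx z.1 z.2| <= e / 2).
  exact: filterI.
move/nbhs_ballP : U0 => [r /= r0 rU]; move/nbhs_ballP : V0 => [r' /= r'0 rV].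
pose h := Num.min r r' / 2.
have h0 : 0 < h by rewrite divr_gt0// lt_min r0.
have hr : h < r /\ h < r'.
  have m0 : 0 < Num.min r r' by rewrite lt_min r0.
  have := ge_min r r r'; have := ge_min r' r r'; rewrite !lexx orbT /= => m1 m2.
  by rewrite /h; split; lra.
have near_xt y s : `|y - x| <= h -> `|s - t| <= h ->
    `|gxt x t - gxt y s| <= e / 2 /\ `|gtx x t - gtx y s| <= e / 2.
  move=> yx st; apply: (UV (y, s)); split => /=.
    by apply: rU; rewrite /ball/= distrC (le_lt_trans yx)// hr.1.
  by apply: rV; rewrite /ball/= distrC (le_lt_trans st)// hr.2.
have hE u : `|u + h - u| = h by rewrite addrAC subrr add0r gtr0_norm.
(* The second difference of g over the square of side h, expanded in one order
   and then in the other. *)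
have [y /[!hE] yx yE] := @mean_value R (fun y => g y (t + h) - g y t)
  (fun y => gx y (t + h) - gx y t) x (x + h)
  (fun z _ => is_deriveB (Dx (z, t + h)) (Dx (z, t))).
have [s /[!hE] st sE] := @mean_value R (gx y) (gxt y) t (t + h) (fun z _ => Dxt (y, z)).
have [s' /[!hE] st' sE'] := @mean_value R (fun s => g (x + h) s - g x s)
  (fun s => gt (x + h) s - gt x s) t (t + h)
  (fun z _ => is_deriveB (Dt (x + h, z)) (Dt (x, z))).
have [y' /[!hE] yx' yE'] := @mean_value R (gt^~ s') (gtx^~ s') x (x + h) (fun z _ => Dtx (z, s')).
have E : gxt y s = gtx y' s'.
  have hn : h != 0 by rewrite gt_eqF.
  apply: (mulIf hn); apply: (mulIf hn).
  have eh u : u + h - u = h by rewrite addrAC subrr add0r.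
  rewrite !eh in yE sE yE' sE'.
  rewrite -sE -yE -yE' -sE'; ring.
have [h1 _] := near_xt _ _ yx st; have [_ h2] := near_xt _ _ yx' st'.
have -> : gxt x t - gtx x t = (gxt x t - gxt y s) + (gtx y' s' - gtx x t) by rewrite E; ring.
by rewrite (le_trans (ler_normD _ _))// (distrC (gtx y' s')); lra.
Qed.

(** * Compactly supported functions in the plane *)

Lemma cvg_to_pair (R : realType) (T : Type) (F : set_system T) {FF : Filter F} (f g : T -> R) (p q : R) :
  f @ F --> p -> g @ F --> q -> (f x, g x) @[x --> F] --> (p, q).
Proof. exact: (@cvg_pair _ _ _ _ (nbhs p) (nbhs q)). Qed.

(** Rounding the first coordinate down to multiples of 1/(n+1) gives functions
    that are measurable on countably many strips and converge to H. *)
Lemma continuous_measurable2 (R : realType) (H : R * R -> R) :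
  continuous H -> measurable_fun setT H.
Proof.
move=> cH; pose a (n : nat) (x : R) : R := (Num.floor (x * n.+1%:R))%:~R / n.+1%:R.
have n0 (n : nat) : 0 < n.+1%:R :> R by rewrite ltr0n.
apply: (@measurable_fun_cvg _ _ _ setT (fun n z => H (a n z.1, z.2))).
- move=> n _ B mB; rewrite setTI.
  rewrite (_ : _ @^-1` _ = \bigcup_(k in [set: int])
      ((fun x : R => x * n.+1%:R) @^-1` `[k%:~R, (k + 1)%:~R[ `*`
       (fun t : R => H (k%:~R / n.+1%:R, t)) @^-1` B)); last first.
    apply/seteqP; split => [[x t] /= HB|[x t] [k _ [/= xk]]].
      exists (Num.floor (x * n.+1%:R)) => //; split => //=.
      by rewrite in_itv/= floor_itv.
    by rewrite /a (@floor_def _ _ k)//; move: xk; rewrite in_itv.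
  apply: countable_bigcupT_measurable => [|k]; first exact: countableP.
  apply: measurableX.
    rewrite -[X in measurable X]setTI.
    by apply: (measurable_funM (@measurable_id _ _ _) (measurable_cst _)) => //.
  have cHk : continuous (fun t : R => H (k%:~R / n.+1%:R, t)).
    move=> t; apply: (@continuous_comp _ _ _ (fun t : R => (k%:~R / n.+1%:R : R, t)) H); last exact: cH.
    by apply: cvg_to_pair; [exact: cvg_cst|exact: cvg_id].
  by rewrite -[X in measurable X]setTI; exact: (continuous_measurable_fun cHk).
- move=> [x t] _ /=.
  have ax : a n x @[n --> \oo] --> x.
    apply/cvgrPdist_le => e e0; near=> n.
    have /andP[h1 h2] := floor_itv (x * n.+1%:R).
    have -> : x - a n x = (x * n.+1%:R - (Num.floor (x * n.+1%:R))%:~R) / n.+1%:R.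
      by rewrite /a mulrBl mulfK// gt_eqF.
    rewrite intrD in h2.
    rewrite ger0_norm; last by rewrite divr_ge0// subr_ge0.
    rewrite ler_pdivrMr//; apply: (@le_trans _ _ 1); first by rewrite lerBlDr addrC ltW.
    rewrite -ler_pdivrMl// mulr1; apply: (@le_trans _ _ n%:R); last by rewrite ler_nat.
    by apply: ltW; near: n; exact: nbhs_infty_gtr.
  apply: (@continuous_cvg _ _ _ _ _ (fun n => (a n x, t)) H (x, t)); first exact: cH.
  by apply: cvg_to_pair => //; exact: cvg_cst.
Unshelve. all: by end_near. Qed.

Section compact_support.
Context (R : realType).
Notation mu := (@lebesgue_measure R).

Lemma compact_bounded_pair (K : set (R * R)) : compact K ->
  exists2 M : R, 0 < M & forall z, K z -> `|z.1| <= M /\ `|z.2| <= M.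
Proof.
move=> /compact_bounded [M0 [_ hM]]; exists (`|M0| + 1); first by rewrite ltr_wpDl.
move=> z Kz; have : `|z| <= `|M0| + 1.
  by apply: hM => //; rewrite (le_lt_trans (ler_norm _))// ltrDl.
by rewrite prod_normE ge_max => /andP[].
Qed.

Lemma compact_support_integrable (K : set (R * R)) (H : R -> R -> R) :
  compact K -> (forall x t, ~ K (x, t) -> H x t = 0) ->
  continuous (fun z : R * R => H z.1 z.2) ->
  (mu \x mu)%E.-integrable setT (fun z => (H z.1 z.2)%:E).
Proof.
move=> cK H0 cH; have [M M0 KM] := compact_bounded_pair cK.
have mH := continuous_measurable2 cH.
pose A : set (measurableTypeR R * measurableTypeR R) := (`[- M, M] : set R) `*` (`[- M, M] : set R).
have mA : measurable A by exact: measurableX.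
have : (mu \x mu)%E.-integrable A (EFin \o (fun z => H z.1 z.2)).
  apply: measurable_bounded_integrable => //.
  - have muA : (mu \x mu)%E A = (mu [set` `[(- M)%R, M]] * mu [set` `[(- M)%R, M]])%E.
      exact: product_measure1E.
    rewrite [X in (X < _)%E]muA lebesgue_measure_itv/= lte_fin.
    by case: ifP => // _; rewrite ?mule0 ?mul0e -?EFinD -?EFinM ltry.
  - exact: measurable_funTS.
  - have cHK : compact ((fun z : R * R => H z.1 z.2) @` K).
      by apply: continuous_compact => //; exact: continuous_subspaceT.
    have [B [_ hB]] := compact_bounded cHK.
    exists (`|B|); split; first exact: normr_real.
    move=> y By z Az; have [Kz|nKz] := pselect (K z).
      apply: hB; last by exists z.
      exact: le_lt_trans (ler_norm _) By.
    by case: z Az nKz => x t _ /= /H0 ->; rewrite normr0 (le_trans _ (ltW By)).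
move=> iA; have := (integrable_mkcond _ mA).1 iA; apply: eq_integrable => // -[x t] _.
rewrite /patch; case: ifPn => // /negP zA; rewrite H0//= => Kz; apply: zA.
have [h1 h2] := KM _ Kz.
by rewrite inE /A; split; rewrite /= in_itv/= -ler_norml.
Qed.

Lemma integral_shift (f : R -> R) (s : R) : measurable_fun setT f ->
  (\int[mu]_x (f (x + s))%:E = \int[mu]_x (f x)%:E)%E.
Proof.
move=> mf; have mE : measurable_fun setT (EFin \o f) by exact/measurable_EFinP.
rewrite integralE [RHS]integralE; congr (_ - _)%E.
  apply: etrans (ge0_integral_shift s (measurable_funepos mE) (funepos_ge0 _)).
  by apply: eq_integral => x _; rewrite !unlock.
apply: etrans (ge0_integral_shift s (measurable_funeneg mE) (funeneg_ge0 _)).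
by apply: eq_integral => x _; rewrite !unlock.
Qed.

Lemma integral_derivative0 (k k' : R -> R) (M : R) : 0 < M ->
  (forall t, M <= `|t| -> k t = 0) -> (forall t, M <= `|t| -> k' t = 0) ->
  continuous k' -> (forall t : R, is_derive t 1 k (k' t)) ->
  (\int[mu]_t (k' t)%:E = 0)%E.
Proof.
move=> M0 k0 k'0 ck' dk.
have ck t : {for t, continuous k}.
  by have [+ _] := dk t => /derivable1_diffP/differentiable_continuous.
transitivity (\int[mu]_(t in `[(- M)%R, M]) (k' t)%:E)%E.
  rewrite [RHS]integral_mkcond; apply: eq_integral => t _.
  rewrite /patch; case: ifPn => //; rewrite notin_setE /= in_itv/= -ler_norml.
  by move=> /negP; rewrite -ltNge => /ltW /k'0 ->.
rewrite (@continuous_FTC2 R k' k).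
- by rewrite !k0 ?subee// ?normrN ger0_norm// ltW.
- by rewrite -subr_gt0 opprK addr_gt0.
- exact: continuous_subspaceT.
- split => [x _||]; first by have [] := dk x.
    exact/cvg_at_right_filter/ck.
  exact/cvg_at_left_filter/ck.
- by move=> x _; rewrite derive1E; have [_ ->] := dk x.
Qed.

(** After the shear (x, t) -> (x + a t, t), which preserves area, the integrand is
    a derivative in t of a compactly supported function. *)
Lemma characteristic_integral0 (a : R) (K : set (R * R)) (G H : R -> R -> R) :
  compact K -> (forall x t, ~ K (x, t) -> G x t = 0) -> (forall x t, ~ K (x, t) -> H x t = 0) ->
  continuous (fun z : R * R => H z.1 z.2) ->
  (forall x t : R, is_derive t 1 (fun s => G (x + a * s) s) (H (x + a * t) t)) ->
  (\int[(mu \x mu)%E]_z (H z.1 z.2)%:E = 0)%E.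
Proof.
move=> cK G0 H0 cH dG.
have iH := compact_support_integrable cK H0 cH.
have mH := continuous_measurable2 cH.
pose H' x t := H (x + a * t) t.
have cH' : continuous (fun z : R * R => H' z.1 z.2).
  move=> z; apply: (@continuous_comp _ _ _ (fun z : R * R => (z.1 + a * z.2, z.2)) (fun z : R * R => H z.1 z.2)).
    apply: cvg_to_pair; last exact: cvg_snd.
    apply: cvgD; first exact: cvg_fst.
    by apply: cvgM; [exact: cvg_cst|exact: cvg_snd].
  exact: cH.
pose K' : set (R * R) := (fun z : R * R => (z.1 - a * z.2, z.2)) @` K.
have cK' : compact K'.
  apply: continuous_compact => //; apply: continuous_subspaceT => z.
  apply: cvg_to_pair; last exact: cvg_snd.
  apply: cvgB; first exact: cvg_fst.
  by apply: cvgM; [exact: cvg_cst|exact: cvg_snd].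
have KK' x t : ~ K' (x, t) -> ~ K (x + a * t, t).
  by move=> nK Kz; apply: nK; exists (x + a * t, t) => //=; rewrite addrK.
have H'0 x t : ~ K' (x, t) -> H' x t = 0 by move=> /KK' /H0.
have iH' := compact_support_integrable cK' H'0 cH'.
transitivity (\int[mu]_t \int[mu]_x (H x t)%:E)%E; first by rewrite -(integral21_prod_meas1 iH).
transitivity (\int[mu]_t \int[mu]_x (H' x t)%:E)%E.
  apply: eq_integral => t _; rewrite -(integral_shift (a * t))//.
  apply: continuous_measurable_fun => x.
  apply: (@continuous_comp _ _ _ (fun x => (x, t)) (fun z : R * R => H z.1 z.2)); last exact: cH.
  by apply: cvg_to_pair; [exact: cvg_id|exact: cvg_cst].
have := Fubini iH'; rewrite /= => <-.
apply: integral0_eq => x _.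
have [M M0 KM] := compact_bounded_pair cK'.
have outside t : M + 1 <= `|t| -> ~ K' (x, t).
  by move=> Mt /KM /= [_ tM]; have := le_trans Mt tM; rewrite leNgt ltrDl ltr01.
apply: (@integral_derivative0 (fun t => G (x + a * t) t) (H' x) (M + 1)).
- exact: addr_gt0.
- by move=> t /outside /KK' /G0.
- by move=> t /outside /H'0.
- move=> t; apply: (@continuous_comp _ _ _ (fun t => (x, t)) (fun z : R * R => H' z.1 z.2)); last exact: cH'.
  by apply: cvg_to_pair; [exact: cvg_cst|exact: cvg_id].
Qed.

Lemma compact_support_continuous (U K : set (R * R)) (H : R -> R -> R) :
  compact K -> K `<=` U -> (forall x t, ~ K (x, t) -> H x t = 0) ->
  (forall z : R * R, U z -> {for z, continuous (fun z : R * R => H z.1 z.2)}) ->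
  continuous (fun z : R * R => H z.1 z.2).
Proof.
move=> cK KU H0 cH z; have [/KU|nKz] := pselect (K z); first exact: cH.
apply: (near_continuous (g := fun=> 0)); last exact: cvg_cst.
have oK : open (~` K) by apply: closed_openC; apply: compact_closed => //; exact: norm_hausdorff.
by apply: filterS (open_nbhs_nbhs (conj oK nKz)) => -[x t]; exact: H0.
Qed.

(** K being closed, everything vanishes near a point outside K, which settles the
    points outside U. *)
Lemma compact_support_characteristic (a : R) (U K : set (R * R)) (G H : R -> R -> R) :
  compact K -> K `<=` U ->
  (forall x t, ~ K (x, t) -> G x t = 0) -> (forall x t, ~ K (x, t) -> H x t = 0) ->
  (forall z : R * R, U z -> {for z, continuous (fun z : R * R => H z.1 z.2)}) ->
  (forall x t : R, U (x + a * t, t) -> is_derive t 1 (fun s => G (x + a * s) s) (H (x + a * t) t)) ->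
  (\int[(mu \x mu)%E]_z (H z.1 z.2)%:E = 0)%E.
Proof.
move=> cK KU G0 H0 cH dG.
apply: (@characteristic_integral0 a K G H) => //; first exact: (compact_support_continuous cK KU H0 cH).
move=> x t; have [/KU|nK] := pselect (K (x + a * t, t)); first exact: dG.
rewrite (H0 _ _ nK); have oK : open (~` K).
  by apply: closed_openC; apply: compact_closed => //; exact: norm_hausdorff.
have ct : {for t, continuous (fun s => (x + a * s, s))}.
  apply: cvg_to_pair; last exact: cvg_id.
  by apply: cvgD; [exact: cvg_cst|apply: cvgM; [exact: cvg_cst|exact: cvg_id]].
have near0 : \near t, cst (0 : R) t = G (x + a * t) t.
  have h : \forall s \near t, (~` K) (x + a * s, s) := ct _ (open_nbhs_nbhs (conj oK nK)).
  by near=> s; rewrite (G0 (x + a * s) s)//; near: s.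
exact: (near_eq_is_derive near0 (is_derive_cst (0 : R) t (1 : R))).
Unshelve. all: by end_near. Qed.

End compact_support.

(** * Transport along characteristics *)

Section weak_wave.
Context (R : realType) (rate : R -> R).
Notation mu := (@lebesgue_measure R).
Hypothesis rate0 : forall t : R, 0 < t -> 0 <= rate t.
Hypothesis rateI : forall t : R, 0 < t -> mu.-integrable `]0, t] (EFin \o rate).
Hypothesis ratec : forall t : R, 0 < t -> {for t, continuous rate}.
Hypothesis mass : forall T : R, 0 < T -> exists B : R, forall t, 0 < t -> t <= T ->
  (\sum_(n <oo) \int[mu]_p sojourn_density rate n t p <= B%:E)%E.
Hypothesis rated : forall t : R, 0 < t -> derivable rate t 1.
Hypothesis rate'c : forall t : R, 0 < t -> {for t, continuous (derive1 rate)}.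
Notation S := (total_kernel rate).

(** The kernel in the characteristic coordinates of speed a; replacing a by -a
    exchanges its two arguments. *)
Definition wave (a x t : R) : R := S ((t + x / a) / 2) ((t - x / a) / 2).

Lemma wave_coordinates (a : R) (z : R * R) : a != 0 -> cone `|a| z ->
  [/\ 0 < z.2, 0 < (z.2 + z.1 / a) / 2 & 0 < (z.2 - z.1 / a) / 2].
Proof.
case: z => x t a0 [/= t0 xt]; have na : 0 < `|a| by rewrite normr_gt0.
have : `|x / a| < t by rewrite normrM normfV ltr_pdivrMr// mulrC.
by rewrite ltr_norml => /andP[h1 h2]; split => //; rewrite divr_gt0//; lra.
Qed.

Lemma wave_continuous (a : R) (z : R * R) : a != 0 -> cone `|a| z ->
  {for z, continuous (fun z : R * R => wave a z.1 z.2)}.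
Proof.
move=> a0 /(wave_coordinates a0) [_ h1 h2].
apply: (@continuous_comp _ _ _ (fun z : R * R => ((z.2 + z.1 / a) / 2, (z.2 - z.1 / a) / 2))
  (fun z : R * R => S z.1 z.2)); last exact: total_kernel_continuous.
apply: cvg_to_pair; apply: cvgM; try exact: cvg_cst.
  by apply: cvgD; [exact: cvg_snd|apply: cvgM; [exact: cvg_fst|exact: cvg_cst]].
by apply: cvgB; [exact: cvg_snd|apply: cvgM; [exact: cvg_fst|exact: cvg_cst]].
Qed.

(** Along the line of slope a the second argument of S is constant. *)
Lemma wave_transport (a y t : R) : a != 0 -> cone `|a| (y + a * t, t) ->
  is_derive t 1 (fun s : R => wave a (y + a * s) s) (rate t * wave (- a) (y + a * t) t).
Proof.
move=> a0 /(wave_coordinates a0) [/= t0 h1 h2].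
have pE s : (s + (y + a * s) / a) / 2 = s + y / a / 2 by field.
have qE s : (s - (y + a * s) / a) / 2 = - (y / a / 2) by field.
rewrite pE in h1; rewrite qE in h2.
have -> : rate t * wave (- a) (y + a * t) t =
    rate (t + y / a / 2 + - (y / a / 2)) * S (- (y / a / 2)) (t + y / a / 2) * 1.
  rewrite mulr1 addrK /wave; congr (_ * S _ _); field; exact: a0.
have dK := total_kernel_derive1 rate0 rateI ratec mass h1 h2.
have ds : is_derive t 1 (fun s : R => s + y / a / 2) 1.
  by have := is_deriveD (is_derive_id t (1 : R)) (is_derive_cst (y / a / 2) t 1); rewrite addr0.
have := @is_derive1_comp R (S^~ (- (y / a / 2))) (fun s : R => s + y / a / 2) t _ _ dK ds.
apply: near_eq_is_derive; exists 1 => /= [|s _ /=]; first exact: ltr01.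
by rewrite /wave pE qE.
Qed.

Lemma cone_oppr (a : R) (z : R * R) : cone `|a| z -> cone `|- a| z.
Proof. by rewrite normrN. Qed.

(** Here g and h are the derivative of psi along the slope -a and that of g along
    the slope a, so h stands for psi_tt - a^2 psi_xx. The integrand is the
    derivative of T g along a minus that of rate T' psi along -a, where T and T'
    are the waves of speeds a and -a: the products rate T' g cancel. *)
Lemma weak_wave_half (a : R) (K : set (R * R)) (psi g h : R -> R -> R) :
  a != 0 -> compact K -> K `<=` cone `|a| ->
  (forall x t, ~ K (x, t) -> [/\ psi x t = 0, g x t = 0 & h x t = 0]) ->
  (forall z : R * R, cone `|a| z -> [/\ {for z, continuous (fun z : R * R => psi z.1 z.2)},
     {for z, continuous (fun z : R * R => g z.1 z.2)} &
     {for z, continuous (fun z : R * R => h z.1 z.2)}]) ->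
  (forall y t : R, cone `|a| (y + (- a) * t, t) ->
     is_derive t 1 (fun s => psi (y + (- a) * s) s) (g (y + (- a) * t) t)) ->
  (forall y t : R, cone `|a| (y + a * t, t) ->
     is_derive t 1 (fun s => g (y + a * s) s) (h (y + a * t) t)) ->
  let F x t := wave a x t * h x t
    - (derive1 rate t * wave (- a) x t + rate t ^+ 2 * wave a x t) * psi x t in
  (mu \x mu)%E.-integrable setT (fun z => (F z.1 z.2)%:E) /\
  (\int[(mu \x mu)%E]_z (F z.1 z.2)%:E = 0)%E.
Proof.
move=> a0 cK KU out cont dpsi dg F.
have Na0 : - a != 0 by rewrite oppr_eq0.
(* H1 is the derivative of G1 along a, and H2 that of G2 along - a. *)
pose G1 x t := wave a x t * g x t.
pose H1 x t := wave a x t * h x t + rate t * wave (- a) x t * g x t.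
pose G2 x t := rate t * wave (- a) x t * psi x t.
pose H2 x t := rate t * wave (- a) x t * g x t
  + (derive1 rate t * wave (- a) x t + rate t ^+ 2 * wave a x t) * psi x t.
have cs (z : R * R) (r : R -> R) : {for z.2, continuous r} -> {for z, continuous (fun z : R * R => r z.2)}.
  by case: z => z1 z2 cr; exact: (cvg_comp _ _ (@cvg_snd R R (nbhs z1) (nbhs z2) _) cr).
have cw b z : `|b| = `|a| -> cone `|a| z -> {for z, continuous (fun z : R * R => wave b z.1 z.2)}.
  by move=> ba; rewrite -ba; apply: wave_continuous; rewrite -normr_eq0 ba normr_eq0.
have G10 x t : ~ K (x, t) -> G1 x t = 0 by move=> /out[_ e _]; rewrite /G1 e mulr0.
have H10 x t : ~ K (x, t) -> H1 x t = 0 by move=> /out[_ e e']; rewrite /H1 e e' !mulr0 addr0.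
have G20 x t : ~ K (x, t) -> G2 x t = 0 by move=> /out[e _ _]; rewrite /G2 e mulr0.
have H20 x t : ~ K (x, t) -> H2 x t = 0 by move=> /out[e e' _]; rewrite /H2 e e' !mulr0 addr0.
have cH1 (z : R * R) : cone `|a| z -> {for z, continuous (fun z : R * R => H1 z.1 z.2)}.
  move=> cz; have [_ cg ch] := cont z cz; have [t0 _ _] := wave_coordinates a0 cz.
  apply: cvgD; first by apply: cvgM; [exact: cw|exact: ch].
  apply: cvgM; last exact: cg.
  by apply: cvgM; [exact/cs/ratec|apply: cw; rewrite ?normrN].
have cH2 (z : R * R) : cone `|a| z -> {for z, continuous (fun z : R * R => H2 z.1 z.2)}.
  move=> cz; have [cp cg _] := cont z cz; have [t0 _ _] := wave_coordinates a0 cz.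
  apply: cvgD.
    apply: cvgM; last exact: cg.
    by apply: cvgM; [exact/cs/ratec|apply: cw; rewrite ?normrN].
  apply: cvgM; last exact: cp.
  apply: cvgD; apply: cvgM.
  - exact/cs/rate'c.
  - by apply: cw; rewrite ?normrN.
  - by apply: cvgM; exact/cs/ratec.
  - exact: cw.
have i1 : (\int[(mu \x mu)%E]_z (H1 z.1 z.2)%:E = 0)%E.
  apply: (@compact_support_characteristic R a (cone `|a|) K G1 H1) => // x t cxt.
  have := is_deriveM (wave_transport a0 cxt) (dg _ _ cxt).
  rewrite /GRing.scale/=; congr is_derive; rewrite /H1; ring.
have i2 : (\int[(mu \x mu)%E]_z (H2 z.1 z.2)%:E = 0)%E.
  apply: (@compact_support_characteristic R (- a) (cone `|a|) K G2 H2) => // x t cxt.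
  have [t0 _ _] := wave_coordinates a0 cxt.
  have dr : is_derive t 1 rate (derive1 rate t) by apply: DeriveDef; [exact: rated|rewrite derive1E].
  have := is_deriveM (is_deriveM dr (wave_transport Na0 (cone_oppr cxt))) (dpsi _ _ cxt).
  rewrite /GRing.scale/= opprK; congr is_derive; rewrite /H2 mulrfctE; ring.
have I1 : (mu \x mu)%E.-integrable setT (fun z => (H1 z.1 z.2)%:E).
  by apply: (compact_support_integrable cK H10); exact: (compact_support_continuous cK KU H10).
have I2 : (mu \x mu)%E.-integrable setT (fun z => (H2 z.1 z.2)%:E).
  by apply: (compact_support_integrable cK H20); exact: (compact_support_continuous cK KU H20).
have FE z : (F z.1 z.2)%:E = ((H1 z.1 z.2)%:E - (H2 z.1 z.2)%:E)%E.
  by rewrite -EFinB /F /H1 /H2; congr EFin; ring.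
split.
  by apply: eq_integrable (integrableB _ I1 I2) => // z _; rewrite FE.
apply: etrans (etrans (integralB measurableT I1 I2) _); last by rewrite [X in (X - _)%E]i1 [X in (_ - X)%E]i2 sube0.
by apply: eq_integral => z _; exact: FE.
Qed.

End weak_wave.

(** * The equation in the sense of distributions *)

Section test_functions.
Context (R : realType).

Lemma differentiable_upto_is_derive (g : R -> R -> R) : differentiable_upto 1 g ->
  (forall x t : R, is_derive x 1 (g^~ t) (dx g x t)) /\
  (forall x t : R, is_derive t 1 (g x) (dt g x t)).
Proof.
move=> [_ [D _ _]]; split => x t; have [d1 d2] := D x t.
  by apply: (DeriveDef d1); rewrite /dx derive1E.
by apply: (DeriveDef d2); rewrite /dt derive1E.
Qed.

Lemma line_derive (g : R -> R -> R) (b y t : R) : differentiable_upto 1 g ->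
  is_derive t 1 (fun s : R => g (y + b * s) s) (b * dx g (y + b * t) t + dt g (y + b * t) t).
Proof.
move=> g1; have [D1 D2] := differentiable_upto_is_derive g1.
have [_ [_ [cx _] _]] := g1.
have := @is_derive_affine_path R g (dx g) y 0 b 1 t (dt g (y + b * t) t).
rewrite !add0r !mul1r mulr1.
have -> : (fun s : R => g (y + b * s) (0 + 1 * s)) = (fun s => g (y + b * s) s).
  by apply/funext => s; rewrite add0r mul1r.
have D1' : \forall z \near (y + b * t, t) : R * R, is_derive (z.1 : R) 1 (g^~ z.2) (dx g z.1 z.2).
  exists (setT, setT) => [|z _]; first by split; exact: filterT.
  exact: (D1 z.1 z.2).
by apply; [exact: D1'|exact: cx].
Qed.

Lemma derivatives_outside (K : set (R * R)) (g : R -> R -> R) :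
  closed K -> (forall x t, ~ K (x, t) -> g x t = 0) ->
  forall x t, ~ K (x, t) -> dx g x t = 0 /\ dt g x t = 0.
Proof.
move=> clK g0 x t nK.
have oK : open (~` K) by exact: closed_openC.
have nbK := open_nbhs_nbhs (conj oK nK).
have cx : {for x, continuous (fun y => (y, t))} by apply: cvg_to_pair; [exact: cvg_id|exact: cvg_cst].
have ct : {for t, continuous (fun s => (x, s))} by apply: cvg_to_pair; [exact: cvg_cst|exact: cvg_id].
have hx : \forall y \near x, (~` K) (y, t) := cx _ nbK.
have ht : \forall s \near t, (~` K) (x, s) := ct _ nbK.
split.
  rewrite /dx derive1E (@near_eq_derive _ _ _ _ (cst 0)) ?derive_cst//.
  by near=> y; rewrite g0//; near: y.
rewrite /dt derive1E (@near_eq_derive _ _ _ _ (cst 0)) ?derive_cst//.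
by near=> y; rewrite g0//; near: y.
Unshelve. all: by end_near. Qed.

End test_functions.

Section weak_solution.
Context (R : realType) (c : R) (rate : R -> R).
Notation mu := (@lebesgue_measure R).
Hypothesis c0 : 0 < c.
Hypothesis rate0 : forall t : R, 0 < t -> 0 <= rate t.
Hypothesis rateI : forall t : R, 0 < t -> mu.-integrable `]0, t] (EFin \o rate).
Hypothesis rated : forall t : R, 0 < t -> derivable rate t 1.
Hypothesis rate'c : forall t : R, 0 < t -> {for t, continuous (derive1 rate)}.
Notation L := (cumulative_rate rate).
Notation third := (fun t => rate t / 3).
Hypothesis mass : forall T : R, 0 < T -> exists B : R, forall t, 0 < t -> t <= T ->
  (\sum_(n <oo) \int[mu]_p sojourn_density third n t p <= B%:E)%E.

Lemma rate_derivable_continuous (t : R) : 0 < t -> {for t, continuous rate}.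
Proof. by move=> /rated /derivable1_diffP/differentiable_continuous. Qed.

Lemma rate_is_derive (t : R) : 0 < t -> is_derive t 1 rate (derive1 rate t).
Proof. by move=> t0; apply: DeriveDef; [exact: rated|rewrite derive1E]. Qed.

Lemma survival_is_derive (t : R) : 0 < t ->
  is_derive t 1 (fun t => expR (- L t)) (- rate t * expR (- L t)).
Proof.
move=> t0; have dL := cumulative_rate_derive rateI t0 (rate_derivable_continuous t0).
rewrite mulrC; exact: (is_derive1_comp (is_derive_expR _) (is_deriveN dL)).
Qed.

Lemma third_is_derive (t : R) : 0 < t -> is_derive t 1 third (derive1 rate t / 3).
Proof.
move=> t0; have := is_deriveM (rate_is_derive t0) (is_derive_cst (3^-1 : R) t 1).
rewrite /GRing.scale/=; congr is_derive; rewrite /GRing.scale/=; ring.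
Qed.

Lemma third_derive1 (t : R) : 0 < t -> derive1 third t = derive1 rate t / 3.
Proof. by move=> t0; rewrite derive1E; have [_ ->] := third_is_derive t0. Qed.

Lemma third_derive1_continuous (t : R) : 0 < t -> {for t, continuous (derive1 third)}.
Proof.
move=> t0; apply: (near_continuous (g := fun t => derive1 rate t / 3)).
  by near=> s; apply: third_derive1; near: s; exact: lt_nbhsr.
by apply: cvgM; [exact: rate'c|exact: cvg_cst].
Unshelve. all: by end_near. Qed.

Lemma diagonal_profile_wave (x t : R) :
  diagonal_profile c rate x t =
  expR (- L t) / (8 * c) * (wave third c x t + wave third (- c) x t).
Proof. by rewrite /diagonal_profile /cone_profile /wave invrN mulrN opprK. Qed.

Section test.
Variables (phi : R -> R -> R) (K : set (R * R)).
Hypothesis smooth : differentiable_upto 2 phi.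
Hypothesis cK : compact K.
Hypothesis KU : K `<=` cone c.
Hypothesis phi0 : forall x t, ~ K (x, t) -> phi x t = 0.

Let e (t : R) := expR (- L t).
Let psi (x t : R) := e t * phi x t.
Let g (a x t : R) := e t * (dt phi x t - rate t * phi x t - a * dx phi x t).
Let h (x t : R) := e t * (dt (dt phi) x t - 2 * rate t * dt phi x t - derive1 rate t * phi x t
  + rate t ^+ 2 * phi x t - c ^+ 2 * dx (dx phi) x t).

Let smooth_phi : differentiable_upto 1 phi.
Proof. by have [cp [D [c1 _] [c2 _]]] := smooth. Qed.
Let smooth_dx : differentiable_upto 1 (dx phi).
Proof. by have [_ [_ + _]] := smooth. Qed.
Let smooth_dt : differentiable_upto 1 (dt phi).
Proof. by have [_ [_ _ +]] := smooth. Qed.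

Let schwarz x t : dx (dt phi) x t = dt (dx phi) x t.
Proof.
have [D1 D2] := differentiable_upto_is_derive smooth_phi.
have [_ D12] := differentiable_upto_is_derive smooth_dx.
have [D21 _] := differentiable_upto_is_derive smooth_dt.
have [_ [_ _ [c12 _]]] := smooth_dx; have [_ [_ [c21 _] _]] := smooth_dt.
symmetry; exact: (@mixed_derivatives_equal R phi (dx phi) (dt phi) (dt (dx phi)) (dx (dt phi)) x t
  (fun z => D1 z.1 z.2) (fun z => D2 z.1 z.2) (fun z => D12 z.1 z.2) (fun z => D21 z.1 z.2)
  (c12 (x, t)) (c21 (x, t))).
Qed.

Let clK : closed K. Proof. by apply: compact_closed => //; exact: norm_hausdorff. Qed.

Let outside a x t : ~ K (x, t) -> [/\ psi x t = 0, g a x t = 0 & h x t = 0].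
Proof.
move=> nK; have [e1 e2] := derivatives_outside clK phi0 nK.
have ox x' t' : ~ K (x', t') -> dx phi x' t' = 0 by move=> /(derivatives_outside clK phi0)[].
have ot x' t' : ~ K (x', t') -> dt phi x' t' = 0 by move=> /(derivatives_outside clK phi0)[].
have [e3 _] := derivatives_outside clK ox nK; have [_ e4] := derivatives_outside clK ot nK.
by rewrite /psi /g /h e1 e2 e3 e4 phi0// !mulr0 !subr0 addr0 !mulr0.
Qed.

Let inside a (z : R * R) : cone c z -> [/\ {for z, continuous (fun z : R * R => psi z.1 z.2)},
   {for z, continuous (fun z : R * R => g a z.1 z.2)} &
   {for z, continuous (fun z : R * R => h z.1 z.2)}].
Proof.
move=> [z0 _].
have cs (r : R -> R) : {for z.2, continuous r} -> {for z, continuous (fun z : R * R => r z.2)}.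
  by case: (z) => z1 z2 cr; exact: (cvg_comp _ _ (@cvg_snd R R (nbhs z1) (nbhs z2) _) cr).
have ce : {for z, continuous (fun z : R * R => e z.2)}.
  apply: cs; have [+ _] := survival_is_derive z0; by move=> /derivable1_diffP/differentiable_continuous.
have cr := cs _ (rate_derivable_continuous z0).
have cr' := cs _ (rate'c z0).
have [cp [_ [cx _] [ct _]]] := smooth_phi.
have [_ [_ [cxx _] _]] := smooth_dx; have [_ [_ _ [ctt _]]] := smooth_dt.
split.
- by apply: cvgM => //; exact: cp.
- apply: cvgM => //; apply: cvgB.
    apply: cvgB; first exact: ct.
    by apply: cvgM => //; exact: cp.
  by apply: cvgM; [exact: cvg_cst|exact: cx].
- apply: cvgM => //; apply: cvgB; last by apply: cvgM; [exact: cvg_cst|exact: cxx].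
  apply: cvgD.
    apply: cvgB; last by apply: cvgM => //; exact: cp.
    apply: cvgB; first exact: ctt.
    apply: cvgM; last exact: ct.
    by apply: cvgM => //; exact: cvg_cst.
  by apply: cvgM; [apply: cvgM|exact: cp].
Qed.

Let psi_derive a y t : cone c (y + (- a) * t, t) ->
  is_derive t 1 (fun s : R => psi (y + (- a) * s) s) (g a (y + (- a) * t) t).
Proof.
move=> [/= t0 _].
have := is_deriveM (survival_is_derive t0) (line_derive (- a) y t smooth_phi).
rewrite /GRing.scale/=; congr is_derive; rewrite /g /e; ring.
Qed.

Let g_derive a y t : a ^+ 2 = c ^+ 2 -> cone c (y + a * t, t) ->
  is_derive t 1 (fun s : R => g a (y + a * s) s) (h (y + a * t) t).
Proof.
move=> ac [/= t0 _].
have dphi := line_derive a y t smooth_phi.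
have ddx := line_derive a y t smooth_dx.
have ddt := line_derive a y t smooth_dt.
have := is_deriveM (survival_is_derive t0) (is_deriveB (is_deriveB ddt
  (is_deriveM (rate_is_derive t0) dphi)) (is_deriveZ a ddx)).
rewrite /GRing.scale/=; congr is_derive; rewrite /h /e -ac schwarz.
rewrite [X in _ + X * _ = _](_ : _ = dt phi (y + a * t) t - rate t * phi (y + a * t) t
  - a * dx phi (y + a * t) t); last exact: erefl.
move: (dt (dx phi) _ _) (dt (dt phi) _ _) (dx (dx phi) _ _) (dx phi _ _) (dt phi _ _) (phi _ _) => *.
ring.
Qed.

Let F a x t := wave third a x t * h x t
    - (derive1 third t * wave third (- a) x t + third t ^+ 2 * wave third a x t) * psi x t.

Let F_integral a : `|a| = c ->
  (mu \x mu)%E.-integrable setT (fun z => (F a z.1 z.2)%:E) /\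
  (\int[(mu \x mu)%E]_z (F a z.1 z.2)%:E = 0)%E.
Proof.
move=> ac; have a0 : a != 0 by rewrite -normr_eq0 ac gt_eqF.
have a2 : a ^+ 2 = c ^+ 2 by rewrite -ac real_normK// num_real.
have tc t : 0 < t -> {for t, continuous third}.
  by move=> t0; apply: (third_continuous (rate := rate)) => // s; exact: rate_derivable_continuous.
have td (t : R) : 0 < t -> derivable third t 1 by move=> t0; have [] := third_is_derive t0.
apply: (weak_wave_half (third_ge0 rate0) (third_integrable rateI) tc mass td third_derive1_continuous a0 cK (g := g a)).
- by rewrite ac.
- by move=> x t; exact: outside.
- by move=> z; rewrite ac => cz; exact: inside.
- by move=> y t; rewrite ac; exact: psi_derive.
- by move=> y t; rewrite ac; exact: g_derive.
Qed.

(** With psi = e^(-L) phi the adjoint operator applied to phi is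
    e^L (psi_tt - c^2 psi_xx - (third' + third^2) psi), and the half identities for c
    and -c add up to this operator tested against the sum of the two waves. *)
Lemma diagonal_weak_identity :
  (\int[(mu \x mu)%E]_(z in cone c)
       (diagonal_profile c rate z.1 z.2 *
         (dt (dt phi) z.1 z.2
          - 2%:R * dt (fun x t => rate t * phi x t) z.1 z.2
          + zero_order_coef rate z.2 * phi z.1 z.2
          - c ^+ 2 * dx (dx phi) z.1 z.2))%:E = 0)%E.
Proof.
have [i1 e1] := @F_integral c (gtr0_norm c0).
have [i2 e2] : (mu \x mu)%E.-integrable setT (fun z => (F (- c) z.1 z.2)%:E) /\
  (\int[(mu \x mu)%E]_z (F (- c) z.1 z.2)%:E = 0)%E by apply: F_integral; rewrite normrN gtr0_norm.
have E z : cone c z -> diagonal_profile c rate z.1 z.2 *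
         (dt (dt phi) z.1 z.2
          - 2%:R * dt (fun x t => rate t * phi x t) z.1 z.2
          + zero_order_coef rate z.2 * phi z.1 z.2
          - c ^+ 2 * dx (dx phi) z.1 z.2) = (8 * c)^-1 * (F c z.1 z.2 + F (- c) z.1 z.2).
  case: z => x t [/= t0 _]; rewrite diagonal_profile_wave /F opprK third_derive1//.
  have -> : dt (fun x t => rate t * phi x t) x t = derive1 rate t * phi x t + rate t * dt phi x t.
    have [_ D2] := differentiable_upto_is_derive smooth_phi.
    rewrite {1}/dt derive1E; have [_ ->] := is_deriveM (rate_is_derive t0) (D2 x t).
    by rewrite /GRing.scale/= addrC mulrC.
  rewrite /zero_order_coef /h /psi /e; field; exact: lt0r_neq0.
have out z : ~ cone c z -> (8 * c)^-1 * (F c z.1 z.2 + F (- c) z.1 z.2) = 0.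
  case: z => x t nc; have nK : ~ K (x, t) by move=> /KU.
  have [p0 _ h0] := outside 0 nK.
  by rewrite /F /= p0 h0 !mulr0 subr0 addr0 mulr0.
have iD := integrableD measurableT i1 i2.
transitivity (\int[(mu \x mu)%E]_z ((8 * c)^-1%:E * ((F c z.1 z.2)%:E + (F (- c) z.1 z.2)%:E)))%E.
  rewrite [LHS]integral_mkcond; apply: eq_integral => z _.
  rewrite -EFinD -EFinM /patch; case: ifPn => [|/negP zc]; first by rewrite inE => /E ->.
  by rewrite out// => cz; apply: zc; rewrite inE.
apply: etrans (integralZl measurableT iD _) _.
apply: etrans (congr1 (fun y => _ * y)%E (integralD measurableT i1 i2)) _.
by rewrite [X in (_ * (X + _))%E]e1 [X in (_ * (_ + X))%E]e2 adde0 mule0.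
Qed.

End test.

Lemma diagonal_weak_solution (f : R -> R -> R) :
  (forall x t, cone c (x, t) -> f x t = diagonal_profile c rate x t) ->
  distributional_solution c rate f.
Proof.
move=> fE phi [smooth [K [cK KU phi0]]].
apply: etrans (diagonal_weak_identity (smooth 2%N) cK KU phi0).
by apply: eq_integral => -[x t]; rewrite inE => /fE /= ->.
Qed.

End weak_solution.

(** * Second derivatives of the kernel *)

Lemma positive_continuous_bounded (R : realType) (f : R -> R) (a b : R) :
  (forall t, 0 < t -> {for t, continuous f}) -> 0 < a ->
  exists2 C : R, 0 <= C & forall x, a <= x <= b -> `|f x| <= C.
Proof.
move=> cf a0.
have cfab : {within `[a, b], continuous f}.
  apply: continuous_in_subspaceT => x; rewrite inE /= in_itv/= => /andP[ax _].
  by apply: cf; exact: lt_le_trans ax.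
have [B [_ hB]] := compact_bounded (continuous_compact cfab (@segment_compact R a b)).
exists (`|B| + 1) => [|x abx]; first by rewrite addr_ge0.
apply: hB; first by rewrite (le_lt_trans (ler_norm _))// ltrDl.
by exists x => //=; rewrite in_itv.
Qed.

Lemma positive_continuous_measurable (R : realType) (f : R -> R) (p : R) :
  (forall t, 0 < t -> {for t, continuous f}) -> measurable_fun `]0, p] f.
Proof.
move=> cf; have m : measurable_fun (`]0, +oo[%classic : set R) f.
  apply: open_continuous_measurable_fun; first exact: interval_open.
  by move=> x; rewrite inE /= in_itv/= andbT; exact: cf.
apply: (measurable_funS _ _ m) => //.
by move=> x /=; rewrite !in_itv/= => /andP[->].
Qed.

Lemma dominated_integrable (R : realType) (f G : R -> R) (p : R) :
  (forall t, 0 < t -> {for t, continuous f}) ->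
  (forall r, 0 < r -> r <= p -> `|f r| <= G r) ->
  (@lebesgue_measure R).-integrable `]0, p] (EFin \o G) ->
  (@lebesgue_measure R).-integrable `]0, p] (EFin \o f).
Proof.
move=> cf fG iG; apply: le_integrable iG => //.
  by apply/measurable_EFinP; exact: positive_continuous_measurable.
move=> r /=; rewrite in_itv/= => /andP[r0 rp].
by rewrite lee_fin (le_trans (fG _ r0 rp))// ler_norm.
Qed.

Lemma cumulative_rate_parameter (R : realType) (f f' : R -> R -> R) (p a u v : R) (G : R -> R) :
  u < a -> a < v ->
  (forall x, u < x -> x < v -> (@lebesgue_measure R).-integrable `]0, p] (EFin \o f x)) ->
  (forall x r : R, u < x -> x < v -> 0 < r -> r <= p -> is_derive x 1 (f^~ r) (f' x r)) ->
  (forall r, 0 <= G r) -> (@lebesgue_measure R).-integrable `]0, p] (EFin \o G) ->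
  (forall x r, u < x -> x < v -> 0 < r -> r <= p -> `|f' x r| <= G r) ->
  is_derive a 1 (fun x => cumulative_rate (f x) p) (cumulative_rate (f' a) p).
Proof.
move=> ua av fI df G0 GI f'G.
have Ia : (`]u, v[%classic : set R) a by rewrite /= in_itv/= ua av.
have I1 (x : R) : (`]u, v[%classic : set R) x -> (@lebesgue_measure R).-integrable `]0, p] (EFin \o f x).
  by rewrite /= in_itv/= => /andP[]; exact: fI.
have D1 (x r : R) : (`]u, v[%classic : set R) x -> (`]0, p]%classic : set R) r -> is_derive x 1 (f^~ r) (f' x r).
  by rewrite /= !in_itv/= => /andP[ux xv] /andP[r0 rp]; exact: df.
have D2 (x r : R) : (`]u, v[%classic : set R) x -> (`]0, p]%classic : set R) r -> derivable (f^~ r) x 1.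
  by move=> Ix Ir; have [] := D1 x r Ix Ir.
have E x r : (`]u, v[%classic : set R) x -> (`]0, p]%classic : set R) r -> partial1of2 f x r = f' x r.
  by move=> Ix Ir; rewrite partial1of2E; have [_ ->] := D1 x r Ix Ir.
have G1 x r : (`]u, v[%classic : set R) x -> (`]0, p]%classic : set R) r -> `|partial1of2 f x r| <= G r.
  move=> Ix Ir; rewrite E//; move: Ix Ir; rewrite /= !in_itv/= => /andP[ux xv] /andP[r0 rp]; exact: f'G.
have mI : measurable (`]0, p]%classic : set (measurableTypeR R)) by [].
have d1 := derivable_under_integral mI Ia I1 D2 G0 GI G1.
have d2 := differentiation_under_integral mI Ia I1 D2 G0 GI G1.
apply: (DeriveDef d1); rewrite -derive1E d2; apply: eq_Rintegral => r.
by rewrite inE => Ir; exact: E.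
Qed.

Section kernel_second_derivatives.
Context (R : realType) (rate : R -> R).
Notation mu := (@lebesgue_measure R).
Hypothesis rate0 : forall t : R, 0 < t -> 0 <= rate t.
Hypothesis rateI : forall t : R, 0 < t -> mu.-integrable `]0, t] (EFin \o rate).
Hypothesis mass : forall T : R, 0 < T -> exists B : R, forall t, 0 < t -> t <= T ->
  (\sum_(n <oo) \int[mu]_p sojourn_density rate n t p <= B%:E)%E.
Hypothesis rated : forall t : R, 0 < t -> derivable rate t 1.
Hypothesis rated' : forall t : R, 0 < t -> derivable (derive1 rate) t 1.
Hypothesis rate''c : forall t : R, 0 < t -> {for t, continuous (derive1 (derive1 rate))}.
Notation S := (total_kernel rate).
Notation rate1 := (derive1 rate).
Notation rate2 := (derive1 (derive1 rate)).

Let ratec (t : R) : 0 < t -> {for t, continuous rate}.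
Proof. by move=> /rated /derivable1_diffP/differentiable_continuous. Qed.
Let rate'c (t : R) : 0 < t -> {for t, continuous rate1}.
Proof. by move=> /rated' /derivable1_diffP/differentiable_continuous. Qed.

Let shift_derive (f : R -> R) (r q : R) : (forall t : R, 0 < t -> derivable f t 1) ->
  0 < q -> 0 < r -> is_derive q 1 (fun q : R => f (r + q)) (derive1 f (r + q)).
Proof.
move=> df q0 r0.
have d1 : is_derive (r + q) 1 f (derive1 f (r + q)).
  by apply: (DeriveDef (df _ _)); [rewrite addr_gt0|rewrite derive1E].
have d2 : is_derive q 1 (fun q : R => r + q) 1.
  by have := is_deriveD (is_derive_cst r q 1) (is_derive_id q (1 : R)); rewrite add0r.
by have := is_derive1_comp d1 d2; rewrite mulr1.
Qed.

Let shift_continuous1 (f : R -> R) (r q : R) : (forall t : R, 0 < t -> {for t, continuous f}) ->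
  0 < q -> 0 < r -> {for r, continuous (fun r : R => f (r + q))}.
Proof.
move=> cf q0 r0; apply: (@continuous_comp _ _ _ (fun r => r + q) f).
  by apply: cvgD; [exact: cvg_id|exact: cvg_cst].
by apply: cf; rewrite addr_gt0.
Qed.

(** The derivative in q of the renewal integrand, and at the same time both mixed
    second derivatives of S at the point (r, q). *)
Definition kernel_mixed (q r : R) : R := rate1 (r + q) * S q r + rate (r + q) ^+ 2 * S r q.

(** The derivative of S in its second argument, obtained by differentiating the
    renewal equation under the integral sign. *)
Definition kernel_derive2 (p q : R) : R := rate1 q + cumulative_rate (kernel_mixed q) p.
Notation k := kernel_mixed.
Notation Q := kernel_derive2.

Let dS1 (p q : R) : 0 < p -> 0 < q -> is_derive p 1 (S^~ q) (rate (p + q) * S q p).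
Proof. exact: total_kernel_derive1. Qed.

Lemma kernel_mixed_continuous2 q r : 0 < q -> 0 < r -> {for r, continuous (k q)}.
Proof.
move=> q0 r0; have cr := shift_continuous1 ratec q0 r0; apply: cvgD; apply: cvgM.
- exact: (shift_continuous1 rate'c q0 r0).
- exact: total_kernel_continuous2.
- by apply: cvgM; exact: cr.
- exact: total_kernel_continuous1.
Qed.

Let renewal_is_derive (q r : R) : 0 < q -> 0 < r ->
  is_derive q 1 ((renewal_integrand rate)^~ r) (k q r).
Proof.
move=> q0 r0; have := is_deriveM (shift_derive rated q0 r0) (dS1 q0 r0).
rewrite /GRing.scale/=; congr is_derive; rewrite /k (addrC q r); ring.
Qed.

(** One constant dominates all the factors for q in a compact interval, except
    S q r, which may be unbounded as r tends to 0 but is integrable. *)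
Let local_bounds p u v : 0 < p -> 0 < u -> u < v -> exists C : R, 0 <= C /\
  forall q r, u < q -> q < v -> 0 < r -> r <= p ->
  [/\ `|rate (r + q)| <= C, `|rate1 (r + q)| <= C, `|rate2 (r + q)| <= C,
      `|rate1 q| <= C & 0 <= S r q <= C] /\ 0 <= S q r <= S v r.
Proof.
move=> p0 u0 uv; have v0 := lt_trans u0 uv.
have [C0 C00 h0] := positive_continuous_bounded (p + v) ratec u0.
have [C1 C10 h1] := positive_continuous_bounded (p + v) rate'c u0.
have [C2 C20 h2] := positive_continuous_bounded (p + v) rate''c u0.
have cSp t : 0 < t -> {for t, continuous (S p)} by move=> t0; exact: total_kernel_continuous2.
have [C3 C30 h3] := positive_continuous_bounded v cSp u0.
exists (C0 + C1 + C2 + C3); split => [|q r uq qv r0 rp]; first by rewrite !addr_ge0.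
have q0 := lt_trans u0 uq.
have I : u <= r + q <= p + v by apply/andP; split; lra.
have I' : u <= q <= p + v by apply/andP; split; lra.
have Sv := total_kernel_nd rate0 rateI ratec mass q0 (ltW qv) r0.
split; last by rewrite total_kernel_ge0.
have I3 : u <= q <= v by rewrite !ltW.
split.
- by apply: le_trans (h0 _ I) _; rewrite -!addrA lerDl !addr_ge0.
- by apply: le_trans (h1 _ I) _; rewrite -!addrA addrCA lerDl !addr_ge0.
- by apply: le_trans (h2 _ I) _; rewrite -addrA addrCA lerDl !addr_ge0.
- by apply: le_trans (h1 _ I') _; rewrite -!addrA addrCA lerDl !addr_ge0.
- rewrite (total_kernel_ge0 rate0)/=; have Sp := total_kernel_nd rate0 rateI ratec mass r0 rp q0.
  apply: (le_trans Sp); apply: (le_trans (ler_norm _)); apply: (le_trans (h3 _ I3)).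
  by rewrite lerDr !addr_ge0.
Qed.

Let G (C : R) v r : R := C * S v r + C ^+ 3 .

Let mixed_dominated p u v C : 0 <= C ->
  (forall q r, u < q -> q < v -> 0 < r -> r <= p ->
  [/\ `|rate (r + q)| <= C, `|rate1 (r + q)| <= C, `|rate2 (r + q)| <= C,
      `|rate1 q| <= C & 0 <= S r q <= C] /\ 0 <= S q r <= S v r) ->
  forall q r, u < q -> q < v -> 0 < r -> r <= p -> `|k q r| <= G C v r.
Proof.
move=> C0 hC q r uq qv r0 rp; have [[c0 c1 _ _ /andP[s0 sC]] /andP[s1 sv]] := hC q r uq qv r0 rp.
rewrite /k /G (le_trans (ler_normD _ _))// lerD// normrM.
  by rewrite (ger0_norm s1) ler_pM.
by rewrite (ger0_norm s0) (exprSr C 2) ler_pM// normrX lerXn2r// nnegrE.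
Qed.

Let G_ge0 C v r : 0 <= C -> 0 <= G C v r.
Proof. by move=> C0; rewrite addr_ge0 ?exprn_ge0// mulr_ge0// total_kernel_ge0. Qed.

Let cst_integrable (C p : R) : mu.-integrable `]0, p] (EFin \o cst C).
Proof.
have [p0|p0] := leP p 0.
  by rewrite set_itv_ge ?bnd_simp -?leNgt//; exact: integrable_set0.
apply: measurable_bounded_integrable => //; last exact: bounded_cst.
by rewrite /= lebesgue_measure_itv/= lte_fin p0 ltry.
Qed.

Let G_integrable C v p : 0 < v -> mu.-integrable `]0, p] (EFin \o G C v).
Proof.
move=> v0; have Si : mu.-integrable `]0, p] (EFin \o S v) by exact: total_kernel_integrable.
exact: (integrableD _ (integrableZl _ C Si) (cst_integrable (C ^+ 3) p)).
Qed.

Lemma kernel_mixed_integrable q p : 0 < q -> mu.-integrable `]0, p] (EFin \o k q).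
Proof.
move=> q0; have [p0|p0] := leP p 0.
  by rewrite set_itv_ge ?bnd_simp -?leNgt//; exact: integrable_set0.
have u0 : 0 < q / 2 by rewrite divr_gt0.
have uv : q / 2 < q + 1 by lra.
have [C [C0 hC]] := local_bounds p0 u0 uv.
apply: (@dominated_integrable R _ (G C (q + 1))).
- by move=> t; exact: kernel_mixed_continuous2.
- by move=> r; apply: (mixed_dominated C0 hC); lra.
- by apply: G_integrable; lra.
Qed.

Lemma total_kernel_derive2 (p q : R) : 0 < p -> 0 < q -> is_derive q 1 (S p) (Q p q).
Proof.
move=> p0 q0.
have u0 : 0 < q / 2 by rewrite divr_gt0.
have uv : q / 2 < q + 1 by lra.
have [C [C0 hC]] := local_bounds p0 u0 uv.
have uq : q / 2 < q by lra.
have qv : q < q + 1 by lra.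
have dI : is_derive q 1 (fun q => cumulative_rate (renewal_integrand rate q) p) (cumulative_rate (k q) p).
  apply: (@cumulative_rate_parameter R _ _ p q (q / 2) (q + 1) (G C (q + 1))) => //.
  - by move=> x ux _; apply: renewal_integrand_integrable => //; exact: lt_trans ux.
  - by move=> x r ux _ r0 _; apply: renewal_is_derive => //; exact: lt_trans ux.
  - by move=> r; exact: G_ge0.
  - by apply: G_integrable; lra.
  - exact: (mixed_dominated C0 hC).
have dr : is_derive q 1 rate (rate1 q) by apply: (DeriveDef (rated q0)); rewrite derive1E.
have := is_deriveD dr dI; apply: near_eq_is_derive.
by near=> x; rewrite total_kernelE//; near: x; exact: lt_nbhsr.
Unshelve. all: by end_near. Qed.

Lemma kernel_derive2_derive1 (p q : R) : 0 < p -> 0 < q -> is_derive p 1 (Q^~ q) (k q p).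
Proof.
move=> p0 q0; have kI t : 0 < t -> mu.-integrable `]0, t] (EFin \o k q).
  by move=> _; exact: kernel_mixed_integrable.
have := is_deriveD (is_derive_cst (rate1 q) p 1) (cumulative_rate_derive kI p0 (kernel_mixed_continuous2 q0 p0)).
by rewrite add0r.
Qed.

Let k' q r := rate2 (r + q) * S q r + 3 * (rate1 (r + q) * rate (r + q)) * S r q
  + rate (r + q) ^+ 2 * Q r q.

Let mixed_is_derive (q r : R) : 0 < q -> 0 < r -> is_derive q 1 (k^~ r) (k' q r).
Proof.
move=> q0 r0; have d0 := shift_derive rated q0 r0; have d1 := shift_derive rated' q0 r0.
have := is_deriveD (is_deriveM d1 (dS1 q0 r0))
  (is_deriveM (is_deriveM d0 d0) (total_kernel_derive2 r0 q0)).
rewrite /GRing.scale/=; congr is_derive; rewrite /k' (addrC q r) mulrfctE.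
move: (Q r q) => x; ring.
Qed.

(** A second differentiation under the integral sign; kernel_derive2 itself is
    bounded through the integral of the dominating function. *)
Lemma kernel_derive2_derivable2 (p q : R) : 0 < p -> 0 < q -> derivable (Q p) q 1.
Proof.
move=> p0 q0.
have u0 : 0 < q / 2 by rewrite divr_gt0.
have uv : q / 2 < q + 1 by lra.
have [C [C0 hC]] := local_bounds p0 u0 uv.
have uq : q / 2 < q by lra.
have qv : q < q + 1 by lra.
have v0 : 0 < q + 1 by lra.
have mC := mixed_dominated C0 hC.
(* D bounds kernel_derive2 at all the points (r, x) under the integral. *)
pose D := C + cumulative_rate (G C (q + 1)) p.
have GI t : 0 < t -> mu.-integrable `]0, t] (EFin \o G C (q + 1)) by move=> _; exact: G_integrable.
have G0 t : 0 < t -> 0 <= G C (q + 1) t by move=> _; exact: G_ge0.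
have D0 : 0 <= D by rewrite addr_ge0//; apply: (cumulative_rate_ge0 G0 GI); exact: ltW.
have QD x r : q / 2 < x -> x < q + 1 -> 0 < r -> r <= p -> `|Q r x| <= D.
  move=> ux xv r0 rp; have x0 := lt_trans u0 ux.
  have [[_ _ _ c1 _] _] := hC x r ux xv r0 rp.
  rewrite /Q (le_trans (ler_normD _ _))// lerD//.
  apply: le_trans (cumulative_rate_nd G0 GI (ltW r0) rp).
  apply: le_trans (le_normr_Rintegral _ _) _ => //; first exact: kernel_mixed_integrable.
  apply: le_Rintegral => //.
  - by have := integrable_norm (kernel_mixed_integrable r x0).
  - exact: G_integrable.
  - by move=> s /=; rewrite in_itv/= => /andP[s0 sr]; apply: mC => //; exact: le_trans rp.
pose G' r := C * S (q + 1) r + (3 * (C * C) * C + C ^+ 2 * D).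
have dI : is_derive q 1 (fun q => cumulative_rate (k q) p) (cumulative_rate (k' q) p).
  apply: (@cumulative_rate_parameter R _ _ p q (q / 2) (q + 1) G') => //.
  - by move=> x ux _; apply: kernel_mixed_integrable; exact: lt_trans ux.
  - by move=> x r ux _ r0 _; apply: mixed_is_derive => //; exact: lt_trans ux.
  - by move=> r; rewrite !addr_ge0// !mulr_ge0// ?total_kernel_ge0// exprn_ge0.
  - have Si : mu.-integrable `]0, p] (EFin \o S (q + 1)) by exact: total_kernel_integrable.
    exact: (integrableD _ (integrableZl _ C Si) (cst_integrable (3 * (C * C) * C + C ^+ 2 * D) p)).
  - move=> x r ux xv r0 rp; have [[c0 c1 c2 _ /andP[s0 sC]] /andP[s1 sv]] := hC x r ux xv r0 rp.
    have hQ := QD x r ux xv r0 rp.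
    rewrite /k' /G' addrA (le_trans (ler_normD _ _))// lerD//.
      rewrite (le_trans (ler_normD _ _))// lerD//.
        by rewrite normrM (ger0_norm s1) ler_pM.
      rewrite normrM (ger0_norm s0) ler_pM// normrM (ger0_norm (ler0n _ 3)) ler_wpM2l// normrM.
      by rewrite ler_pM.
    by rewrite normrM ler_pM// normrX lerXn2r// nnegrE.
have dr : is_derive q 1 rate1 (rate2 q) by apply: (DeriveDef (rated' q0)); rewrite derive1E.
by have [] := is_deriveD dr dI.
Qed.

End kernel_second_derivatives.

(** * The classical equation *)

Lemma cone_near_t (R : realType) (c x t : R) : 0 < c -> cone c (x, t) ->
  \forall s \near t, cone c (x, s).
Proof.
move=> c0 [/= t0 xt]; have xt' : `|x| / c < t by rewrite ltr_pdivrMr// mulrC.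
near=> s; split => /=; first by near: s; exact: lt_nbhsr.
by rewrite mulrC -ltr_pdivrMr//; near: s; exact: lt_nbhsr.
Unshelve. all: by end_near. Qed.

Lemma cone_near_x (R : realType) (c x t : R) : cone c (x, t) ->
  \forall y \near x, cone c (y, t).
Proof.
move=> [/= t0]; rewrite ltr_norml => /andP[h1 h2].
near=> y; split => //=; rewrite ltr_norml; apply/andP; split; near: y.
  exact: lt_nbhsr.
exact: lt_nbhsl.
Unshelve. all: by end_near. Qed.

Section classical_wave.
Context (R : realType) (rate : R -> R).
Notation mu := (@lebesgue_measure R).
Hypothesis rate0 : forall t : R, 0 < t -> 0 <= rate t.
Hypothesis rateI : forall t : R, 0 < t -> mu.-integrable `]0, t] (EFin \o rate).
Hypothesis mass : forall T : R, 0 < T -> exists B : R, forall t, 0 < t -> t <= T ->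
  (\sum_(n <oo) \int[mu]_p sojourn_density rate n t p <= B%:E)%E.
Hypothesis rated : forall t : R, 0 < t -> derivable rate t 1.
Hypothesis rated' : forall t : R, 0 < t -> derivable (derive1 rate) t 1.
Hypothesis rate''c : forall t : R, 0 < t -> {for t, continuous (derive1 (derive1 rate))}.
Notation S := (total_kernel rate).
Notation rate1 := (derive1 rate).
Notation Q := (kernel_derive2 rate).
Notation k := (kernel_mixed rate).

Let ratec (t : R) : 0 < t -> {for t, continuous rate}.
Proof. by move=> /rated /derivable1_diffP/differentiable_continuous. Qed.
Let rate'c (t : R) : 0 < t -> {for t, continuous rate1}.
Proof. by move=> /rated' /derivable1_diffP/differentiable_continuous. Qed.

Definition kernel_derive1 (p q : R) : R := rate (p + q) * S q p.
Notation S1 := kernel_derive1.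

Let S11 (p q : R) : R := rate1 (p + q) * S q p + rate (p + q) * Q q p.

Let near_positive (p q : R) (A : R -> R -> Prop) : 0 < p -> 0 < q ->
  (forall p q, 0 < p -> 0 < q -> A p q) -> \forall z \near (p, q) : R * R, A z.1 z.2.
Proof.
move=> p0 q0 h; exists ([set y | 0 < y], [set y | 0 < y]) => /=.
  by split; exact: lt_nbhsr.
by move=> [y z] [/= y0 z0]; exact: h.
Qed.

Let sum_continuous (f : R -> R) (p q : R) : (forall t, 0 < t -> {for t, continuous f}) ->
  0 < p -> 0 < q -> {for (p, q), continuous (fun z : R * R => f (z.1 + z.2))}.
Proof.
move=> cf p0 q0; apply: (@continuous_comp _ _ _ (fun z : R * R => z.1 + z.2) f).
  by apply: cvgD; [exact: cvg_fst|exact: cvg_snd].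
by apply: cf; rewrite addr_gt0.
Qed.

Let swap_continuous (f : R -> R -> R) (p q : R) :
  {for (q, p), continuous (fun z : R * R => f z.1 z.2)} ->
  {for (p, q), continuous (fun z : R * R => f z.2 z.1)}.
Proof.
move=> cf; have cs : {for (p, q), continuous (fun z : R * R => (z.2, z.1))}.
  by apply: cvg_to_pair; [exact: cvg_snd|exact: cvg_fst].
exact: (@continuous_comp _ _ _ _ (fun z : R * R => f z.1 z.2) (p, q) cs cf).
Qed.

Let S_continuous (p q : R) : 0 < p -> 0 < q -> {for (p, q), continuous (fun z : R * R => S z.1 z.2)}.
Proof. by move=> p0 q0; exact: total_kernel_continuous. Qed.

Let S1_continuous (p q : R) : 0 < p -> 0 < q -> {for (p, q), continuous (fun z : R * R => S1 z.1 z.2)}.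
Proof.
move=> p0 q0; apply: cvgM; first exact: (sum_continuous ratec).
exact: (swap_continuous (S_continuous q0 p0)).
Qed.

Let k_continuous (p q : R) : 0 < p -> 0 < q -> {for (p, q), continuous (fun z : R * R => k z.2 z.1)}.
Proof.
move=> p0 q0; apply: cvgD; apply: cvgM.
- exact: (sum_continuous rate'c).
- exact: (swap_continuous (S_continuous q0 p0)).
- by apply: cvgM; exact: (sum_continuous ratec).
- exact: S_continuous.
Qed.

Let dS1 (p q : R) : 0 < p -> 0 < q -> is_derive p 1 (S^~ q) (S1 p q).
Proof. exact: total_kernel_derive1. Qed.

Let dS2 (p q : R) : 0 < p -> 0 < q -> is_derive q 1 (S p) (Q p q).
Proof. exact: total_kernel_derive2. Qed.

Let dsum (f : R -> R) (a r : R) : (forall t : R, 0 < t -> derivable f t 1) -> 0 < a + r ->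
  is_derive r 1 (fun r => f (a + r)) (derive1 f (a + r)).
Proof.
move=> df ar0.
have d1 : is_derive (a + r) 1 f (derive1 f (a + r)) by apply: (DeriveDef (df _ ar0)); rewrite derive1E.
have d2 : is_derive r 1 (fun r : R => a + r) 1.
  by have := is_deriveD (is_derive_cst a r 1) (is_derive_id r (1 : R)); rewrite add0r.
by have := is_derive1_comp d1 d2; rewrite mulr1.
Qed.

Let dS11 (p q : R) : 0 < p -> 0 < q -> is_derive p 1 (S1^~ q) (S11 p q).
Proof.
move=> p0 q0; have qp : 0 < q + p by rewrite addr_gt0.
have := is_deriveM (dsum rated qp) (dS2 q0 p0); rewrite (addrC q).
have E : (fun r => rate (q + r)) * S q = S1^~ q by apply/funext => r; rewrite /kernel_derive1 (addrC r).
rewrite E /GRing.scale/=; congr is_derive; rewrite /S11; ring.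
Qed.

Let dS12 (p q : R) : 0 < p -> 0 < q -> is_derive q 1 (S1 p) (k q p).
Proof.
move=> p0 q0; have pq : 0 < p + q by rewrite addr_gt0.
have := is_deriveM (dsum rated pq) (dS1 q0 p0).
rewrite /GRing.scale/=; congr is_derive; rewrite /kernel_mixed /kernel_derive1 (addrC q p); ring.
Qed.

Let pathS (p q a b s : R) : 0 < p + a * s -> 0 < q + b * s ->
  is_derive s 1 (fun s => S (p + a * s) (q + b * s))
    (a * S1 (p + a * s) (q + b * s) + Q (p + a * s) (q + b * s) * b).
Proof.
move=> p0 q0; apply: is_derive_affine_path; [|exact: S1_continuous|exact: dS2].
exact: (@near_positive _ _ (fun y z => is_derive y 1 (S^~ z) (S1 y z)) p0 q0 dS1).
Qed.

Let pathS1 (p q a b s : R) : 0 < p + a * s -> 0 < q + b * s ->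
  is_derive s 1 (fun s => S1 (p + a * s) (q + b * s))
    (b * k (q + b * s) (p + a * s) + S11 (p + a * s) (q + b * s) * a).
Proof.
move=> p0 q0; apply: (@is_derive_affine_path R (fun q p => S1 p q) k q p b a s).
- apply: (@near_positive _ _ (fun y z => is_derive y 1 (fun q => S1 z q) (k y z)) q0 p0) => y z y0 z0.
  exact: dS12.
- exact: (swap_continuous (f := fun x y => k y x) (k_continuous p0 q0)).
- exact: dS11.
Qed.

Let pathQ (p q a b s : R) : 0 < p + a * s -> 0 < q + b * s ->
  is_derive s 1 (fun s => Q (p + a * s) (q + b * s))
    (a * k (q + b * s) (p + a * s) + derive1 (Q (p + a * s)) (q + b * s) * b).
Proof.
move=> p0 q0; apply: (@is_derive_affine_path R Q (fun p q => k q p) p q a b s).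
- apply: (@near_positive _ _ (fun y z => is_derive y 1 (Q^~ z) (k z y)) p0 q0) => y z y0 z0.
  exact: kernel_derive2_derive1.
- exact: k_continuous.
- apply: DeriveDef; last by rewrite derive1E.
  exact: kernel_derive2_derivable2.
Qed.

Definition wave_dt (a x t : R) : R :=
  2^-1 * (S1 ((t + x / a) / 2) ((t - x / a) / 2) + Q ((t + x / a) / 2) ((t - x / a) / 2)).

Definition wave_dx (a x t : R) : R :=
  (2 * a)^-1 * (S1 ((t + x / a) / 2) ((t - x / a) / 2) - Q ((t + x / a) / 2) ((t - x / a) / 2)).

(** The pure second derivatives of S cancel in T_tt - a^2 T_xx and the two equal
    mixed derivatives remain. *)
Lemma wave_classical (a x t : R) : a != 0 -> cone `|a| (x, t) ->
  [/\ is_derive t 1 (wave rate a x) (wave_dt a x t),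
      is_derive x 1 ((wave rate a)^~ t) (wave_dx a x t) &
      exists wtt wxx, [/\ is_derive t 1 (wave_dt a x) wtt,
        is_derive x 1 ((wave_dx a)^~ t) wxx &
        wtt - a ^+ 2 * wxx = rate1 t * wave rate (- a) x t + rate t ^+ 2 * wave rate a x t]].
Proof.
move=> a0 /(wave_coordinates a0) [/= t0 u0 v0].
pose p := x / a / 2; pose b := (2 * a)^-1.
have tu s : (s + x / a) / 2 = p + 2^-1 * s by rewrite /p; field.
have tv s : (s - x / a) / 2 = - p + 2^-1 * s by rewrite /p; field.
have xu y : (t + y / a) / 2 = t / 2 + b * y by rewrite /b; field.
have xv y : (t - y / a) / 2 = t / 2 + - b * y by rewrite /b; field.
have ut : 0 < p + 2^-1 * t by rewrite -tu.
have vt : 0 < - p + 2^-1 * t by rewrite -tv.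
have ux : 0 < t / 2 + b * x by rewrite -xu.
have vx : 0 < t / 2 + - b * x by rewrite -xv.
have Et (f : R -> R -> R) : (fun s => f (p + 2^-1 * s) (- p + 2^-1 * s)) =
    (fun s => f ((s + x / a) / 2) ((s - x / a) / 2)) by apply/funext => s; rewrite tu tv.
have Ex (f : R -> R -> R) : (fun y => f (t / 2 + b * y) (t / 2 + - b * y)) =
    (fun y => f ((t + y / a) / 2) ((t - y / a) / 2)) by apply/funext => y; rewrite xu xv.
have dt0 := pathS ut vt; have dx0 := pathS ux vx.
have dt1 := pathS1 ut vt; have dx1 := pathS1 ux vx.
have dt2 := pathQ ut vt; have dx2 := pathQ ux vx.
rewrite !(Et, Ex) -!(tu, tv, xu, xv) in dt0 dx0 dt1 dx1 dt2 dx2.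
set u := (t + x / a) / 2 in dt0 dx0 dt1 dx1 dt2 dx2 u0 *.
set v := (t - x / a) / 2 in dt0 dx0 dt1 dx1 dt2 dx2 v0 *.
split.
- by move: dt0; congr is_derive; rewrite /wave_dt -/u -/v; ring.
- by move: dx0; congr is_derive; rewrite /wave_dx -/u -/v -/b; ring.
have dtt := is_deriveZ 2^-1 (is_deriveD dt1 dt2).
have dxx := is_deriveZ b (is_deriveB dx1 dx2).
eexists; eexists; split; [exact: dtt|exact: dxx|].
have uv : u + v = t by rewrite /u /v; field.
have wN : wave rate (- a) x t = S v u by rewrite /wave invrN mulrN opprK.
rewrite wN /GRing.scale/= /wave -/u -/v.
have -> : k v u = rate1 t * S v u + rate t ^+ 2 * S u v by rewrite /kernel_mixed uv.
move: (S11 u v) (derive1 (Q u) v) (S u v) (S v u) => A B C D; rewrite /b; field.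
exact: a0.
Qed.

End classical_wave.

Section classical_solution.
Context (R : realType) (c : R) (rate : R -> R).
Notation mu := (@lebesgue_measure R).
Hypothesis c0 : 0 < c.
Hypothesis rate0 : forall t : R, 0 < t -> 0 <= rate t.
Hypothesis rateI : forall t : R, 0 < t -> mu.-integrable `]0, t] (EFin \o rate).
Hypothesis rated : forall t : R, 0 < t -> derivable rate t 1.
Hypothesis rated' : forall t : R, 0 < t -> derivable (derive1 rate) t 1.
Hypothesis rate''c : forall t : R, 0 < t -> {for t, continuous (derive1 (derive1 rate))}.
Notation L := (cumulative_rate rate).
Notation third := (fun t => rate t / 3).
Hypothesis mass : forall T : R, 0 < T -> exists B : R, forall t, 0 < t -> t <= T ->
  (\sum_(n <oo) \int[mu]_p sojourn_density third n t p <= B%:E)%E.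

Let third'_is_derive (t : R) : 0 < t ->
  is_derive t 1 (derive1 third) (derive1 (derive1 rate) t / 3).
Proof.
move=> t0.
have d2 : is_derive t 1 (derive1 rate) (derive1 (derive1 rate) t).
  by apply: (DeriveDef (rated' t0)); rewrite [RHS]derive1E.
have d3 : is_derive t 1 (fun t => derive1 rate t / 3) (derive1 (derive1 rate) t / 3).
  have := is_deriveM d2 (is_derive_cst (3^-1 : R) t 1).
  rewrite /GRing.scale/=; congr is_derive; rewrite /GRing.scale/=; ring.
apply: near_eq_is_derive d3.
by near=> s; rewrite (third_derive1 rated)//; near: s; exact: lt_nbhsr.
Unshelve. all: by end_near. Qed.

Let third''_continuous (t : R) : 0 < t -> {for t, continuous (derive1 (derive1 third))}.
Proof.
move=> t0; apply: (near_continuous (g := fun t => derive1 (derive1 rate) t / 3)).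
  near=> s; have s0 : 0 < s by near: s; exact: lt_nbhsr.
  by rewrite derive1E; have [_ ->] := third'_is_derive s0.
by apply: cvgM; [exact: rate''c|exact: cvg_cst].
Unshelve. all: by end_near. Qed.

Let W (x t : R) := wave third c x t + wave third (- c) x t.
Let Wt (x t : R) := wave_dt third c x t + wave_dt third (- c) x t.
Let Wx (x t : R) := wave_dx third c x t + wave_dx third (- c) x t.

Let W_classical (x t : R) : cone c (x, t) ->
  [/\ is_derive t 1 (W x) (Wt x t), is_derive x 1 (W^~ t) (Wx x t) &
      exists wtt wxx, [/\ is_derive t 1 (Wt x) wtt, is_derive x 1 (Wx^~ t) wxx &
        wtt - c ^+ 2 * wxx = (derive1 rate t / 3 + (rate t / 3) ^+ 2) * W x t]].
Proof.
move=> cxt; have [t0 _] := cxt.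
have td (s : R) : 0 < s -> derivable third s 1 by move=> /(third_is_derive rated)[].
have td' (s : R) : 0 < s -> derivable (derive1 third) s 1 by move=> /third'_is_derive[].
have h := wave_classical (third_ge0 rate0) (third_integrable rateI) mass td td' third''_continuous.
have cn : c != 0 by rewrite gt_eqF.
have ncn : - c != 0 by rewrite oppr_eq0.
have cp : cone `|c| (x, t) by rewrite gtr0_norm.
have cm : cone `|- c| (x, t) by rewrite normrN gtr0_norm.
have [a1 a2 [wtt [wxx [a3 a4 a5]]]] := h c x t cn cp.
have [b1 b2 [wtt' [wxx' [b3 b4 b5]]]] := h (- c) x t ncn cm.
split; [exact: is_deriveD|exact: is_deriveD|].
exists (wtt + wtt'), (wxx + wxx'); split; [exact: is_deriveD|exact: is_deriveD|].
rewrite sqrrN opprK (third_derive1 rated t0) in b5; rewrite (third_derive1 rated t0) in a5.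
have -> : wtt + wtt' - c ^+ 2 * (wxx + wxx') = (wtt - c ^+ 2 * wxx) + (wtt' - c ^+ 2 * wxx') by ring.
rewrite a5 b5 /W; ring.
Qed.

Let e (t : R) := expR (- L t).
Let de (t : R) : 0 < t -> is_derive t 1 e (- rate t * e t).
Proof. exact: survival_is_derive. Qed.

Lemma diagonal_classical_solution (f : R -> R -> R) :
  (forall x t, cone c (x, t) -> f x t = diagonal_profile c rate x t) ->
  classical_solution c rate f.
Proof.
move=> fE; pose m := (8 * c)^-1.
have fW x t : cone c (x, t) -> f x t = m *: (e t * W x t).
  by move=> /fE ->; rewrite diagonal_profile_wave /GRing.scale/= /m mulrCA -mulrA.
pose ft x t := m *: (e t * (Wt x t - rate t * W x t)).
pose fx x t := (m * e t) *: Wx x t.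
have Dt x t : cone c (x, t) -> is_derive t 1 (f x) (ft x t).
  move=> cxt; have [t0 _] := cxt; have [w1 _ _] := W_classical cxt.
  have d := is_deriveZ m (is_deriveM (de t0) w1).
  have nf : \forall s \near t, (m \*: (e * W x)) s = f x s.
    by near=> s; rewrite fW//; near: s; exact: cone_near_t.
  have := near_eq_is_derive nf d.
  congr is_derive; rewrite /ft /GRing.scale/=; ring.
have Dx x t : cone c (x, t) -> is_derive x 1 (f^~ t) (fx x t).
  move=> cxt; have [t0 _] := cxt; have [_ w1 _] := W_classical cxt.
  have nf : \forall y \near x, ((m * e t) \*: (W^~ t)) y = f y t.
    near=> y; rewrite fW; last by near: y; exact: cone_near_x.
    by rewrite /GRing.scale/= mulrA.
  exact: near_eq_is_derive nf (is_deriveZ (m * e t) w1).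
have dtE x t : cone c (x, t) -> dt f x t = ft x t.
  by move=> /Dt [_ fd]; rewrite /dt derive1E.
have dxE x t : cone c (x, t) -> dx f x t = fx x t.
  by move=> /Dx [_ fd]; rewrite /dx derive1E.
move=> x t cxt; have [t0 _] := cxt; have [w1 w2 [wtt [wxx [w3 w4 w5]]]] := W_classical cxt.
have dr : is_derive t 1 rate (derive1 rate t) by exact: rate_is_derive.
have Dtt : is_derive t 1 (dt f x) (m * e t * (wtt - 2 * rate t * Wt x t
    - derive1 rate t * W x t + rate t ^+ 2 * W x t)).
  have d := is_deriveZ m (is_deriveM (de t0) (is_deriveB w3 (is_deriveM dr w1))).
  have nf : \forall s \near t, (m \*: (e * (Wt x - rate * W x))) s = dt f x s.
    by near=> s; rewrite dtE//; near: s; exact: cone_near_t.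
  have := near_eq_is_derive nf d; congr is_derive; rewrite /GRing.scale/=.
  rewrite [X in _ + X * _](_ : _ = Wt x t - rate t * W x t); last exact: erefl.
  ring.
have Dxx : is_derive x 1 ((dx f)^~ t) (m * e t * wxx).
  have nf : \forall y \near x, ((m * e t) \*: (Wx^~ t)) y = dx f y t.
    by near=> y; rewrite dxE//; near: y; exact: cone_near_x.
  exact: near_eq_is_derive nf (is_deriveZ (m * e t) w4).
split.
- by have [] := Dt _ _ cxt.
- by have [] := Dtt.
- by have [] := Dx _ _ cxt.
- by have [] := Dxx.
have -> : dt (dt f) x t = m * e t * (wtt - 2 * rate t * Wt x t
    - derive1 rate t * W x t + rate t ^+ 2 * W x t).
  by have [_ d] := Dtt; rewrite {1}/dt derive1E.
have -> : dx (dx f) x t = m * e t * wxx by have [_ d] := Dxx; rewrite {1}/dx derive1E.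
rewrite (dtE _ _ cxt) (fW _ _ cxt) /ft /GRing.scale/= /zero_order_coef.
have -> : wtt = c ^+ 2 * wxx + (derive1 rate t / 3 + (rate t / 3) ^+ 2) * W x t.
  by rewrite -w5 addrC subrK.
field.
Unshelve. all: by end_near. Qed.

End classical_solution.

(** * Identification of the densities *)

Section identification.
Context (R : realType).
Notation mu := (@lebesgue_measure R).

Lemma cone_near (v : R) (z : R * R) : cone v z -> \forall y \near z, cone v y.
Proof.
move=> [z0 zv].
have c2 : {for z, continuous (fun z : R * R => z.2)} by exact: cvg_snd.
have c1 : {for z, continuous (fun z : R * R => v * z.2 - `|z.1|)}.
  apply: cvgB; first by apply: cvgM; [exact: cvg_cst|exact: c2].
  by apply: cvg_norm; exact: cvg_fst.
have h1 : \forall y \near z, 0 < y.2 := cvgr_gt _ c2 _ z0.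
have h2 : \forall y \near z, 0 < v * y.2 - `|y.1|.
  by apply: (cvgr_gt _ c1); rewrite subr_gt0.
by near=> y; split; [near: y; exact: h1|rewrite -subr_gt0; near: y; exact: h2].
Unshelve. all: by end_near. Qed.

Lemma cone_section_continuous (v : R) (g : R -> R -> R) (t : R) : continuous_on_cone v g -> 0 < t ->
  {in `](- (v * t)), (v * t)[, forall x, {for x, continuous (g^~ t)}}.
Proof.
move=> cg t0 x; rewrite in_itv/= -ltr_norml => xv.
have cx : {for x, continuous (fun x : R => (x, t))} by apply: cvg_to_pair; [exact: cvg_id|exact: cvg_cst].
exact: (@continuous_comp _ _ _ _ (fun z : R * R => g z.1 z.2) x cx (cg (x, t) (conj t0 xv))).
Qed.

Section profiles.
Variables (v : R) (rate : R -> R).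
Hypothesis v0 : 0 < v.
Hypothesis rate0 : forall t : R, 0 < t -> 0 <= rate t.
Hypothesis rateI : forall t : R, 0 < t -> mu.-integrable `]0, t] (EFin \o rate).
Hypothesis ratec : forall t : R, 0 < t -> {for t, continuous rate}.
Hypothesis mass : forall T : R, 0 < T -> exists B : R, forall t, 0 < t -> t <= T ->
  (\sum_(n <oo) \int[mu]_p sojourn_density rate n t p <= B%:E)%E.

Lemma cone_profile_continuous : continuous_on_cone v (cone_profile rate v).
Proof.
move=> z cz; have cp : cone `|v| z by rewrite gtr0_norm.
have cm : cone `|- v| z by rewrite normrN gtr0_norm.
have vn : v != 0 by rewrite gt_eqF.
have vm : - v != 0 by rewrite oppr_eq0.
have h1 := wave_continuous rate0 rateI ratec mass vn cp.
have h2 := wave_continuous rate0 rateI ratec mass vm cm.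
apply: (near_continuous (g := fun z : R * R => wave rate v z.1 z.2 + wave rate (- v) z.1 z.2)).
  by near=> y; rewrite /cone_profile /wave invrN mulrN opprK.
by apply: cvgD; [exact: h1|exact: h2].
Unshelve. all: by end_near. Qed.

Lemma survival_continuous (a : R) (z : R * R) : 0 < z.2 ->
  {for z, continuous (fun z : R * R => expR (- cumulative_rate rate z.2) / a)}.
Proof.
case: z => x t /= t0; apply: cvgM; last exact: cvg_cst.
have cL : {for t, continuous (fun t => expR (- cumulative_rate rate t))}.
  apply: (@continuous_comp _ _ _ (fun t => - cumulative_rate rate t) expR); last exact: continuous_expR.
  by apply: cvgN; exact: (cumulative_rate_continuous_at rateI).
exact: (cvg_comp _ _ (@cvg_snd R R (nbhs x) (nbhs t) _) cL).
Qed.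

Lemma telegraph_profile_continuous : continuous_on_cone v (telegraph_profile v rate).
Proof.
move=> z cz; have [z0 _] := cz.
apply: (near_continuous (g := fun z : R * R =>
  expR (- cumulative_rate rate z.2) / (4 * v) * cone_profile rate v z.1 z.2)).
  by apply: filterS (cone_near cz) => y [_ yv]; rewrite /telegraph_profile yv.
by apply: cvgM; [exact: survival_continuous|exact: cone_profile_continuous].
Qed.

Lemma telegraph_profile_extension (x t : R) : telegraph_profile v rate x t =
  expR (- cumulative_rate rate t) / (4 * v) * fine (cone_extension rate v t x).
Proof. by rewrite /telegraph_profile /cone_extension; case: ifP => //= _; rewrite mulr0. Qed.

Lemma telegraph_profile_measurable (t : R) : measurable_fun setT (fun x => telegraph_profile v rate x t).
Proof.
rewrite (_ : (fun x => _) = fun x => expR (- cumulative_rate rate t) / (4 * v) * fine (cone_extension rate v t x)).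
  apply: measurable_funM => //; apply: (measurableT_comp (f := fine)) => //.
  exact: (cone_extension_measurable rate0 rateI ratec mass).
by apply/funext => x; exact: telegraph_profile_extension.
Qed.

Lemma telegraph_profile_ge0 (x t : R) : 0 <= telegraph_profile v rate x t.
Proof.
rewrite telegraph_profile_extension mulr_ge0//; first by rewrite divr_ge0 ?expR_ge0// mulr_ge0// ltW.
by rewrite fine_ge0// (cone_extension_ge0 rate0).
Qed.

Section telegraph_component.
Context (d : measure_display) (Om : measurableType d) (P : probability Om R) (W : R -> Om -> R).
Hypothesis hW : telegraph_process P v rate W.

Lemma telegraph_law_off_null (t : R) (A S : set R) : 0 < t -> measurable A -> measurable S ->
  mu S = 0%E -> ~ (A `\` S) (v * t) -> ~ (A `\` S) (- (v * t)) ->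
  P [set w | (A `\` S) (W t w)] = (\int[mu]_(x in A) (telegraph_profile v rate x t)%:E)%E.
Proof.
move=> t0 mA mS S0 A1 A2; have [N [B [hN hB hI hXW]]] := hW.
have mAS : measurable (A `\` S) by exact: measurableD.
have := telegraph_law v0 rate0 rateI ratec mass hN hB hI hXW t0 mAS A1 A2.
move=> ->; symmetry; apply: ge0_negligible_integral => //.
  by apply/measurable_EFinP; apply: measurable_funTS; exact: telegraph_profile_measurable.
by move=> x _; rewrite lee_fin telegraph_profile_ge0.
Qed.

Lemma telegraph_component_exists : ac_component_density P v W (telegraph_profile v rate).
Proof.
split; first exact: telegraph_profile_continuous.
move=> t t0; split; first exact: telegraph_profile_measurable.
(* The singular part comes from the paths without events. *)
pose S : set R := [set v * t] `|` [set - (v * t)].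
have mS : measurable S by apply: measurableU; exact: measurable_set1.
have S0 : mu S = 0%E.
  apply: countable_lebesgue_measure0; apply: finite_set_countable.
  by rewrite finite_setU; split; exact: finite_set1.
exists S; split => // A mA; apply: telegraph_law_off_null => //.
  by move=> [_ nS]; apply: nS; left.
by move=> [_ nS]; apply: nS; right.
Qed.

(** The null set carrying the singular part may depend on p, but removing a null
    set from an interval changes neither integral. *)
Lemma telegraph_component_unique (p : R -> R -> R) : ac_component_density P v W p ->
  forall x t : R, cone v (x, t) -> p x t = telegraph_profile v rate x t.
Proof.
move=> [cp hp] x t [/= t0 xv]; have [_ [S [mS S0 hS]]] := hp t t0.
apply: (continuous_density_unique (cone_section_continuous cp t0)
  (cone_section_continuous telegraph_profile_continuous t0)); last by rewrite in_itv/= -ltr_norml.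
move=> a b va ab bv; rewrite -hS//; apply: telegraph_law_off_null => // -[/=]; rewrite in_itv/= => /andP[h1 h2] _.
  by move: (le_lt_trans h2 bv); rewrite ltxx.
by move: (lt_le_trans va h1); rewrite ltxx.
Qed.

End telegraph_component.

End profiles.

Lemma cumulative_rate_third (rate : R -> R) (t : R) : mu.-integrable `]0, t] (EFin \o rate) ->
  cumulative_rate (fun t => rate t / 3) t = cumulative_rate rate t / 3.
Proof. by move=> I; apply: etrans (RintegralZr _ _ I) _. Qed.

Lemma diagonal_telegraph (c : R) (rate : R -> R) (x t : R) : 0 < c -> `|x| < c * t ->
  mu.-integrable `]0, t] (EFin \o rate) ->
  diagonal_profile c rate x t = expR (- (2 / 3 * cumulative_rate rate t)) / 4
    * telegraph_profile (c / 2) (fun t => rate t / 3) (x / 2) t.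
Proof.
move=> c0 xc I; have cn : c != 0 by rewrite gt_eqF.
have xc2 : `|x / 2| < c / 2 * t.
  by rewrite normrM (ger0_norm (_ : 0 <= 2^-1)) ?invr_ge0// mulrAC ltr_pM2r// invr_gt0.
rewrite /telegraph_profile xc2 cumulative_rate_third// /diagonal_profile.
have -> : cone_profile (fun t => rate t / 3) (c / 2) (x / 2) t = cone_profile (fun t => rate t / 3) c x t.
  have -> : cone_profile (fun t => rate t / 3) (c / 2) (x / 2) t =
    let y := x / 2 / (c / 2) in total_kernel (fun t => rate t / 3) ((t + y) / 2) ((t - y) / 2)
      + total_kernel (fun t => rate t / 3) ((t - y) / 2) ((t + y) / 2) by [].
  by have -> : x / 2 / (c / 2) = x / c by field.
rewrite (_ : - cumulative_rate rate t = - (2 / 3 * cumulative_rate rate t) + - (cumulative_rate rate t / 3)).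
  by rewrite expRD; field.
by field.
Qed.

End identification.

Theorem proposition3p2 (R : realType) (c : R) (lambda : R -> R)
    (hc : 0 < c) (hlambda : C1_rate lambda)
    (d : measure_display) (Om : measurableType d) (P : probability Om R)
    (X Y : R -> Om -> R)
    (hXY : reflecting_orthogonal_motion P c lambda X Y) :
  (exists f : R -> R -> R, diagonal_density P c X Y f) /\
  forall f : R -> R -> R, diagonal_density P c X Y f ->
    [/\ distributional_solution c lambda f /\
        (C2_rate lambda -> classical_solution c lambda f),
        forall x t : R, 0 < t -> `|x| < c * t -> 0 <= f x t,
        forall t : R, 0 < t ->
          (\int[@lebesgue_measure R]_(x in `](- (c * t))%R, (c * t)%R[)
             (f x t)%:E)%E =
          (2%:R^-1 * (expR (- (2%:R / 3%:R * cumulative_rate lambda t))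
                      - expR (- cumulative_rate lambda t)))%:E &
        forall (d' : measure_display) (Om' : measurableType d')
               (P' : probability Om' R) (W : R -> Om' -> R),
          telegraph_process P' (c / 2%:R) (fun t => lambda t / 3%:R) W ->
          (exists p : R -> R -> R, ac_component_density P' (c / 2%:R) W p) /\
          forall p : R -> R -> R, ac_component_density P' (c / 2%:R) W p ->
            forall x t : R, 0 < t -> `|x| < c * t ->
              f x t = expR (- (2%:R / 3%:R * cumulative_rate lambda t)) / 4%:R
                      * p (x / 2%:R) t].
Proof.
have [rate0 rated rate'c rateI] := hlambda.
have ratec := rate_derivable_continuous rated.
have [N [D [hN hD hI hX]]] := hXY.
have mass := third_mass rate0 rateI hN.
have t3 := third_ge0 rate0; have tI := third_integrable rateI; have tc := third_continuous ratec.
have cf0 : continuous_on_cone c (diagonal_profile c lambda).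
  move=> z cz; have [z0 _] := cz.
  by apply: cvgM; [exact: survival_continuous|exact: cone_profile_continuous].
have law0 t A := @motion_density R c lambda hc rate0 rateI ratec d Om P N D hN hD hI X Y hX t A.
split.
  exists (diagonal_profile c lambda); split => // t A t0 mA AC; exact: law0.
move=> f [cf hf].
have fE x t : cone c (x, t) -> f x t = diagonal_profile c lambda x t.
  move=> [/= t0 xc].
  apply: (continuous_density_unique (cone_section_continuous cf t0)
    (cone_section_continuous cf0 t0)); last by rewrite in_itv/= -ltr_norml.
  move=> a b va ab bv.
  have sub : `[a, b] `<=` `](- (c * t)), (c * t)[.
    by move=> y /=; rewrite !in_itv/= => /andP[h1 h2]; apply/andP; split; lra.
  by rewrite -hf// -law0.
split.
- split; first exact: (diagonal_weak_solution hc rate0 rateI rated rate'c mass fE).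
  move=> [_ rated' rate''c].
  exact: (diagonal_classical_solution hc rate0 rateI rated rated' rate''c mass fE).
- move=> x t t0 xc; rewrite fE//; rewrite mulr_ge0//.
    by rewrite divr_ge0 ?expR_ge0// mulr_ge0// ltW.
  by rewrite addr_ge0// (total_kernel_ge0 t3).
- move=> t t0; rewrite -(diagonal_mass hc rate0 rateI ratec hN t0).
  apply: eq_integral => x; rewrite inE /= in_itv/= -ltr_norml => xc.
  by rewrite fE.
- move=> d' Om' P' W hW; have c20 : 0 < c / 2 by rewrite divr_gt0.
  split.
    exists (telegraph_profile (c / 2) (fun t => lambda t / 3)).
    exact: (telegraph_component_exists c20 t3 tI tc mass hW).
  move=> p hp x t t0 xc; rewrite fE// (diagonal_telegraph hc xc (rateI t t0)).
  rewrite (telegraph_component_unique c20 t3 tI tc mass hW hp)//; split => //=.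
  by rewrite normrM (ger0_norm (_ : 0 <= 2^-1)) ?invr_ge0// mulrAC ltr_pM2r// invr_gt0.
Qed.
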